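(* Let $E$ be a directed graph, $R$ a subset of $E^0_{\mathrm{reg}}$ and $N:E^1\to(1,\infty)$ a function, and let $\sigma$ be the strongly continuous one-parameter group of automorphisms of $C^*(E,R)$ such that $\sigma_t(s_e)=(N(e))^{it}s_e$ and $\sigma_t(p_v)=p_v$ for all $e\in E^1$ and $v\in E^0$. Then a ground state $\psi$ of $(C^*(E,R),\sigma)$ is a KMS$_\infty$ state if and only if $\beta_v<\infty$ for every $v\in E^0$ for which $\psi(p_v)\ne0$.
   Context: **Graphs.** A directed graph $E=(E^0,E^1,s,r)$ consists of arbitrary (not necessarily countable) sets $E^0$ (vertices), $E^1$ (edges) and maps $s,r:E^1\to E^0$. A path of length $n\ge1$ is a sequence $u=e_1\cdots e_n$ of edges with $r(e_i)=s(e_{i+1})$, with $s(u)=s(e_1)$, $r(u)=r(e_n)$; vertices are paths of length $0$ with $s(v)=r(v)=v$. $E^*$ is the set of all finite paths, $E^*v=\{u\in E^*:r(u)=v\}$. $vE^1=\{e\in E^1:s(e)=v\}$; $E^0_{\mathrm{reg}}=\{v: vE^1\text{ finite and non-empty}\}$. **Relative graph algebra.** $C^*(E,R)$ is the universal $C^*$-algebra generated by partial isometries $(s_e)_{e\in E^1}$ with mutually orthogonal range projections and mutually orthogonal projections $(p_v)_{v\in E^0}$ satisfying $s_e^*s_e=p_{r(e)}$ and $s_es_e^*\le p_{s(e)}$ for all $e\in E^1$, and $p_v=\sum_{e\in vE^1}s_es_e^*$ for $v\in R$. **KMS and ground states.** For a $C^*$-algebra $A$ with dynamics $\sigma:\mathbb{R}\to\operatorname{Aut}(A)$,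 $a\in A$ is analytic if $t\mapsto\sigma_t(a)$ extends to an entire function. For $\beta\in(0,\infty)$ a KMS$_\beta$ state is a state $\psi$ with $\psi(ab)=\psi(b\sigma_{i\beta}(a))$ for all analytic $a,b$. A KMS$_0$ state is a $\sigma$-invariant state with $\psi(ab)=\psi(ba)$ for all $a,b$. A ground state is a state $\psi$ such that for all analytic $a,b$ the entire function $z\mapsto\psi(a\sigma_z(b))$ is bounded on the upper half-plane. A ground state is called a KMS$_\infty$ state if it is the weak* limit of a sequence of KMS$_{\beta_n}$ states with $\beta_n\to\infty$. **Critical inverse temperatures.** Extend $N$ to $E^*$ by $N(v)=1$ for $v\in E^0$ and $N(e_1\cdots e_n)=N(e_1)\cdots N(e_n)$. For $v\in E^0$ let $Z_v(\beta)=\sum_{u\in E^*v}N(u)^{-\beta}\in[0,\infty]$. If there is $\beta\in[0,\infty)$ with $Z_v(\beta)<\infty$, set $\beta_v=\inf\{\beta\in[0,\infty):Z_v(\beta)<\infty\}$; otherwise $\beta_v=\infty$. *)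

(* Defs.v *)
From HB Require Import structures.
From mathcomp Require Import all_boot all_order all_algebra.
From mathcomp Require Import complex.
From mathcomp Require Import all_classical all_reals all_analysis.
Import Order.TTheory GRing.Theory Num.Theory.
Import numFieldNormedType.Exports.

Set Implicit Arguments.
Unset Strict Implicit.
Unset Printing Implicit Defensive.

Local Open Scope classical_set_scope.
Local Open Scope ring_scope.
Local Open Scope complex_scope.

(* C*-algebras are not assumed unital, so the product cannot be the one of a
   MathComp ring.  The norm of a [normedModType R[i]] takes its values in
   [R[i]], whose order is [x <= y] iff [y - x] is a nonnegative real. *)
HB.mixin Record CompleteNormedModule_isCStar (R : realType) A
    of CompleteNormedModule R[i] A := {
  cmul : A -> A -> A;
  cstar : A -> A;
  cmulA : associative cmul;
  cmulDl : left_distributive cmul +%R;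
  cmulDr : right_distributive cmul +%R;
  cmulZl : forall (k : R[i]) (a b : A), cmul (k *: a) b = k *: cmul a b;
  cmulZr : forall (k : R[i]) (a b : A), cmul a (k *: b) = k *: cmul a b;
  cstarK : involutive cstar;
  cstarD : {morph cstar : a b / a + b};
  cstarZ : forall (k : R[i]) (a : A), cstar (k *: a) = (k^*)%C *: cstar a;
  cstarM : forall a b, cstar (cmul a b) = cmul (cstar b) (cstar a);
  cnormM : forall a b, `|cmul a b| <= `|a| * `|b|;
  cnorm_star : forall a, `|cmul (cstar a) a| = `|a| ^+ 2
}.

#[short(type="cstarAlgType")]
HB.structure Definition CStar (R : realType) :=
  { A of CompleteNormedModule_isCStar R A & CompleteNormedModule R[i] A }.

Declare Scope cstar_scope.
Delimit Scope cstar_scope with CS.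
Notation "a ** b" := (cmul a b) (at level 40, left associativity) : cstar_scope.
Notation "a ^#" := (cstar a) (at level 2, format "a ^#") : cstar_scope.
Local Open Scope cstar_scope.

Section CStarTheory.
Variable R : realType.
Implicit Types A B : cstarAlgType R.

Definition cpos A (a : A) : Prop := exists c : A, a = c^# ** c.

Definition cle A (a b : A) : Prop := cpos (b - a).

Definition projection A (p : A) : Prop := p^# = p /\ p ** p = p.

Definition partial_isometry A (x : A) : Prop := projection (x^# ** x).

Definition star_hom A B (f : A -> B) : Prop :=
  [/\ linear f, forall a b, f (a ** b) = f a ** f b
    & forall a, f a^# = (f a)^#].

Definition closed_star_subalgebra A (D : set A) : Prop :=
  [/\ closed D, D 0, forall (k : R[i]) a b, D a -> D b -> D (k *: a + b),
      forall a b, D a -> D b -> D (a ** b) & forall a, D a -> D a^#].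

(* If the values of [psi] on the unit ball are unbounded then the supremum is
   [0] by convention, so the last clause says that [psi] is bounded of norm 1. *)
Definition state A (psi : A -> R[i]) : Prop :=
  [/\ scalar psi, forall a, cpos a -> 0 <= psi a
    & sup [set complex.Re `|psi a| | a in [set a : A | `|a| <= 1]] = 1].

Definition dynamics A (sigma : R -> A -> A) : Prop :=
  [/\ forall t, star_hom (sigma t) /\ bijective (sigma t),
      forall a, sigma 0 a = a,
      forall t u a, sigma (t + u) a = sigma t (sigma u a)
    & forall a, continuous (sigma ^~ a)].

(* [R[i]] by itself has no topology in the libraries, [R[i]^o] does. *)
Definition entire A (f : R[i] -> A) : Prop :=
  forall z : R[i], derivable (f : R[i]^o -> A) z 1.

(* Entire extensions are unique, so quantifying over them below is the same as
   using the notation [sigma_z(a)]. *)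
Definition entire_extension A (sigma : R -> A -> A) (a : A) (f : R[i] -> A)
    : Prop :=
  entire f /\ forall t : R, f t%:C = sigma t a.

Definition analytic A (sigma : R -> A -> A) (a : A) : Prop :=
  exists f, entire_extension sigma a f.

Definition kms_state A (sigma : R -> A -> A) (beta : R) (psi : A -> R[i])
    : Prop :=
  [/\ state psi, 0 <= beta,
      beta = 0 -> (forall t a, psi (sigma t a) = psi a) /\
                  (forall a b, psi (a ** b) = psi (b ** a))
    & 0 < beta -> forall a b f, entire_extension sigma a f ->
        analytic sigma b -> psi (a ** b) = psi (b ** f (0 +i* beta))].

Definition ground_state A (sigma : R -> A -> A) (psi : A -> R[i]) : Prop :=
  state psi /\
  forall a b f, analytic sigma a -> entire_extension sigma b f ->
    exists M : R, forall z : R[i], 0 < complex.Im z ->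
      `|psi (a ** f z)| <= M%:C.

Definition kms_infty_state A (sigma : R -> A -> A) (psi : A -> R[i]) : Prop :=
  ground_state sigma psi /\
  exists (beta : nat -> R) (phi : nat -> A -> R[i]),
    [/\ forall n, kms_state sigma (beta n) (phi n),
        beta n @[n --> \oo] --> +oo
      & forall a, (phi n a : R[i]^o) @[n --> \oo] --> (psi a : R[i]^o)].

(* [x ^ (i t)] for [x > 0]. *)
Definition powRi (x t : R) : R[i] := cos (t * ln x) +i* sin (t * ln x).

End CStarTheory.

(* Every type carries a choiceType structure classically, so the vertex and
   edge sets are arbitrary. *)
Record digraph := Digraph {
  vertex : choiceType;
  edge : choiceType;
  src : edge -> vertex;
  rng : edge -> vertex }.

Section Graph.
Variable E : digraph.

Definition out_edges (v : vertex E) : set (edge E) := [set e | src e = v].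

Definition regular : set (vertex E) :=
  [set v | finite_set (out_edges v) /\ out_edges v !=set0].

(* The pair [(v, s)] stands for the path with source [v] and edges [s]; [s] is
   empty for the path [v] of length 0. *)
Definition is_path (u : vertex E * seq (edge E)) : bool :=
  if u.2 is e :: s then
    (src e == u.1) && path (fun e1 e2 => rng e1 == src e2) e s
  else true.

Definition path_rng (u : vertex E * seq (edge E)) : vertex E :=
  last u.1 (map (@rng E) u.2).

Definition paths_to (v : vertex E) : set (vertex E * seq (edge E)) :=
  [set u | is_path u /\ path_rng u = v].

Variable R : realType.

Definition path_weight (N : edge E -> R) (u : vertex E * seq (edge E)) : R :=
  \prod_(e <- u.2) N e.

Definition partition_function (N : edge E -> R) (v : vertex E) (beta : R)
    : \bar R :=
  \esum_(u in paths_to v) (path_weight N u `^ (- beta))%:E.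

(* The infimum in [\bar R] of the empty set is [+oo]. *)
Definition critical_beta (N : edge E -> R) (v : vertex E) : \bar R :=
  ereal_inf [set beta%:E | beta in
    [set beta : R | 0 <= beta /\ (partition_function N v beta < +oo)%E]].

Definition graph_family (V : set (vertex E)) (A : cstarAlgType R)
    (s : edge E -> A) (p : vertex E -> A) : Prop :=
  [/\ (forall e, partial_isometry (s e)) /\
      (forall e f, e <> f -> (s e ** (s e)^#) ** (s f ** (s f)^#) = 0),
      (forall v, projection (p v)) /\
      (forall v w, v <> w -> p v ** p w = 0),
      forall e, (s e)^# ** s e = p (rng e),
      forall e, cle (s e ** (s e)^#) (p (src e))
    & forall v, V v -> p v = \sum_(e \in out_edges v) (s e ** (s e)^#)].

(* [A], with the generators [s] and [p], is C*(E, V). *)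
Definition is_relative_graph_algebra (V : set (vertex E)) (A : cstarAlgType R)
    (s : edge E -> A) (p : vertex E -> A) : Prop :=
  [/\ graph_family V s p,
      forall D : set A, closed_star_subalgebra D ->
        (forall e, D (s e)) -> (forall v, D (p v)) -> D = setT
    & forall (B : cstarAlgType R) (s' : edge E -> B) (p' : vertex E -> B),
        graph_family V s' p' ->
        exists f : A -> B, [/\ star_hom f, forall e, f (s e) = s' e
                             & forall v, f (p v) = p' v]].

End Graph.

(* Main.v *)
(* If phi is a KMS_b state then m_w = phi(p_w) is subinvariant: the sum of
   N(e)^-b m_{r(e)} over the edges e leaving w is at most m_w. Passing to b + 1 makes
   the inequality strict at every v with m_v > 0, with some defect d > 0, and
   iterating it gives d Z_v(b + 1) <= sum_w m_w <= 1. So a KMS_infty state charges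
   only vertices with finite critical value.

   Conversely, a ground state psi kills s_e A and A s_e^*, because s_e^* is an
   eigenvector of the dynamics that grows exponentially in the upper half-plane.
   A bounded functional killing them is determined by its values on the vertex
   projections. For a finite set F of vertices with psi(p_v) <> 0 and a large b, the
   functional Phi(a) = sum_{v in F} sum_{u in E^*v} N(u)^-b psi(s_u^* a s_u)
   satisfies Phi(s_e a) = N(e)^-b Phi(a s_e) and commutes with the p_v; as the KMS
   condition is stable under multiplication by generators, Phi is a multiple of a
   KMS_b state. When F grows and b tends to infinity along a sequence,
   Phi(s_e a) -> 0 and Phi(p_v) -> psi(p_v), hence Phi -> psi.

   The KMS condition involves arbitrary entire extensions, so their uniqueness is
   needed: an entire function g constant on R is constant. Goursat's bisection
   gives Cauchy's theorem for rectangles, applied to g times a polynomial kernel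
   that peaks at the point considered. *)

Require Import Defs.
From mathcomp Require Import all_boot all_order all_algebra.
From mathcomp Require Import complex.
From mathcomp Require Import all_classical all_reals all_analysis.
From mathcomp Require Import ring lra.
Import Order.TTheory GRing.Theory Num.Theory.
Import numFieldNormedType.Exports.

Set Implicit Arguments.
Unset Strict Implicit.
Unset Printing Implicit Defensive.

Local Open Scope classical_set_scope.
Local Open Scope ring_scope.

(** * Cauchy's theorem for rectangles *)

Section Goursat.
Context {R : realType}.
Implicit Types (a b c d x y : R).

(** [A] may lack a unit, and [s_e s_e^# <= p_v] is available only as the existence of some [c] with
    difference [c^# c]. The relation [p_{s(e)} s_e = s_e] is therefore replaced by its image under
    positive functionals, where Cauchy-Schwarz proves it; hence the many statements under a
    functional with spare factors on both sides. The bound of [phi(p a p)] by [phi(p)] and the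
    contractivity of the automorphisms both rest on one square root, obtained as a fixed point.

    The norm of [Phi] cannot be read off at a unit: it is the sum over [F] of [psi(p_v) Z_v(b)],
    approached on finite sums of vertex projections. For the normalised functionals to converge to
    [psi] and not to a multiple of it, the numbers [psi(p_v)] must add up to 1; this comes out only
    at the end, because the limit [psi] of the [Phi] has norm at most that total.

    The KMS condition is carried from generator to generator starting at the [p_v], where it says
    that [phi(p_v sigma_z(a))], constant on the real line by invariance, has the same value at
    [z = ib]. Uniqueness of entire extensions enters only there. Invariance of [Phi] comes from that
    of [psi]. *)

Lemma mean_value_ineq (F f : R -> R) a b M : a <= b ->
  (forall x, a <= x <= b -> is_derive x 1 F (f x)) ->
  (forall x, a <= x <= b -> `|f x| <= M) ->
  `|F b - F a| <= M * (b - a).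
Proof.
move=> ab dF fM.
have cF : {within `[a, b], continuous F}.
  apply: derivable_within_continuous => x; rewrite in_itv/= => xab.
  by have := dF _ xab => -[].
have [|x] := @MVT_segment _ F f a b ab _ cF.
  by move=> x; rewrite in_itv/= => /andP[ax xb]; apply: dF; rewrite !ltW.
rewrite in_itv/= => xab ->; rewrite normrM (ger0_norm (_ : 0 <= b - a)) ?subr_ge0//.
by rewrite ler_wpM2r ?subr_ge0// fM.
Qed.

Lemma mean_value_ge (F f : R -> R) a b m : a <= b ->
  (forall x, a <= x <= b -> is_derive x 1 F (f x)) ->
  (forall x, a <= x <= b -> m <= f x) ->
  m * (b - a) <= F b - F a.
Proof.
move=> ab dF fM.
have cF : {within `[a, b], continuous F}.
  apply: derivable_within_continuous => x; rewrite in_itv/= => xab.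
  by have := dF _ xab => -[].
have [|x] := @MVT_segment _ F f a b ab _ cF.
  by move=> x; rewrite in_itv/= => /andP[ax xb]; apply: dF; rewrite !ltW.
rewrite in_itv/= => xab ->.
by rewrite ler_wpM2r ?subr_ge0// fM.
Qed.

(** The fundamental theorem of calculus is applied to an integral from the fixed left end [-B], so
    the result holds in a bounded window; a window around the rectangle is enough for Cauchy's
    theorem. *)
Lemma antiderivative (h : R -> R) (B : R) : continuous h ->
  exists H : R -> R, forall x, `|x| < B -> is_derive x 1 H (h x).
Proof.
move=> ch.
exists (fun x => (\int[lebesgue_measure]_(t in [set` `[- B, x]]) h t)%R).
move=> x; rewrite ltr_norml => /andP[Bx xB].
have [|||dH H'] := @continuous_FTC1 _ h (BLeft (- B)) x B xB.
- apply: continuous_compact_integrable; first exact: segment_compact.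
  exact: continuous_subspaceT.
- by rewrite lte_fin.
- exact: ch.
- by apply: DeriveDef; [exact: dH|rewrite -derive1E].
Qed.

(* The real part of the integral of [U + iV] along the boundary of the rectangle
   [a, b] x [c, d], expressed by antiderivatives [X y] of [U _ y] and [Y x] of
   [V x _]. *)
Definition rect_integral (X Y : R -> R -> R) a b c d : R :=
  (X c b - X c a) - (X d b - X d a) - (Y b d - Y b c) + (Y a d - Y a c).

(** The affine part of [U + iV] at [(x0, y0)] has explicit antiderivatives and integral 0; [X'] and
    [Y'] are what remains. The remainder is at most [e p] on the boundary, whose length is [2 p],
    with [p = b - a + (d - c)]. *)
Lemma rect_integral_local (U V X Y : R -> R -> R) x0 y0 (al ga e r a b c d : R) :
  a <= x0 <= b -> c <= y0 <= d ->
  (forall x y, a <= x <= b -> c <= y <= d -> is_derive x 1 (X y) (U x y)) ->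
  (forall x y, a <= x <= b -> c <= y <= d -> is_derive y 1 (Y x) (V x y)) ->
  0 <= e -> b - a <= r -> d - c <= r ->
  (forall x y, `|x - x0| <= r -> `|y - y0| <= r ->
    `|U x y - U x0 y0 - (al * (x - x0) - ga * (y - y0))|
      <= e * (`|x - x0| + `|y - y0|) /\
    `|V x y - V x0 y0 - (ga * (x - x0) + al * (y - y0))|
      <= e * (`|x - x0| + `|y - y0|)) ->
  `|rect_integral X Y a b c d| <= 2 * e * (b - a + (d - c)) ^+ 2.
Proof.
move=> /andP[ax0 x0b] /andP[cy0 y0d] dX dY e0 bar dcr UV.
have ab : a <= b by exact: le_trans x0b.
have cd : c <= d by exact: le_trans y0d.
pose X' y x := X y x - (U x0 y0 * x + al / 2 * (x - x0) ^+ 2 - ga * (y - y0) * x).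
pose Y' x y := Y x y - (V x0 y0 * y + ga * (x - x0) * y + al / 2 * (y - y0) ^+ 2).
have -> : rect_integral X Y a b c d = rect_integral X' Y' a b c d.
  by rewrite /rect_integral /X' /Y'; field.
set p := b - a + (d - c).
have near x y : a <= x <= b -> c <= y <= d ->
   [/\ `|x - x0| <= r, `|y - y0| <= r & `|x - x0| + `|y - y0| <= p].
  move=> /andP[? ?] /andP[? ?]; have ? : `|x - x0| <= b - a by rewrite ler_norml; lra.
  have ? : `|y - y0| <= d - c by rewrite ler_norml; lra.
  by split; rewrite /p; lra.
have HX y : c <= y <= d -> `|X' y b - X' y a| <= e * p * (b - a).
  move=> yc; apply: (@mean_value_ineq _ (fun x =>
      U x y - U x0 y0 - (al * (x - x0) - ga * (y - y0)))) => // x xab.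
    have ? := dX x y xab yc.
    rewrite /X'; apply: is_derive_eq.
    by rewrite /GRing.scale/= ; field.
  have [? ? ?] := near x y xab yc; have [+ _] := UV x y ltac:(by []) ltac:(by []).
  by move/le_trans; apply; rewrite ler_wpM2l.
have HY x : a <= x <= b -> `|Y' x d - Y' x c| <= e * p * (d - c).
  move=> xab; apply: (@mean_value_ineq _ (fun y =>
      V x y - V x0 y0 - (ga * (x - x0) + al * (y - y0)))) => // y yc.
    have ? := dY x y xab yc.
    rewrite /Y'; apply: is_derive_eq.
    by rewrite /GRing.scale/= ; field.
  have [? ? ?] := near x y xab yc; have [_ +] := UV x y ltac:(by []) ltac:(by []).
  by move/le_trans; apply; rewrite ler_wpM2l.
have := HX c; have := HX d; have := HY a; have := HY b.
rewrite !lexx ab cd /= => /(_ isT) h1 /(_ isT) h2 /(_ isT) h3 /(_ isT) h4.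
rewrite /rect_integral.
apply: (le_trans (ler_normD _ _)); apply: (le_trans (lerD (ler_normB _ _) (lexx _))).
apply: (le_trans (lerD (lerD (ler_normB _ _) (lexx _)) (lexx _))).
have -> : 2 * e * p ^+ 2 = e * p * (b - a) + e * p * (b - a) + e * p * (d - c) + e * p * (d - c).
  by rewrite /p; ring.
lra.
Qed.

End Goursat.

Section GoursatRectangle.
Context {R : realType}.

Lemma nested_intervals (u r : nat -> R) : (forall n, 0 <= r n) ->
  (forall n, u n <= u n.+1) -> (forall n, u n.+1 + r n.+1 <= u n + r n) ->
  exists x, forall n, u n <= x <= u n + r n.
Proof.
move=> r0 u_nd ur_ni.
have u_le m n : (m <= n)%N -> u m <= u n.
  by move=> /subnK <-; elim: (n - m)%N => // k ih; exact: le_trans (u_nd _).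
have ur_le m n : (m <= n)%N -> u n + r n <= u m + r m.
  by move=> /subnK <-; elim: (n - m)%N => // k ih; exact: le_trans (ur_ni _) _.
have ub m n : u m <= u n + r n.
  have [mn|/ltnW nm] := leqP m n; first by rewrite (le_trans (u_le _ _ mn))// lerDl.
  by rewrite (le_trans _ (ur_le _ _ nm))// lerDl.
exists (sup (range u)) => n; apply/andP; split.
  by apply: ub_le_sup; [exists (u 0%N + r 0%N) => _ [m _ <-]|exists n].
by apply: ge_sup; [exists (u 0%N), 0%N|move=> _ [m _ <-]].
Qed.

(** The integrals over the four quarters add up to the whole because inner sides cancel, so some
    quarter carries at least a fourth of the modulus. *)
Lemma rect_integral_split (X Y : R -> R -> R) (x y w h m : R) :
  4 * m <= `|rect_integral X Y x (x + (w + w)) y (y + (h + h))| ->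
  exists i j : bool,
    m <= `|rect_integral X Y (x + w *+ i) (x + w *+ i + w)
                             (y + h *+ j) (y + h *+ j + h)|.
Proof.
move=> Hm; apply: contrapT => /forallNP H.
have {}H (i j : bool) : `|rect_integral X Y (x + w *+ i) (x + w *+ i + w)
    (y + h *+ j) (y + h *+ j + h)| < m.
  by rewrite ltNge; apply/negP => Hij; apply: (H i); exists j.
have := H false false; have := H false true; have := H true false.
have := H true true; rewrite !mulr1n !mulr0n !addr0 => h1 h2 h3 h4.
move: Hm; apply/negP; rewrite -ltNge.
have -> : rect_integral X Y x (x + (w + w)) y (y + (h + h)) =
    rect_integral X Y (x + w) (x + w + w) (y + h) (y + h + h) +
    rect_integral X Y (x + w) (x + w + w) y (y + h) +
    rect_integral X Y x (x + w) (y + h) (y + h + h) +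
    rect_integral X Y x (x + w) y (y + h).
  by rewrite /rect_integral !(addrA _ w w) !(addrA _ h h); ring.
apply: (le_lt_trans (ler_normD _ _)).
apply: (le_lt_trans (lerD (ler_normD _ _) (lexx _))).
apply: (le_lt_trans (lerD (lerD (ler_normD _ _) (lexx _)) (lexx _))).
lra.
Qed.

(* Complex differentiability of [U + iV] in the rectangle enters only through the
   real Frechet differentials, with matrix [[al, -ga], [ga, al]]. *)
Lemma goursat (U V X Y : R -> R -> R) (a b c d : R) : a <= b -> c <= d ->
  (forall x0 y0, a <= x0 <= b -> c <= y0 <= d -> exists al ga, forall e, 0 < e ->
    exists2 r, 0 < r & forall x y, `|x - x0| <= r -> `|y - y0| <= r ->
    `|U x y - U x0 y0 - (al * (x - x0) - ga * (y - y0))|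
      <= e * (`|x - x0| + `|y - y0|) /\
    `|V x y - V x0 y0 - (ga * (x - x0) + al * (y - y0))|
      <= e * (`|x - x0| + `|y - y0|)) ->
  (forall x y, a <= x <= b -> c <= y <= d -> is_derive x 1 (X y) (U x y)) ->
  (forall x y, a <= x <= b -> c <= y <= d -> is_derive y 1 (Y x) (V x y)) ->
  rect_integral X Y a b c d = 0.
Proof.
move=> ab cd dUV dX dY.
pose w n := (b - a) / 2 ^+ n; pose h n := (d - c) / 2 ^+ n.
have wS n : w n = w n.+1 + w n.+1 by rewrite /w exprS; field; rewrite expf_neq0.
have hS n : h n = h n.+1 + h n.+1 by rewrite /h exprS; field; rewrite expf_neq0.
have w0 n : 0 <= w n by rewrite divr_ge0 ?subr_ge0 ?exprn_ge0.
have h0 n : 0 <= h n by rewrite divr_ge0 ?subr_ge0 ?exprn_ge0.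
pose mu n (z : R * R) := `|rect_integral X Y z.1 (z.1 + w n) z.2 (z.2 + h n)|.
have /choice[f Hf] : forall nz : nat * (R * R), exists ij : bool * bool,
    mu nz.1 nz.2 / 4 <= mu nz.1.+1 (nz.2.1 + w nz.1.+1 *+ ij.1, nz.2.2 + h nz.1.+1 *+ ij.2).
  move=> [n [x y]] /=.
  have [|i [j Hij]] := @rect_integral_split X Y x y (w n.+1) (h n.+1) (mu n (x, y) / 4).
    by rewrite mulrC divfK// -wS -hS.
  by exists (i, j).
pose step n (z : R * R) := (z.1 + w n.+1 *+ (f (n, z)).1, z.2 + h n.+1 *+ (f (n, z)).2).
pose z := fix z n := if n is n'.+1 then step n' (z n') else (a, c).
have zmu n : mu 0%N (a, c) <= 4 ^+ n * mu n (z n).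
  elim: n => [|n ih]; first by rewrite expr0 mul1r.
  apply: (le_trans ih); rewrite exprSr -mulrA ler_wpM2l ?exprn_ge0//.
  by have := Hf (n, z n); rewrite /= ler_pdivrMr// mulrC.
have [x0 Hx0] : exists x, forall n, (z n).1 <= x <= (z n).1 + w n.
  apply: nested_intervals => // n /=; first by rewrite lerDl mulrn_wge0.
  rewrite (wS n) addrA lerD2r lerD2l; case: (f _).1 => //=.
have [y0 Hy0] : exists y, forall n, (z n).2 <= y <= (z n).2 + h n.
  apply: nested_intervals => // n /=; first by rewrite lerDl mulrn_wge0.
  rewrite (hS n) addrA lerD2r lerD2l; case: (f _).2 => //=.
have zin n : [/\ a <= (z n).1, (z n).1 + w n <= b, c <= (z n).2 & (z n).2 + h n <= d].
  elim: n => [|n [h1 h2 h3 h4]]; first by rewrite /= /w /h expr0 !divr1 !lexx; split=> //; lra.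
  rewrite /=; case: (f _) => i j /=.
  have := wS n; have := hS n; have := w0 n.+1; have := h0 n.+1.
  by case: i; case: j; rewrite ?mulr1n ?mulr0n => *; split; lra.
have x0ab : a <= x0 <= b by have := Hx0 0%N; rewrite /= /w expr0 divr1; lra.
have y0cd : c <= y0 <= d by have := Hy0 0%N; rewrite /= /h expr0 divr1; lra.
have [al [ga Hag]] := dUV x0 y0 x0ab y0cd.
(* The factor [4 ^ n] lost in [zmu] is exactly the square of the factor [2 ^ n] by which the sides
   have shrunk, and the local bound is quadratic in the sides. *)
have main e : 0 < e -> mu 0%N (a, c) <= 2 * e * (b - a + (d - c)) ^+ 2.
  move=> e0; have [r r0 Hr] := Hag e e0.
  have [n wr hr] : exists2 n, w n <= r & h n <= r.
    pose k := maxn (Num.bound ((b - a) / r)) (Num.bound ((d - c) / r)).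
    exists k; rewrite /w /h ler_pdivrMr ?exprn_gt0// mulrC -ler_pdivrMr// ltW// upper_nthrootP//.
      exact: leq_maxl.
    exact: leq_maxr.
  have [z1 z2 z3 z4] := zin n.
  apply: (le_trans (zmu n)).
  have := @rect_integral_local R U V X Y x0 y0 al ga e r (z n).1 ((z n).1 + w n)
    (z n).2 ((z n).2 + h n) (Hx0 n) (Hy0 n).
  have -> : (z n).1 + w n - (z n).1 = w n by ring.
  have -> : (z n).2 + h n - (z n).2 = h n by ring.
  move=> /(_ _ _ (ltW e0) wr hr Hr) H.
  have {}H : mu n (z n) <= 2 * e * (w n + h n) ^+ 2.
    by apply: H => x y xz yz; [apply: dX|apply: dY]; lra.
  have -> : 2 * e * (b - a + (d - c)) ^+ 2 = 4 ^+ n * (2 * e * (w n + h n) ^+ 2).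
    rewrite /w /h (_ : 4 = 2 ^+ 2 :> R) ?expr2; last by ring.
    by rewrite exprMn; field; rewrite expf_neq0.
  by rewrite ler_wpM2l// exprn_ge0.
have mu0 : mu 0%N (a, c) = `|rect_integral X Y a b c d|.
  by rewrite /mu /= /w /h expr0 !divr1 !(addrC _ (_ - _)) !subrK.
apply/eqP; rewrite -normr_eq0 eq_le normr_ge0 andbT -mu0.
apply/ler_addgt0Pl => e e0; rewrite addr0.
have p0 : 0 <= (b - a + (d - c)) ^+ 2 by exact: sqr_ge0.
set p := (_ ^+ 2) in main p0.
have q0 : 0 < 2 * (p + 1) by lra.
apply: (le_trans (main (e / (2 * (p + 1))) _)); first by rewrite divr_gt0.
rewrite (_ : 2 * (e / (2 * (p + 1))) * p = e * (p / (p + 1))); last by field; lra.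
rewrite ger_pMr// ler_pdivrMr; lra.
Qed.

End GoursatRectangle.

(** * Complex differentiability and the identity theorem *)

Local Open Scope complex_scope.

Section RealNorm.
Context {R : realType}.
Implicit Types z w : R[i].

(* Norms over [R[i]] are elements of [R[i]]; their real parts can be handled by
   the arithmetic of [R]. *)
Definition nrm (V : normedZmodType R[i]) (x : V) : R := complex.Re `|x|.

Lemma nrmE (V : normedZmodType R[i]) (x : V) : `|x| = (nrm x)%:C.
Proof. by rewrite /nrm RRe_real// normr_real. Qed.

Lemma nrm_ge0 (V : normedZmodType R[i]) (x : V) : 0 <= nrm x.
Proof. by rewrite -ler0c -nrmE. Qed.

Lemma nrm0 (V : normedZmodType R[i]) : nrm (0 : V) = 0.
Proof. by apply: complexI; rewrite -nrmE normr0. Qed.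

Lemma nrm_eq0 (V : normedZmodType R[i]) (x : V) : nrm x = 0 -> x = 0.
Proof. by move=> x0; apply/eqP; rewrite -normr_eq0 nrmE x0. Qed.

Lemma nrmN (V : normedZmodType R[i]) (x : V) : nrm (- x) = nrm x.
Proof. by rewrite /nrm normrN. Qed.

Lemma nrm_distC (V : normedZmodType R[i]) (x y : V) : nrm (x - y) = nrm (y - x).
Proof. by rewrite -opprB nrmN. Qed.

Lemma nrmD (V : normedZmodType R[i]) (x y : V) : nrm (x + y) <= nrm x + nrm y.
Proof. by rewrite -lecR rmorphD /= -!nrmE ler_normD. Qed.

Lemma nrmB (V : normedZmodType R[i]) (x y : V) : nrm (x - y) <= nrm x + nrm y.
Proof. by rewrite -(nrmN y); exact: nrmD. Qed.

Lemma nrm_dist (V : normedZmodType R[i]) (x y : V) : nrm x <= nrm y + nrm (x - y).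
Proof. by rewrite -{1}(subrK y x) addrC nrmD. Qed.

Lemma nrm_sum (V : normedZmodType R[i]) (I : Type) (r : seq I) (P : pred I) (F : I -> V) :
  nrm (\sum_(i <- r | P i) F i) <= \sum_(i <- r | P i) nrm (F i).
Proof.
elim/big_ind2 : _ => [|x1 x2 y1 y2 h1 h2|//]; first by rewrite nrm0.
exact: le_trans (nrmD _ _) (lerD h1 h2).
Qed.

Lemma nrmZ (V : normedModType R[i]) z (x : V) : nrm (z *: x) = nrm z * nrm x.
Proof. by apply: complexI; rewrite rmorphM /= -!nrmE normrZ. Qed.

Lemma nrmM z w : nrm (z * w) = nrm z * nrm w.
Proof. by apply: complexI; rewrite rmorphM /= -!nrmE normrM. Qed.

Lemma nrmX z n : nrm (z ^+ n) = nrm z ^+ n.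
Proof. by apply: complexI; rewrite rmorphXn /= -!nrmE normrX. Qed.

Lemma nrmV z : nrm z^-1 = (nrm z)^-1.
Proof. by apply: complexI; rewrite -nrmE normfV nrmE -fmorphV. Qed.

Lemma nrm_gt0 (V : normedZmodType R[i]) (x : V) : x != 0 -> 0 < nrm x.
Proof. by move=> x0; rewrite -ltcR -nrmE normr_gt0. Qed.

Lemma nrm_sqr z : nrm z ^+ 2 = complex.Re z ^+ 2 + complex.Im z ^+ 2.
Proof. by apply: complexI; rewrite rmorphXn /= -nrmE add_Re2_Im2. Qed.

Lemma nrm_real (x : R) : nrm x%:C = `|x|.
Proof. by rewrite -[LHS]ger0_norm ?nrm_ge0// -!sqrtr_sqr nrm_sqr/= expr0n addr0. Qed.

Lemma normRe_le z : `|complex.Re z| <= nrm z.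
Proof.
rewrite -(ger0_norm (nrm_ge0 z)) -!sqrtr_sqr ler_wsqrtr// nrm_sqr.
by rewrite lerDl sqr_ge0.
Qed.

Lemma normIm_le z : `|complex.Im z| <= nrm z.
Proof.
rewrite -(ger0_norm (nrm_ge0 z)) -!sqrtr_sqr ler_wsqrtr// nrm_sqr.
by rewrite lerDr sqr_ge0.
Qed.

Lemma nrm_le_Re_Im z : nrm z <= `|complex.Re z| + `|complex.Im z|.
Proof.
rewrite -(ler_pXn2r (_ : 0 < 2)%N) ?nnegrE ?nrm_ge0 ?addr_ge0//.
by rewrite nrm_sqr sqrrD !real_normK ?num_real// addrAC lerDl mulrn_wge0// mulr_ge0.
Qed.

Lemma nrm_conj z : nrm z^* = nrm z.
Proof.
rewrite -[LHS]ger0_norm ?nrm_ge0// -[RHS]ger0_norm ?nrm_ge0// -!sqrtr_sqr !nrm_sqr.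
by case: z => x y /=; rewrite sqrrN.
Qed.

Lemma cvg_nrmP (T : Type) (F : set_system T) (FF : Filter F) (V : normedModType R[i])
    (f : T -> V) (l : V) :
  f @ F --> l <-> forall e : R, 0 < e -> \forall t \near F, nrm (l - f t) <= e.
Proof.
split=> [/cvgrPdist_le fl e e0|fl].
  have := fl e%:C; rewrite ltcR => /(_ e0).
  by apply: filterS => t; rewrite nrmE lecR.
apply/cvgrPdist_le => e e0.
have eE : e = (complex.Re e)%:C by rewrite RRe_real// gtr0_real.
have := fl (complex.Re e); rewrite -ltcR -eE => /(_ e0).
by apply: filterS => t; rewrite eE nrmE lecR.
Qed.

Lemma nbhs_nrmP (V : normedModType R[i]) (x : V) (P : set V) :
  nbhs x P <-> exists2 r : R, 0 < r & forall y, nrm (x - y) < r -> P y.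
Proof.
split=> [/nbhs_normP [r /= r0 H]|[r r0 H]].
  have rE : r = (complex.Re r)%:C by rewrite RRe_real// gtr0_real.
  exists (complex.Re r); first by rewrite -ltcR -rE.
  by move=> y xy; apply: H; rewrite /= rE nrmE ltcR.
apply/nbhs_normP; exists r%:C; first by rewrite /= ltcR.
by move=> y /=; rewrite nrmE ltcR => /H.
Qed.

Lemma closed_nrmP (V : normedModType R[i]) (D : set V) :
  (forall x, (forall e : R, 0 < e -> exists2 y, D y & nrm (x - y) < e) -> D x) ->
  closed D.
Proof.
move=> H x Dx; apply: H => e e0.
have [|y [Dy xy]] := Dx [set y | nrm (x - y) < e]; last by exists y.
by apply/nbhs_nrmP; exists e.
Qed.

Lemma closed_nrm (V : normedModType R[i]) (D : set V) x : closed D ->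
  (forall e : R, 0 < e -> exists2 y, D y & nrm (x - y) < e) -> D x.
Proof.
move=> cD H; apply: cD => B /nbhs_nrmP [r r0 HB].
by have [y Dy /HB] := H r r0; exists y.
Qed.

Lemma derivable_nrm (V : normedModType R[i]) (f : R[i] -> V) z :
  derivable (f : R[i]^o -> V) z 1 -> exists d, forall e : R, 0 < e ->
    exists2 r, 0 < r & forall h, nrm h <= r -> nrm (f (z + h) - f z - h *: d) <= e * nrm h.
Proof.
move=> /cvg_ex [d /cvg_nrmP fd]; exists d => e e0.
have /nbhs_nrmP [r r0 Hr] := fd e e0.
exists (r / 2); first by rewrite divr_gt0.
move=> h hr; have [->|h0] := eqVneq h 0; first by rewrite addr0 subrr scale0r subr0 !nrm0 mulr0.
have /= := Hr h; rewrite sub0r nrmN => /(_ _ h0) H.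
have {H} : nrm (d - h^-1 *: (f (h *: (1 : R[i]^o) + z) - f z)) <= e.
  by apply: H; apply: (le_lt_trans hr); rewrite ltr_pdivrMr// mulr_natr mulr2n ltrDl.
have -> : h *: (1 : R[i]^o) = h by rewrite /GRing.scale/= mulr1.
move=> H.
have -> : f (z + h) - f z - h *: d = - (h *: (d - h^-1 *: (f (h + z) - f z))).
  by rewrite (scalerBr h) scalerA mulfV// scale1r opprB (addrC z).
by rewrite nrmN nrmZ mulrC ler_wpM2r// nrm_ge0.
Qed.

Lemma nrm_derivable (V : normedModType R[i]) (f : R[i] -> V) z d :
  (forall e : R, 0 < e -> exists2 r, 0 < r &
    forall h, nrm h <= r -> nrm (f (z + h) - f z - h *: d) <= e * nrm h) ->
  derivable (f : R[i]^o -> V) z 1.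
Proof.
move=> H; apply/cvg_ex; exists d; apply/cvg_nrmP => e e0.
have [r r0 Hr] := H e e0.
apply/nbhs_nrmP; exists r => // h; rewrite sub0r nrmN => /ltW/Hr {}Hr h0 /=.
have -> : h *: (1 : R[i]^o) = h by rewrite /GRing.scale/= mulr1.
have -> : d - h^-1 *: (f (h + z) - f z) = - (h^-1 *: (f (z + h) - f z - h *: d)).
  by rewrite (scalerBr h^-1 _ (h *: d)) scalerA mulVf// scale1r opprB (addrC z).
rewrite nrmN nrmZ nrmV mulrC ler_pdivrMr ?nrm_gt0//.
Qed.

End RealNorm.

Section ComplexDerivable.
Context {R : realType}.
Implicit Types f g : R[i] -> R[i].

Definition cderivable f := forall z, derivable (f : R[i]^o -> R[i]^o) z 1.

Lemma cderivable_cst (c : R[i]) : cderivable (fun=> c).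
Proof. by move=> z; exact: (@derivable_cst _ R[i]^o R[i]^o c z 1). Qed.

Lemma cderivable_id : cderivable id.
Proof. by move=> z; exact: (@derivable_id _ R[i]^o z 1). Qed.

Lemma cderivableB f g : cderivable f -> cderivable g -> cderivable (fun z => f z - g z).
Proof. by move=> df dg z; exact: (@derivableB _ R[i]^o R[i]^o f g). Qed.

Lemma cderivableM f g : cderivable f -> cderivable g -> cderivable (fun z => f z * g z).
Proof. by move=> df dg z; exact: (@derivableM _ R[i]^o f g). Qed.

Lemma cderivableX f n : cderivable f -> cderivable (fun z => f z ^+ n).
Proof.
move=> df; elim: n => [|n ih]; first exact: cderivable_cst.
by under eq_fun do rewrite exprS; exact: cderivableM.
Qed.

(** The Cauchy-Riemann equations: multiplication by the derivative [al + i ga] is the real matrix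
    that [goursat] asks for. *)
Lemma cderivable_frechet f x0 y0 : cderivable f ->
  exists al ga, forall e, 0 < e -> exists2 r, 0 < r &
    forall x y, `|x - x0| <= r -> `|y - y0| <= r ->
    `|complex.Re (f (x +i* y)) - complex.Re (f (x0 +i* y0)) -
        (al * (x - x0) - ga * (y - y0))| <= e * (`|x - x0| + `|y - y0|) /\
    `|complex.Im (f (x +i* y)) - complex.Im (f (x0 +i* y0)) -
        (ga * (x - x0) + al * (y - y0))| <= e * (`|x - x0| + `|y - y0|).
Proof.
move=> /(_ (x0 +i* y0))/derivable_nrm[[al ga] Hd]; exists al, ga => e e0.
have [r r0 Hr] := Hd e e0; exists (r / 2); first by rewrite divr_gt0.
move=> x y xr yr; have hE : nrm ((x - x0) +i* (y - y0)) <= `|x - x0| + `|y - y0|.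
  exact: nrm_le_Re_Im.
have {Hr}/= H := Hr ((x - x0) +i* (y - y0)) ltac:(lra).
have {}H : nrm (f (x +i* y) - f (x0 +i* y0) - (al +i* ga) * ((x - x0) +i* (y - y0)))
    <= e * (`|x - x0| + `|y - y0|).
  have zE : x0 +i* y0 + ((x - x0) +i* (y - y0)) = x +i* y.
    by apply/eqP; rewrite eq_complex /= !(addrC x0) !(addrC y0) !subrK !eqxx.
  move: H; rewrite zE [_ *: _]mulrC => /le_trans; apply.
  by rewrite ler_wpM2l// ltW.
split; apply: le_trans H.
  apply: le_trans (normRe_le _); rewrite le_eqVlt; apply/orP; left; apply/eqP; congr `|_|.
  by case: (f _) => u v; case: (f _) => u' v' /=; ring.
apply: le_trans (normIm_le _); rewrite le_eqVlt; apply/orP; left; apply/eqP; congr `|_|.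
by case: (f _) => u v; case: (f _) => u' v' /=; ring.
Qed.

Lemma cderivable_cont f : cderivable f -> forall z (e : R), 0 < e ->
  exists2 r, 0 < r & forall w, nrm (z - w) < r -> nrm (f z - f w) < e.
Proof.
move=> df z e e0.
have cf : {for z, continuous (f : R[i]^o -> R[i]^o)}.
  by apply: differentiable_continuous; apply/derivable1_diffP; exact: df.
move/cvg_nrmP: cf => /(_ (e / 2) ltac:(lra))/nbhs_nrmP[r r0 Hr].
by exists r => // w /Hr h; apply: (le_lt_trans h); lra.
Qed.

(** Stated for any 1-Lipschitz [P] and isometric [l], to serve real part, imaginary part and norm on
    horizontal and vertical lines alike. *)
Lemma cderivable_line (P : R[i] -> R) f (l : R -> R[i]) : cderivable f ->
  (forall z w, `|P z - P w| <= nrm (z - w)) ->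
  (forall s t, nrm (l s - l t) = `|s - t|) ->
  continuous (fun t => P (f (l t)) : R).
Proof.
move=> df P1 l1 t; apply/cvgrPdist_lt => e e0.
have [r r0 Hr] := cderivable_cont df (l t) e0.
apply/nbhs_normP; exists r => // s /= ts.
by apply: (le_lt_trans (P1 _ _)); apply: Hr; rewrite l1.
Qed.

Lemma nrm_hline (y s t : R) : nrm (s +i* y - t +i* y) = `|s - t|.
Proof. by rewrite -nrm_real; congr nrm; apply/eqP; rewrite eq_complex /= subrr !eqxx. Qed.

Lemma nrm_vline (x s t : R) : nrm (x +i* s - x +i* t) = `|s - t|.
Proof.
rewrite -(ger0_norm (nrm_ge0 _)) -!sqrtr_sqr nrm_sqr /=.
by rewrite subrr expr0n /= add0r.
Qed.

Lemma Re_lip (z w : R[i]) : `|complex.Re z - complex.Re w| <= nrm (z - w).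
Proof. by apply: le_trans (normRe_le _); case: z w => ? ? []. Qed.

Lemma Im_lip (z w : R[i]) : `|complex.Im z - complex.Im w| <= nrm (z - w).
Proof. by apply: le_trans (normIm_le _); case: z w => ? ? []. Qed.

Lemma nrm_lip (z w : R[i]) : `|nrm z - nrm w| <= nrm (z - w).
Proof.
rewrite ler_norml; have := nrm_dist z w; have := nrm_dist w z.
rewrite (nrm_distC w); lra.
Qed.

(** The antiderivatives are chosen line by line, without relation between different lines. They
    depend on [f] and [B] but not on the rectangle. *)
Lemma cauchy_rectangle f (B : R) : cderivable f -> exists X Y : R -> R -> R,
  [/\ forall x y : R, `|x| < B -> is_derive x 1 (X y) (complex.Re (f (x +i* y))),
      forall x y : R, `|y| < B -> is_derive y 1 (Y x) (complex.Im (f (x +i* y)))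
    & forall a b c d, - B < a -> a <= b -> b < B -> - B < c -> c <= d -> d < B ->
        rect_integral X Y a b c d = 0].
Proof.
move=> df.
have /choice[X HX] : forall y : R, exists H : R -> R, forall x : R, `|x| < B ->
    is_derive x 1 H (complex.Re (f (x +i* y))).
  move=> y; apply: (@antiderivative R (fun x => complex.Re (f (x +i* y)))).
  by apply: (cderivable_line df Re_lip) => s t; exact: nrm_hline.
have /choice[Y HY] : forall x : R, exists H : R -> R, forall y : R, `|y| < B ->
    is_derive y 1 H (complex.Im (f (x +i* y))).
  move=> x; apply: (@antiderivative R (fun y => complex.Im (f (x +i* y)))).
  by apply: (cderivable_line df Im_lip) => s t; exact: nrm_vline.
exists X, Y; split=> [x y|x y|a b c d Ba ab bB Bc cd dB]; [exact: HX|exact: HY|].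
apply: (@goursat R (fun x y => complex.Re (f (x +i* y)))
  (fun x y => complex.Im (f (x +i* y)))) => //.
- by move=> x0 y0 _ _; exact: cderivable_frechet.
- by move=> x y xab ycd; apply: HX; rewrite ltr_norml; lra.
- by move=> x y xab ycd; apply: HY; rewrite ltr_norml; lra.
Qed.

Lemma bounded_line f (l : R -> R[i]) a b : a <= b -> cderivable f ->
  (forall s t, nrm (l s - l t) = `|s - t|) ->
  exists C, forall t, a <= t <= b -> nrm (f (l t)) <= C.
Proof.
move=> ab df l1.
have [|c _ Hc] := @EVT_max R (fun t => nrm (f (l t))) a b ab.
  by apply: continuous_subspaceT; exact: (cderivable_line df nrm_lip).
by exists (nrm (f (l c))) => t tab; apply: Hc; rewrite in_itv.
Qed.

Lemma bernoulli (x : R) n : -1 <= x -> 1 + n%:R * x <= (1 + x) ^+ n.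
Proof.
move=> x1; elim: n => [|n ih]; first by rewrite mul0r addr0 expr0.
have := ler_wpM2l (_ : 0 <= 1 + x) ih; rewrite exprS => /(_ ltac:(lra)).
have : 0 <= n%:R * x ^+ 2 by rewrite mulr_ge0// sqr_ge0.
rewrite -natr1 expr2; nra.
Qed.

(* [n rho^n] tends to 0: for [n = 2m] it is [2 (m rho^m) rho^m]. *)
Lemma linear_geometric_small (rho c : R) (n0 : nat) : 0 <= rho < 1 -> 0 < c ->
  exists2 n, (n0 <= n)%N & n%:R * rho ^+ n < c.
Proof.
move=> /andP[rho0 rho1] c0.
have [->|rho_neq0] := eqVneq rho 0.
  by exists n0.+1 => //; rewrite expr0n /= mulr0.
have {rho_neq0}rho0 : 0 < rho by rewrite lt_def rho_neq0.
pose t := rho^-1 - 1.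
have t0 : 0 < t by rewrite subr_gt0 invf_gt1.
(* Bernoulli's inequality for [1 / rho = 1 + t] gives [rho ^ -m >= 1 + m t]. *)
have bnd m : m%:R * rho ^+ m <= t^-1.
  rewrite -ler_pdivlMr ?exprn_gt0// -exprVn -[_^-1 ^+ _ in leRHS](_ : (1 + t) ^+ m = _).
    rewrite mulrC ler_pdivlMr//; apply: le_trans (@bernoulli t m _); lra.
  by rewrite /t addrC subrK.
pose m := maxn n0 (Num.bound (2 / (t ^+ 2 * c))).
exists (m.*2); first by rewrite -addnn; apply: leq_trans (leq_addr _ _); exact: leq_maxl.
have rm : rho ^+ m * m%:R <= t^-1 by rewrite mulrC.
have m_big : 2 / (t ^+ 2 * c) < m%:R.
  apply: (lt_le_trans (archi_boundP _)); first by rewrite divr_ge0// mulr_ge0 ?sqr_ge0// ltW.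
  by rewrite ler_nat leq_maxr.
have m0 : 0 < m%:R :> R by apply: le_lt_trans m_big; rewrite divr_ge0// mulr_ge0 ?sqr_ge0// ltW.
rewrite -addnn natrD exprD.
have -> : (m%:R + m%:R) * (rho ^+ m * rho ^+ m) = 2 * (rho ^+ m * m%:R) ^+ 2 / m%:R.
  by field; rewrite gt_eqF.
rewrite ltr_pdivrMr//.
have : (rho ^+ m * m%:R) ^+ 2 <= t^-1 ^+ 2.
  by rewrite ler_pXn2r ?nnegrE// ?mulr_ge0 ?exprn_ge0 ?invr_ge0// ltW.
move=> h; have : 2 * t^-1 ^+ 2 < c * m%:R.
  move: m_big; rewrite ltr_pdivrMr ?mulr_gt0 ?exprn_gt0// exprVn => h'.
  by rewrite ltr_pdivrMr ?exprn_gt0//; lra.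
lra.
Qed.

End ComplexDerivable.

Section IdentityTheorem.
Context {R : realType}.
Implicit Types f g : R[i] -> R[i].

(* A lower bound for the integral of [G q^n], for the Landau kernel
   [q = 1 - x^2 / 5b^2]. *)
Lemma landau_peak (X G : R -> R) (b d eta C rho : R) (n : nat) :
  let q x := 1 - x ^+ 2 / (5 * b ^+ 2) in
  0 < b -> 0 < d -> d <= 2 * b -> 0 < eta -> 0 <= C ->
  (forall x : R, - (2 * b) <= x <= 2 * b -> is_derive x 1 X (G x * q x ^+ n)) ->
  (forall x : R, `|x| <= d -> eta / 2 <= G x) ->
  (forall x : R, - (2 * b) <= x <= 2 * b -> `|G x| <= C) ->
  q d <= rho -> 0 <= rho -> (0 < n)%N -> b / n%:R <= d ->
  4/5 * eta * (b / n%:R) - 4 * b * (C * rho ^+ n) <= X (2 * b) - X (- (2 * b)).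
Proof.
move=> q b0 d0 d2b eta0 C0 dX Hd normG rhoq rho0 n_gt0 bn_d.
have b2 : 0 < 5 * b ^+ 2 by rewrite mulr_gt0// exprn_gt0.
have q_ge0 (x : R) : - (2 * b) <= x <= 2 * b -> 0 <= q x.
  by move=> ?; rewrite /q subr_ge0 ler_pdivrMr// mul1r expr2; nra.
have n0 : 0 < n%:R :> R by rewrite ltr0n.
have rn0 : 0 <= C * rho ^+ n by rewrite mulr_ge0 ?exprn_ge0.
set bn := b / n%:R in bn_d *.
have bn0 : 0 < bn by rewrite divr_gt0.
set u := C * rho ^+ n in rn0 *.
(* Where [|x| >= d] the kernel is at most [q d <= rho]. The two outer pieces have total length at
   most [4 b], which is the error term of the statement. *)
have outer (x1 x2 : R) : - (2 * b) <= x1 <= x2 -> x2 <= 2 * b ->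
    (forall x : R, x1 <= x <= x2 -> d ^+ 2 <= x ^+ 2) -> - u * (x2 - x1) <= X x2 - X x1.
  move=> x12 x2b dx.
  apply: (@mean_value_ge _ _ (fun x => G x * q x ^+ n)) => [|x xx|x xx].
  - by case/andP: x12.
  - by apply: dX; clear -xx x12 x2b; lra.
  - have xb : - (2 * b) <= x <= 2 * b by clear -xx x12 x2b; lra.
    suff : `|G x * q x ^+ n| <= u by rewrite ler_norml => /andP[].
    have q0 : 0 <= q x by exact: q_ge0.
    rewrite normrM normrX (ger0_norm q0) ler_pM ?exprn_ge0//; first exact: normG.
    apply: lerXn2r; rewrite ?nnegrE//.
    apply: le_trans rhoq; rewrite /q lerD2l lerN2 ler_pM2r ?invr_gt0//.
    exact: dx.
have inner (x1 x2 : R) : - d <= x1 <= x2 -> x2 <= d -> 0 * (x2 - x1) <= X x2 - X x1.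
  move=> x12 x2d.
  apply: (@mean_value_ge _ _ (fun x => G x * q x ^+ n)) => [|x xx|x xx].
  - by case/andP: x12.
  - by apply: dX; clear -xx x12 x2d d2b; lra.
  - rewrite mulr_ge0 ?exprn_ge0//; last by apply: q_ge0; clear -xx x12 x2d d2b; lra.
    apply: le_trans (Hd x _); first by rewrite divr_ge0// ltW.
    by rewrite ler_norml; clear -xx x12 x2d; lra.
(* On [[-b/n, b/n]] one has [n x^2 / (5 b^2) <= 1 / (5 n) <= 1/5], so Bernoulli gives [q^n >= 4/5]:
   the peak is too narrow for the power to spoil it. *)
have peak : eta / 2 * (4/5) * (bn - - bn) <= X bn - X (- bn).
  apply: (@mean_value_ge _ _ (fun x => G x * q x ^+ n)) => [|x xx|x xx].
  - by clear -bn0; lra.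
  - by apply: dX; clear -xx bn_d d2b; lra.
  - have xbn : `|x| <= bn by rewrite ler_norml.
    apply: ler_pM => //; [by clear -eta0; lra|exact/Hd/(le_trans xbn)|].
    have qb : q x = 1 + - (x ^+ 2 / (5 * b ^+ 2)) by [].
    have x2 : x ^+ 2 <= bn ^+ 2.
      by rewrite -(real_normK (num_real x)) lerXn2r ?nnegrE// ltW.
    have u1 : n%:R * (x ^+ 2 / (5 * b ^+ 2)) <= 1/5.
      apply: (@le_trans _ _ (n%:R * (bn ^+ 2 / (5 * b ^+ 2)))).
        by rewrite ler_wpM2l ?ler_wpM2r ?invr_ge0// ltW.
      rewrite (_ : n%:R * _ = n%:R^-1 / 5); last first.
        by rewrite /bn; field; rewrite !gt_eqF.
      by rewrite mul1r ler_piMl// invf_le1// ler1n.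
    have : 1 + n%:R * - (x ^+ 2 / (5 * b ^+ 2)) <= q x ^+ n.
      rewrite qb; apply: bernoulli.
      by rewrite lerN2 ler_pdivrMr// mul1r; clear -xx bn_d d2b b0; nra.
    by rewrite mulrN; clear -u1; lra.
have o1 : - u * (- d - - (2 * b)) <= X (- d) - X (- (2 * b)).
  apply: outer; [by clear -d0 d2b; lra|by clear -d0 b0; lra|move=> x xd].
  by clear -xd d0; nra.
have o2 : - u * (2 * b - d) <= X (2 * b) - X d.
  apply: outer; [by clear -d0 d2b; lra|by []|move=> x xd].
  by clear -xd d0; nra.
have i1 : 0 * (- bn - - d) <= X (- bn) - X (- d).
  by apply: inner; clear -bn_d bn0 d0; lra.
have i2 : 0 * (d - bn) <= X d - X bn.
  by apply: inner; clear -bn_d bn0 d0; lra.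
have e1 : 0 <= u * d by rewrite mulr_ge0// ltW.
have e2 : eta / 2 * (4 / 5) * (bn - - bn) = 4/5 * eta * bn by field.
clear -o1 o2 i1 i2 peak e1 e2; lra.
Qed.

(* Cauchy's theorem for [g k^n] on [-2b, 2b] x [0, b], where the Landau kernel
   [k = 1 - (z - ib)^2 / 5b^2] peaks at [ib] on the upper side and satisfies
   [|k|^2 <= 4/5] on the vertical sides: if [Re g(ib) > 0] the upper side
   contributes at least a multiple of [1/n], the vertical sides decay
   geometrically and the lower side contributes nothing. *)
Lemma entire_Re_le0 g (b : R) : cderivable g -> (forall x : R, g x%:C = 0) ->
  0 < b -> complex.Re (g (0 +i* b)) <= 0.
Proof.
move=> dg g0 b0; rewrite leNgt; apply/negP => eta0.
set eta := complex.Re _ in eta0.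
have b2 : 0 < 5 * b ^+ 2 by rewrite mulr_gt0// exprn_gt0.
pose k (z : R[i]) : R[i] := 1 - (z - 0 +i* b) ^+ 2 * ((5 * b ^+ 2)^-1)%:C.
have dk : cderivable k.
  apply: cderivableB; first exact: cderivable_cst.
  apply: cderivableM; last exact: cderivable_cst.
  apply: cderivableX; apply: cderivableB; [exact: cderivable_id|exact: cderivable_cst].
have kE (x y : R) : k (x +i* y) =
    (1 - (x ^+ 2 - (y - b) ^+ 2) / (5 * b ^+ 2)) +i* (- (2 * x * (y - b)) / (5 * b ^+ 2)).
  rewrite /k expr2; apply/eqP; rewrite eq_complex /=; apply/andP; split; apply/eqP; field; lra.
(* With [v = (y - b)^2 / b^2] in [[0, 1]] the squared modulus is
   [1 - 2 (4 - v) / 5 + (4 + v)^2 / 25]. It increases with [v] up to 4/5, reached on the real axis,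
   and 4/5 is below [(9/10)^2]. *)
have k_side (x y : R) : x ^+ 2 = 4 * b ^+ 2 -> 0 <= y <= b -> nrm (k (x +i* y)) <= 9/10.
  move=> x2 /andP[y0 yb].
  rewrite -(ler_pXn2r (_ : 0 < 2)%N) ?nnegrE ?nrm_ge0//.
  have -> : nrm (k (x +i* y)) ^+ 2 = 1 - 2 * (x ^+ 2 - (y - b) ^+ 2) / (5 * b ^+ 2)
      + (x ^+ 2 + (y - b) ^+ 2) ^+ 2 / (5 * b ^+ 2) ^+ 2.
    by rewrite nrm_sqr kE /=; field; lra.
  rewrite x2; set v := (y - b) ^+ 2 / b ^+ 2.
  have bb : 0 < b ^+ 2 by rewrite exprn_gt0.
  have v0 : 0 <= v by rewrite divr_ge0// sqr_ge0.
  have v1 : v <= 1.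
    rewrite /v ler_pdivrMr// mul1r; have := mulr_ge0 y0 (_ : 0 <= 2 * b - y).
    by rewrite !expr2 => /(_ ltac:(lra)); lra.
  have -> : 1 - 2 * (4 * b ^+ 2 - (y - b) ^+ 2) / (5 * b ^+ 2) +
      (4 * b ^+ 2 + (y - b) ^+ 2) ^+ 2 / (5 * b ^+ 2) ^+ 2 =
      1 - 2 * (4 - v) / 5 + (4 + v) ^+ 2 / 25.
    by rewrite /v; field; lra.
  nra.
have k_top (x : R) : k (x +i* b) = (1 - x ^+ 2 / (5 * b ^+ 2))%:C.
  by rewrite kE subrr expr0n /= subr0 mulr0 oppr0 mul0r.
pose q (x : R) := 1 - x ^+ 2 / (5 * b ^+ 2).
have q_le1 x : q x <= 1 by rewrite /q gerBl divr_ge0// ?sqr_ge0// ltW.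
have q_ge0 (x : R) : - (2 * b) <= x <= 2 * b -> 0 <= q x.
  by move=> ?; rewrite /q subr_ge0 ler_pdivrMr// mul1r expr2; nra.
have ab : - (2 * b) <= 2 * b by lra.
have [C1 HC1] := bounded_line ab dg (nrm_hline b).
have [C2 HC2] := bounded_line (ltW b0) dg (nrm_vline (2 * b)).
have [C3 HC3] := bounded_line (ltW b0) dg (nrm_vline (- (2 * b))).
pose C := 1 + `|C1| + `|C2| + `|C3|.
have C0 : 0 < C by rewrite /C -!addrA ltr_pwDl// !addr_ge0.
have {}HC1 (t : R) : - (2 * b) <= t <= 2 * b -> nrm (g (t +i* b)) <= C.
  move=> /HC1; have := ler_norm C1; have := normr_ge0 C2; have := normr_ge0 C3.
  rewrite /C; lra.
have {}HC2 (t : R) : 0 <= t <= b -> nrm (g ((2 * b) +i* t)) <= C.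
  move=> /HC2; have := ler_norm C2; have := normr_ge0 C1; have := normr_ge0 C3.
  rewrite /C; lra.
have {}HC3 (t : R) : 0 <= t <= b -> nrm (g ((- (2 * b)) +i* t)) <= C.
  move=> /HC3; have := ler_norm C3; have := normr_ge0 C1; have := normr_ge0 C2.
  rewrite /C; lra.
have [d [d0 d2b Hd]] : exists d : R, [/\ 0 < d, d <= 2 * b &
    forall x, `|x| <= d -> eta / 2 <= complex.Re (g (x +i* b))].
  have eta2 : 0 < eta / 2 by rewrite divr_gt0.
  have [r r0 Hr] := cderivable_cont dg (0 +i* b) eta2.
  exists (Num.min (r / 2) (2 * b)); split; first by rewrite lt_min; lra.
    by rewrite ge_min lexx orbT.
  move=> x; rewrite le_min => /andP[xr _].
  have := Hr (x +i* b); rewrite nrm_hline sub0r normrN => /(_ ltac:(lra)) h.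
  have := le_lt_trans (Re_lip _ _) h; rewrite -/eta ltr_norml; lra.
pose rho := Num.max (9/10) (q d).
have rho9 : 9/10 <= rho by rewrite le_max lexx.
have rhoq : q d <= rho by rewrite le_max lexx orbT.
have rho1 : rho < 1.
  by rewrite gt_max /q; apply/andP; split; [lra|rewrite gtrBl divr_gt0// exprn_gt0].
(* If [n rho^n] is below this threshold, the peak [4/5 eta b / n] exceeds the total error
   [6 b C rho^n]: [4 b] from the upper side outside the peak and [b] from each vertical side. *)
pose c := 4/5 * eta * b / (6 * b * C).
have c0 : 0 < c by rewrite divr_gt0 ?mulr_gt0//; lra.
have rhoP : 0 <= rho < 1 by apply/andP; split=> //; lra.
have rho_ge0 : 0 <= rho by case/andP: rhoP.
have [n n_big Hn] := linear_geometric_small (Num.bound (b / d)).+1 rhoP c0.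
have n0 : 0 < n%:R :> R by rewrite ltr0n (leq_ltn_trans _ n_big).
have n_gt0 : (0 < n)%N by exact: leq_ltn_trans n_big.
have bn_d : b / n%:R <= d.
  rewrite ler_pdivrMr// mulrC -ler_pdivrMr// ltW//.
  apply: (lt_le_trans (archi_boundP _)); first by rewrite divr_ge0// ltW.
  by rewrite ler_nat ltnW.
have [X [Y [HX HY HXY]]] := cauchy_rectangle (3 * b) (cderivableM dg (@cderivableX _ k n dk)).
have {HXY} := HXY (- (2 * b)) (2 * b) 0 b.
have ineqs : [/\ - (3 * b) < - (2 * b), - (2 * b) <= 2 * b, 2 * b < 3 * b,
    - (3 * b) < 0 & 0 <= b /\ b < 3 * b] by clear -b0; split; [..|split]; lra.
case: ineqs => i1 i2 i3 i4 [i5 i6]; move=> /(_ i1 i2 i3 i4 i5 i6) {i1 i2 i3 i4 i5 i6}.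
rewrite /rect_integral => H0.
have bottom : `|X 0 (2 * b) - X 0 (- (2 * b))| <= 0 * (2 * b - - (2 * b)).
  apply: (@mean_value_ineq _ _ (fun=> 0)) => // [x xab|x _]; last by rewrite normr0.
  have : is_derive x 1 (X 0) (complex.Re (g (x +i* 0) * k (x +i* 0) ^+ n)).
    by apply: HX; rewrite ltr_norml; clear -xab b0; lra.
  by rewrite complexr0 g0 mul0r.
have side (x : R) : x ^+ 2 = 4 * b ^+ 2 -> (forall t : R, 0 <= t <= b -> nrm (g (x +i* t)) <= C) ->
    `|Y x b - Y x 0| <= C * rho ^+ n * (b - 0).
  move=> x2 HC; apply: (@mean_value_ineq _ _
      (fun y => complex.Im (g (x +i* y) * k (x +i* y) ^+ n))) => // [|y yb|y yb].
  - exact: ltW.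
  - by apply: HY; rewrite ltr_norml; clear -yb b0; lra.
  - apply: (le_trans (normIm_le _)); rewrite nrmM nrmX ler_pM ?nrm_ge0 ?exprn_ge0 ?nrm_ge0 ?HC//.
    apply: lerXn2r; rewrite ?nnegrE ?nrm_ge0//.
    exact: le_trans (k_side _ _ x2 yb) rho9.
have side1 := side (2 * b) ltac:(ring) HC2.
have side2 := side (- (2 * b)) ltac:(ring) HC3.
have dX (x : R) : - (2 * b) <= x <= 2 * b ->
    is_derive x 1 (X b) (complex.Re (g (x +i* b)) * q x ^+ n).
  move=> xab; have : is_derive x 1 (X b) (complex.Re (g (x +i* b) * k (x +i* b) ^+ n)).
    by apply: HX; rewrite ltr_norml; clear -xab b0; lra.
  rewrite k_top -rmorphXn /= -/(q x).
  by case: (g _) => u v /=; rewrite mulr0 subr0.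
have normG (x : R) : - (2 * b) <= x <= 2 * b -> `|complex.Re (g (x +i* b))| <= C.
  by move=> xb; apply: (le_trans (normRe_le _)); exact: HC1.
have pk := landau_peak b0 d0 d2b eta0 (ltW C0) dX Hd normG rhoq rho_ge0 n_gt0 bn_d.
set bn := b / n%:R in pk.
have bnE : bn * n%:R = b by rewrite /bn divfK// gt_eqF.
move: Hn; rewrite /c ltr_pdivlMr; last by rewrite !mulr_gt0.
move: bottom side1 side2 pk; rewrite mul0r !ler_norml subr0.
set u := C * rho ^+ n.
move=> /andP[bt1 bt2] /andP[s1 s2] /andP[s3 s4] pk Hn.
have key : 4/5 * eta * bn <= 6 * b * u.
  by clear -H0 bt1 bt2 s1 s2 s3 s4 pk; lra.
have : 4/5 * eta * bn * n%:R <= 6 * b * u * n%:R by rewrite ler_wpM2r// ltW.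
rewrite -mulrA bnE => h.
have hn : n%:R * rho ^+ n * (6 * b * C) = 6 * b * u * n%:R by rewrite /u; ring.
by clear -h hn Hn; lra.
Qed.

(** [entire_Re_le0] for the multiples of [g] by 1, -1, [i] and [-i] bounds both parts of the value
    from both sides. *)
Lemma entire_zero g (b : R) : cderivable g -> (forall x : R, g x%:C = 0) ->
  0 < b -> g (0 +i* b) = 0.
Proof.
move=> dg g0 b0.
have H (c : R[i]) : complex.Re (c * g (0 +i* b)) <= 0.
  have dcg := cderivableM (@cderivable_cst R c) dg.
  have cg0 (x : R) : c * g x%:C = 0 by rewrite g0 mulr0.
  exact: (entire_Re_le0 dcg cg0 b0).
have := H 1; have := H (-1); have := H ('i)%C; have := H (- 'i)%C.
case: (g _) => u v /= h1 h2 h3 h4; apply/eqP; rewrite eq_complex /= !eq_le.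
by clear -h1 h2 h3 h4; lra.
Qed.

Lemma entire_constant g (c : R[i]) (b : R) : cderivable g ->
  (forall x : R, g x%:C = c) -> 0 < b -> g (0 +i* b) = c.
Proof.
move=> dg gc b0; apply/eqP; rewrite -subr_eq0; apply/eqP.
have gc0 (x : R) : g x%:C - c = 0 by rewrite gc subrr.
exact: (entire_zero (cderivableB dg (@cderivable_cst R c)) gc0 b0).
Qed.

End IdentityTheorem.

(** * The complex exponential and vector-valued entire functions *)

Section ComplexExponential.
Context {R : realType}.

Lemma is_derive_le (f : R -> R) (x d : R) : is_derive x 1 f d -> forall e, 0 < e ->
  exists2 r, 0 < r & forall h, `|h| <= r -> `|f (x + h) - f x - h * d| <= e * `|h|.
Proof.
move=> [df dE] e e0.
have : h^-1 *: (f (h *: 1 + x) - f x) @[h --> 0^'] --> d by rewrite -dE; exact: df.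
move=> /cvgrPdist_le/(_ _ e0) [r /= r0 Hr]; exists (r / 2); first by rewrite divr_gt0.
move=> h hr; have [->|h0] := eqVneq h 0; first by rewrite addr0 subrr mul0r subr0 normr0 mulr0.
have : `|d - h^-1 *: (f (h *: 1 + x) - f x)| <= e.
  by apply: Hr => //=; rewrite sub0r normrN; apply: (le_lt_trans hr); lra.
rewrite /GRing.scale/= mulr1 => H.
have -> : f (x + h) - f x - h * d = - (h * (d - h^-1 * (f (h + x) - f x))).
  by rewrite (addrC x); field.
by rewrite normrN normrM mulrC ler_wpM2r.
Qed.

(** Serves to extend eigenvectors of the dynamics: [z -> cexp (i L z)] is the entire extension of
    the phase of frequency [L]. *)
Definition cexp (z : R[i]) : R[i] :=
  (expR (complex.Re z))%:C * (cos (complex.Im z) +i* sin (complex.Im z)).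

Lemma cexpD z w : cexp (z + w) = cexp z * cexp w.
Proof.
case: z w => x y [u v]; rewrite /cexp /= expRD cosD sinD.
by apply/eqP; rewrite eq_complex /=; apply/andP; split; apply/eqP; ring.
Qed.

Lemma cexp_le (e : R) : 0 < e -> exists2 r, 0 < r &
  forall h, nrm h <= r -> nrm (cexp h - 1 - h) <= e * nrm h.
Proof.
(* The real and imaginary parts of the error split into four terms worth 2, 1, 2 and 1 times
   [e / 6]; the factors 2 bound [expR x]. *)
move=> e0; have e6 : 0 < e / 6 by rewrite divr_gt0.
have [r1 r10 H1] := is_derive_le (is_derive_expR (0 : R)) e6.
have [r2 r20 H2] := is_derive_le (is_derive_cos (0 : R)) e6.
have [r3 r30 H3] := is_derive_le (is_derive_sin (0 : R)) e6.
have [r4 r40 H4] := is_derive_le (is_derive_expR (0 : R)) (ltr01 : 0 < 1 :> R).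
pose r := Num.min (Num.min r1 r2) (Num.min (Num.min r3 r4) (Num.min (e / 12) (1/2))).
exists r; first by rewrite /r !lt_min r10 r20 r30 r40 !divr_gt0.
move=> [x y]; set h := x +i* y; rewrite !le_min.
move=> /andP[/andP[hr1 hr2] /andP[/andP[hr3 hr4] /andP[hr5 hr6]]].
have xh : `|x| <= nrm h := normRe_le h.
have yh : `|y| <= nrm h := normIm_le h.
have := H1 x (le_trans xh hr1); have := H2 y (le_trans yh hr2).
have := H3 y (le_trans yh hr3); have := H4 x (le_trans xh hr4).
rewrite !add0r expR0 cos0 sin0 !mulr1 oppr0 mulr0 mul1r !subr0 ?addr0 => h4 h3 h2 h1.
have ex1 : `|expR x - 1| <= 2 * nrm h.
  have -> : expR x - 1 = (expR x - 1 - x) + x by ring.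
  by apply: (le_trans (ler_normD _ _)); clear -h4 xh; lra.
have ex2 : `|expR x| <= 2.
  have -> : expR x = (expR x - 1) + 1 by ring.
  by apply: (le_trans (ler_normD _ _)); rewrite normr1; clear -ex1 hr6; lra.
have n0 := nrm_ge0 h.
apply: (le_trans (nrm_le_Re_Im _)).
have -> : complex.Re (cexp h - 1 - h) = expR x * (cos y - 1) + (expR x - 1 - x).
  by rewrite /cexp /=; ring.
have -> : complex.Im (cexp h - 1 - h) = expR x * (sin y - y) + (expR x - 1) * y.
  by rewrite /cexp /=; ring.
have b1 : `|expR x * (cos y - 1)| <= 2 * (e / 6 * `|y|) by rewrite normrM ler_pM.
have b2 : `|expR x * (sin y - y)| <= 2 * (e / 6 * `|y|) by rewrite normrM ler_pM.
have b3 : `|(expR x - 1) * y| <= 2 * nrm h * nrm h by rewrite normrM ler_pM.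
have b4 : 2 * nrm h * nrm h <= e / 6 * nrm h by rewrite ler_wpM2r//; clear -hr5; lra.
have b5 : e / 6 * `|x| <= e / 6 * nrm h by rewrite ler_wpM2l// ltW.
have b6 : e / 6 * `|y| <= e / 6 * nrm h by rewrite ler_wpM2l// ltW.
have t1 := ler_normD (expR x * (cos y - 1)) (expR x - 1 - x).
have t2 := ler_normD (expR x * (sin y - y)) ((expR x - 1) * y).
have -> : e * nrm h = 6 * (e / 6 * nrm h) by field.
clear -b1 b2 b3 b4 b5 b6 t1 t2 h1; lra.
Qed.

(** The addition formula moves the question to the origin. Of the two factors in [M ^ 2], one
    absorbs [cexp (k z)] and the other [k]. *)
Lemma cderivable_cexp (k : R[i]) : cderivable (fun z => cexp (k * z)).
Proof.
move=> z; apply: (@nrm_derivable _ R[i]^o (fun z => cexp (k * z)) z (k * cexp (k * z))) => e e0.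
pose M := 1 + nrm k + nrm (cexp (k * z)).
have M1 : 1 <= M by rewrite /M -addrA lerDl addr_ge0 ?nrm_ge0.
have eM : 0 < e / M ^+ 2 by rewrite divr_gt0// exprn_gt0//; lra.
have [r r0 Hr] := cexp_le eM; exists (r / M); first by rewrite divr_gt0//; lra.
have M0 : 0 < M by lra.
have kM : nrm k <= M by rewrite /M addrAC lerDr addr_ge0 ?nrm_ge0.
have cM : nrm (cexp (k * z)) <= M by rewrite /M lerDr addr_ge0 ?nrm_ge0.
move=> h hr; have khr : nrm (k * h) <= r.
  rewrite nrmM; apply: (@le_trans _ _ (M * (r / M))); first by rewrite ler_pM ?nrm_ge0.
  by rewrite mulrC divfK// gt_eqF.
have -> : cexp (k * (z + h)) - cexp (k * z) - h *: (k * cexp (k * z)) =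
    cexp (k * z) * (cexp (k * h) - 1 - k * h).
  by rewrite mulrDr cexpD /GRing.scale /=; ring.
rewrite nrmM; apply: (@le_trans _ _ (M * (e / M ^+ 2 * (M * nrm h)))).
  rewrite ler_pM ?nrm_ge0//; apply: (le_trans (Hr _ khr)).
  by rewrite ler_wpM2l ?(ltW eM)// nrmM ler_wpM2r ?nrm_ge0.
by rewrite le_eqVlt; apply/orP; left; apply/eqP; field; lra.
Qed.

End ComplexExponential.

Section VectorValued.
Context {R : realType} {V W : normedModType R[i]}.
Implicit Types f : R[i] -> V.

Lemma nrm_derivable_cont f z : derivable (f : R[i]^o -> V) z 1 ->
  forall e : R, 0 < e -> exists2 r, 0 < r & forall h, nrm h <= r -> nrm (f (z + h) - f z) <= e.
Proof.
move=> df e e0; have [d Hd] := derivable_nrm df.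
have [r r0 Hr] := Hd 1 ltr01.
pose M := 1 + nrm d; have M0 : 0 < M by rewrite ltr_pwDl ?nrm_ge0.
exists (Num.min r (e / M)); first by rewrite lt_min r0 divr_gt0.
move=> h; rewrite le_min => /andP[/Hr h1 h2].
have -> : f (z + h) - f z = (f (z + h) - f z - h *: d) + h *: d by rewrite subrK.
apply: (le_trans (nrmD _ _)); rewrite nrmZ.
rewrite ler_pdivlMr// in h2; have := nrm_ge0 h; have := nrm_ge0 d.
rewrite /M in h2; clear -h1 h2; lra.
Qed.

Lemma derivable_linear f z (T : V -> W) (C : R) : 0 <= C -> linear T ->
  (forall x, nrm (T x) <= C * nrm x) ->
  derivable (f : R[i]^o -> V) z 1 -> derivable ((fun z => T (f z)) : R[i]^o -> W) z 1.
Proof.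
move=> C0 lT TC df; have [d Hd] := derivable_nrm df.
have TB x y : T (x - y) = T x - T y.
  by rewrite addrC -scaleN1r lT scaleN1r addrC.
have TZ k x : T (k *: x) = k *: T x.
  by rewrite -[k *: x]addr0 lT -(subrr x) TB !subrr addr0.
apply: (@nrm_derivable _ W (fun z => T (f z)) z (T d)) => e e0.
pose M := 1 + C; have M0 : 0 < M by rewrite ltr_pwDl.
have [r r0 Hr] := Hd (e / M) (divr_gt0 e0 M0); exists r => // h /Hr H.
rewrite -TZ -!TB; apply: (le_trans (TC _)).
apply: (@le_trans _ _ (M * (e / M * nrm h))).
  by apply: ler_pM => //; rewrite ?nrm_ge0// /M lerDr.
by rewrite mulrA mulrCA mulfV ?gt_eqF// mulr1.
Qed.

Lemma derivable_scale_cexp f z (k : R[i]) : derivable (f : R[i]^o -> V) z 1 ->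
  derivable ((fun z => cexp (k * z) *: f z) : R[i]^o -> V) z 1.
Proof.
move=> df; have [d Hd] := derivable_nrm df.
pose g z : R[i] := cexp (k * z).
have dg : derivable (g : R[i]^o -> R[i]^o) z 1 by exact: cderivable_cexp.
have [c Hc] := @derivable_nrm _ R[i]^o g z dg.
apply: (@nrm_derivable _ V _ z (c *: f z + g z *: d)) => e e0.
pose M := 2 + nrm (f z) + nrm c + nrm (g z).
have n1 := nrm_ge0 (f z); have n2 := nrm_ge0 c; have n3 := nrm_ge0 (g z).
have M2 : 2 <= M by rewrite /M; lra.
have M0 : 0 < M by lra.
have eM : 0 < e / (3 * M) by rewrite divr_gt0// mulr_gt0.
have [r1 r10 H1] := Hd _ eM; have [r2 r20 H2] := Hc _ eM.
have [r3 r30 H3] := nrm_derivable_cont df eM.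
have [r4 r40 H4] := nrm_derivable_cont df (ltr01 : 0 < 1 :> R).
exists (Num.min (Num.min r1 r2) (Num.min r3 r4)); first by rewrite !lt_min r10 r20 r30 r40.
move=> h; rewrite !le_min => /andP[/andP[/H1{}H1 /H2{}H2] /andP[/H3{}H3 /H4{}H4]].
have -> : g (z + h) *: f (z + h) - g z *: f z - h *: (c *: f z + g z *: d) =
    (g (z + h) - g z - h * c) *: f (z + h) + (h * c) *: (f (z + h) - f z)
      + g z *: (f (z + h) - f z - h *: d).
  have E (a b u v w x : V) : a - v - (w + x) = (a - b - u) + (u - w) + (b - v - x).
    rewrite (addrA (a - b - u)) subrK -(addrA b) (addrA (a - b - w)).
    by rewrite (addrAC (a - b)) subrK addrACA opprD.
  by rewrite !scalerBl !scalerBr scalerDr !scalerA (mulrC h (g z)) -E.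
apply: (le_trans (nrmD _ _)); apply: (le_trans (lerD (nrmD _ _) (lexx _))).
rewrite !nrmZ nrmM.
have f4 : nrm (f (z + h)) <= M.
  by apply: (le_trans (nrm_dist _ (f z))); rewrite /M; clear -H4 n1 n2 n3; lra.
have b1 : nrm (g (z + h) - g z - h * c) * nrm (f (z + h)) <= e / (3 * M) * nrm h * M.
  by rewrite ler_pM ?nrm_ge0.
have b2 : nrm h * nrm c * nrm (f (z + h) - f z) <= nrm h * M * (e / (3 * M)).
  rewrite ler_pM ?mulr_ge0 ?nrm_ge0// ler_wpM2l ?nrm_ge0// /M; clear -n1 n3; lra.
have b3 : nrm (g z) * nrm (f (z + h) - f z - h *: d) <= M * (e / (3 * M) * nrm h).
  rewrite ler_pM ?nrm_ge0// /M; clear -n1 n2; lra.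
have -> : e * nrm h = e / (3 * M) * nrm h * M + nrm h * M * (e / (3 * M))
  + M * (e / (3 * M) * nrm h) by field; lra.
by clear -b1 b2 b3; lra.
Qed.

End VectorValued.

(** * C*-algebras and positive functionals *)

Local Open Scope cstar_scope.

Section CStarBasics.
Context {R : realType} {A : cstarAlgType R}.
Implicit Types a b h x y : A.

Lemma cmul0l a : 0 ** a = 0.
Proof. by apply: (addIr (0 ** a)); rewrite -cmulDl !add0r. Qed.

Lemma cmul0r a : a ** 0 = 0.
Proof. by apply: (addIr (a ** 0)); rewrite -cmulDr !add0r. Qed.

Lemma cmulNl a b : (- a) ** b = - (a ** b).
Proof. by rewrite -scaleN1r cmulZl scaleN1r. Qed.

Lemma cmulNr a b : a ** (- b) = - (a ** b).
Proof. by rewrite -scaleN1r cmulZr scaleN1r. Qed.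

Lemma cmulBl a b x : (a - b) ** x = a ** x - b ** x.
Proof. by rewrite cmulDl cmulNl. Qed.

Lemma cmulBr a b x : x ** (a - b) = x ** a - x ** b.
Proof. by rewrite cmulDr cmulNr. Qed.

Lemma cmul_suml (I : Type) (r : seq I) (P : pred I) (F : I -> A) a :
  (\sum_(i <- r | P i) F i) ** a = \sum_(i <- r | P i) F i ** a.
Proof. by apply: (big_morph (cmul^~ a)) => [x y|]; rewrite ?cmulDl ?cmul0l. Qed.

Lemma cmul_sumr (I : Type) (r : seq I) (P : pred I) (F : I -> A) a :
  a ** (\sum_(i <- r | P i) F i) = \sum_(i <- r | P i) a ** F i.
Proof. by apply: (big_morph (cmul a)) => [x y|]; rewrite ?cmulDr ?cmul0r. Qed.

Lemma cstar0 : (0 : A)^# = 0.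
Proof. by apply: (addIr (0 : A)^#); rewrite -cstarD !add0r. Qed.

Lemma cstarN a : (- a)^# = - a^#.
Proof. by rewrite -scaleN1r cstarZ rmorphN rmorph1 scaleN1r. Qed.

Lemma cstarB a b : (a - b)^# = a^# - b^#.
Proof. by rewrite cstarD cstarN. Qed.

Lemma cstar_sum (I : Type) (r : seq I) (P : pred I) (F : I -> A) :
  (\sum_(i <- r | P i) F i)^# = \sum_(i <- r | P i) (F i)^#.
Proof. by apply: (big_morph cstar) => [x y|]; rewrite ?cstarD ?cstar0. Qed.

Lemma nrm_cmul a b : nrm (a ** b) <= nrm a * nrm b.
Proof. by rewrite -lecR rmorphM /= -!nrmE cnormM. Qed.

Lemma nrm_starM a : nrm (a^# ** a) = nrm a ^+ 2.
Proof. by apply: complexI; rewrite rmorphXn /= -!nrmE cnorm_star. Qed.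

Lemma nrm_star a : nrm a^# = nrm a.
Proof.
have le x : nrm x <= nrm x^#.
  have [->|x0] := eqVneq x 0; first by rewrite cstar0.
  have xp := nrm_gt0 x0; have := nrm_cmul x^# x; rewrite nrm_starM expr2.
  by rewrite ler_pM2r.
by apply/eqP; rewrite eq_le le -{2}(cstarK a) le.
Qed.

Lemma nrm_selfadjoint_sqr h : h^# = h -> nrm (h ** h) = nrm h ^+ 2.
Proof. by move=> hs; rewrite -{1}hs nrm_starM. Qed.

Lemma nrm_projection (p : A) : projection p -> nrm p <= 1.
Proof.
move=> [ps pp]; have := nrm_selfadjoint_sqr ps; rewrite pp expr2 => H.
have := nrm_ge0 p; have [->//|p0 _] := eqVneq (nrm p) 0.
by move: H; rewrite -{1}[nrm p]mulr1 => /(mulfI p0) <-.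
Qed.

Lemma geometric_cauchy (u : nat -> A) (rho C : R) : 0 <= rho < 1 ->
  (forall n, nrm (u n.+1 - u n) <= C * rho ^+ n) ->
  exists l, forall e : R, 0 < e -> exists N, forall n, (N <= n)%N -> nrm (l - u n) <= e.
Proof.
move=> rho01 Hu; have /andP[rho0 rho1] := rho01.
have C0 : 0 <= C by have := Hu 0%N; rewrite expr0 mulr1; apply: le_trans (nrm_ge0 _).
pose t n := C * rho ^+ n / (1 - rho).
have r10 : 0 < 1 - rho by rewrite subr_gt0.
have tS n : t n = C * rho ^+ n + t n.+1.
  by rewrite /t exprS; field; rewrite gt_eqF.
have t0 n : 0 <= t n by rewrite divr_ge0 ?mulr_ge0 ?exprn_ge0// ltW.
have dist n k : nrm (u (k + n)%N - u n) <= t n - t (k + n)%N.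
  elim: k => [|k ih]; first by rewrite !subrr nrm0.
  have -> : u (k.+1 + n)%N - u n = (u (k + n).+1%N - u (k + n)%N) + (u (k + n)%N - u n).
    by rewrite addrA subrK.
  apply: (le_trans (nrmD _ _)); have := Hu (k + n)%N; have := tS (k + n)%N.
  by clear -ih => h1 h2; rewrite addSn; lra.
have tlim e : 0 < e -> exists N, forall n, (N <= n)%N -> t n < e.
  move=> e0; have c0 : 0 < e * (1 - rho) / (C + 1) by rewrite divr_gt0 ?mulr_gt0// ltr_pwDr.
  have [N N1 HN] := linear_geometric_small 1 rho01 c0.
  exists N => n Nn; rewrite ltr_pdivrMr//.
  have h1 : rho ^+ n <= rho ^+ N by rewrite ler_wiXn2l// ltW.
  have h2 : rho ^+ N <= N%:R * rho ^+ N by rewrite ler_peMl ?exprn_ge0// ler1n.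
  have h3 : rho ^+ n < e * (1 - rho) / (C + 1) by exact: le_lt_trans (le_trans h1 h2) HN.
  rewrite ltr_pdivlMr ?ltr_pwDr// in h3.
  apply: le_lt_trans h3; rewrite mulrDr mulr1 mulrC lerDl exprn_ge0//.
have cu : cvgn u.
  apply/cauchy_cvgP/cauchy_exP => e e0.
  have eE : e = (complex.Re e)%:C by rewrite RRe_real// gtr0_real.
  have e0' : 0 < complex.Re e by rewrite -ltcR -eE.
  have [N HN] := tlim _ e0'; exists (u N); exists N => // n /= Nn.
  rewrite -ball_normE /= eE nrmE ltcR nrm_distC -(subnK Nn).
  apply: le_lt_trans (dist _ _) _; apply: le_lt_trans (HN N (leqnn _)).
  by rewrite gerBl.
exists (limn u) => e e0; move/cvg_nrmP: cu => /(_ e e0) [N _ HN].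
by exists N => n Nn; apply: HN.
Qed.

(* [1 - h^2 = (1 - b)^2] without a unit: [b] is the fixed point of
   [b -> (h^2 + b^2) / 2], a contraction of the ball of radius [|h|]. *)
Lemma cstar_sqrt h : h^# = h -> nrm h < 1 ->
  exists b, [/\ b^# = b, b ** h = h ** b & b + b - b ** b = h ** h].
Proof.
move=> hs h1; set rho := nrm h in h1; have rho0 : 0 <= rho := nrm_ge0 h.
pose half : R[i] := (2^-1)%:C.
have half_nrm : nrm half = 2^-1 by rewrite nrm_real ger0_norm// invr_ge0.
have halfD x : half *: x + half *: x = x.
  rewrite -scalerDl (_ : half + half = 1) ?scale1r// -rmorphD /=.
  by rewrite (_ : 2^-1 + 2^-1 = 1 :> R) ?rmorph1//; field.
pose F b := half *: (h ** h + b ** b).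
pose u := fix u n := if n is m.+1 then F (u m) else 0.
have us n : (u n)^# = u n.
  elim: n => [|n ih] /=; first exact: cstar0.
  by rewrite /F cstarZ cstarD !cstarM hs ih /half conjc_real.
have uh n : u n ** h = h ** u n.
  elim: n => [|n ih] /=; first by rewrite cmul0l cmul0r.
  by rewrite /F cmulZl cmulZr cmulDl cmulDr -!cmulA ih !cmulA ih.
have u_le n : nrm (u n) <= rho.
  elim: n => [|n ih] /=; first by rewrite nrm0.
  rewrite /F nrmZ half_nrm mulrC ler_pdivrMr//.
  have := nrmD (h ** h) (u n ** u n); have := nrm_cmul h h; have := nrm_cmul (u n) (u n).
  have : nrm (u n) * nrm (u n) <= rho * rho by rewrite ler_pM ?nrm_ge0.
  have : rho * rho <= rho by rewrite ler_piMl// ltW.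
  rewrite -/rho; lra.
have FB x y : nrm x <= rho -> nrm y <= rho -> nrm (F x - F y) <= rho * nrm (x - y).
  move=> xr yr; rewrite /F -scalerBr nrmZ half_nrm mulrC ler_pdivrMr//.
  have -> : h ** h + x ** x - (h ** h + y ** y) = x ** (x - y) + (x - y) ** y.
    rewrite cmulBr cmulBl opprD addrACA subrr add0r.
    by rewrite addrA subrK.
  apply: (le_trans (nrmD _ _)); have := nrm_cmul x (x - y); have := nrm_cmul (x - y) y.
  have d0 := nrm_ge0 (x - y).
  have := ler_wpM2r d0 xr; have := ler_wpM2l d0 yr; lra.
have [|b Hb] := @geometric_cauchy u rho (nrm (u 1%N)) ltac:(by rewrite rho0).
  elim=> [|n ih]; first by rewrite expr0 mulr1 /= subr0.
  have -> : u n.+2 - u n.+1 = F (u n.+1) - F (u n) by [].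
  apply: (le_trans (FB _ _ (u_le _) (u_le _))).
  by rewrite exprS mulrCA ler_wpM2l.
have small x : (forall e : R, 0 < e -> nrm x <= e) -> x = 0.
  move=> H; apply: nrm_eq0; apply/eqP; rewrite eq_le nrm_ge0 andbT.
  by apply/ler_addgt0Pr => e e0; rewrite add0r H.
have b_le : nrm b <= rho.
  apply/ler_addgt0Pr => e e0; have [N HN] := Hb e e0.
  by rewrite (le_trans (nrm_dist b (u N)))// lerD ?u_le ?HN.
exists b; split.
- apply/eqP; rewrite -subr_eq0; apply/eqP/small => e e0.
  have [N HN] := Hb (e / 2) ltac:(lra).
  have -> : b^# - b = (b - u N)^# - (b - u N) by rewrite cstarB us opprB addrA subrK.
  apply: (le_trans (nrmB _ _)); rewrite nrm_star; have := HN N (leqnn _); lra.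
- apply/eqP; rewrite -subr_eq0; apply/eqP/small => e e0.
  have [N HN] := Hb (e / 2) ltac:(lra).
  have -> : b ** h - h ** b = (b - u N) ** h - h ** (b - u N).
    by rewrite cmulBl cmulBr uh opprB addrA subrK.
  apply: (le_trans (nrmB _ _)); have := HN N (leqnn _).
  have := nrm_cmul (b - u N) h; have := nrm_cmul h (b - u N); have := nrm_ge0 (b - u N).
  rewrite -/rho; nra.
- suff bF : b = F b.
    by rewrite {1 2}bF halfD addrK.
  apply/eqP; rewrite -subr_eq0; apply/eqP/small => e e0.
  have [N HN] := Hb (e / 2) ltac:(lra).
  have -> : b - F b = (b - u N.+1) + (F (u N) - F b) by rewrite addrA subrK.
  apply: (le_trans (nrmD _ _)).
  have h2 := HN N.+1 (leqnSn _); have h3 := HN N (leqnn _).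
  have h4 := FB _ _ (u_le N) b_le; rewrite (nrm_distC (u N) b) in h4.
  have : rho * nrm (b - u N) <= nrm (b - u N) by rewrite ler_piMl ?nrm_ge0 ?ltW.
  lra.
Qed.

End CStarBasics.

Section StarHom.
Context {R : realType} {A B : cstarAlgType R} (f : A -> B).
Hypothesis f_hom : star_hom f.

Lemma star_hom_sub a b : f (a - b) = f a - f b.
Proof. by case: f_hom => fl _ _; rewrite addrC -scaleN1r fl scaleN1r addrC. Qed.

Lemma star_hom_scale k a : f (k *: a) = k *: f a.
Proof.
have f0 : f 0 = 0 by rewrite -(subrr 0) star_hom_sub subrr.
by case: f_hom => fl _ _; rewrite -[k *: a]addr0 fl f0 addr0.
Qed.

(* With [1 - h^2 = (1 - b)^2], [f h + i (1 - f b)] is unitary. *)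
Lemma star_hom_selfadjoint_le1 h : h^# = h -> nrm h < 1 -> nrm (f h) <= 1.
Proof.
move=> hs h1; have [b [bs bh bE]] := cstar_sqrt hs h1.
have [fl fM fS] := f_hom.
set S := f h; set c := f b.
have Ss : S^# = S by rewrite /S -fS hs.
have cs : c^# = c by rewrite /c -fS bs.
have cS : c ** S = S ** c by rewrite /S /c -!fM bh.
have fD x y : f (x + y) = f x + f y by rewrite -[x]scale1r fl !scale1r.
have cE : c + c - c ** c = S ** S by rewrite /c /S -!fM -fD -star_hom_sub bE.
have iC : (('i)%C : R[i])^* = - 'i by apply/eqP; rewrite eq_complex /= oppr0 !eqxx.
have ii : 'i * 'i = -1 :> R[i] by rewrite -expr2 sqr_i.
(* Without a unit the unitary exists only as a left multiplication. [U i] and [U (-i)] are isometric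
   with sum [2 S], so left multiplication by [S] is contractive, and at [x = S] this reads
   [|S|^2 <= |S|]. *)
pose U (e : R[i]) x := S ** x + e *: (x - c ** x).
have Us e x : e^* = - e -> e * e = -1 -> nrm (U e x) = nrm x.
  move=> eC ee.
  have : (U e x)^# ** U e x = x^# ** x.
    rewrite /U cstarD cstarZ cstarB !cstarM Ss cs eC.
    rewrite cmulDl !cmulDr !cmulZl !cmulZr scalerA mulNr ee opprK scale1r.
    rewrite !cmulBl !cmulBr !cmulA.
    have -> : x^# ** S ** c ** x = x^# ** c ** S ** x by rewrite -!cmulA (cmulA S) -cS -!cmulA.
    have -> : x^# ** S ** S ** x = x^# ** c ** x + x^# ** c ** x - x^# ** c ** c ** x.
      by rewrite -(cmulA x^# S S) -cE cmulBr cmulDr cmulBl cmulDl !cmulA.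
    rewrite scaleNr.
    set p := x^# ** c ** x; set q := x^# ** c ** c ** x; set r := x^# ** x.
    set v := e *: _.
    by rewrite addrA addrK -(addrA r) -opprD (addrA p p (- q)) addrC subrK.
  move=> /(congr1 (@nrm R B)); rewrite !nrm_starM => /eqP.
  by rewrite eqrXn2 ?nrm_ge0// => /eqP.
have Sx x : nrm (S ** x) <= nrm x.
  have u1 := Us ('i)%C x iC ii.
  have u2 : nrm (U (- 'i)%C x) = nrm x.
    by apply: Us; [apply/eqP; rewrite eq_complex /= !oppr0 !eqxx|rewrite mulrNN ii].
  have : nrm (S ** x + S ** x) <= nrm x + nrm x.
    rewrite -{1}u1 -u2 (_ : S ** x + S ** x = U 'i x + U (- 'i) x) ?nrmD//.
    by rewrite /U scaleNr addrACA subrr addr0.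
  rewrite -mulr2n -scaler_nat nrmZ (_ : 2%:R = 2%:C) ?nrm_real ?rmorphMn//.
  rewrite ger0_norm//; lra.
have := Sx S; rewrite (nrm_selfadjoint_sqr Ss) expr2.
have [->//|S0] := eqVneq (nrm S) 0.
by rewrite -[X in _ <= X]mul1r ler_pM2r// lt_def S0 nrm_ge0.
Qed.

(** The C*-identity reduces the claim to self-adjoint elements, which are rescaled to norm below
    1. *)
Lemma star_hom_contractive a : nrm (f a) <= nrm a.
Proof.
have [fl fM fS] := f_hom.
have sa h : h^# = h -> nrm (f h) <= nrm h.
  move=> hs; apply/ler_addgt0Pr => e e0.
  have k0 : 0 < nrm h + e by rewrite ltr_pwDr ?nrm_ge0.
  pose k := ((nrm h + e)^-1)%:C : R[i].
  have kn : nrm k = (nrm h + e)^-1 by rewrite nrm_real ger0_norm// invr_ge0 ltW.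
  have := @star_hom_selfadjoint_le1 (k *: h).
  rewrite cstarZ hs conjc_real => /(_ erefl).
  rewrite star_hom_scale !nrmZ kn mulrC ltr_pdivrMr// mul1r ltrDl e0 => /(_ isT).
  by rewrite mulrC ler_pdivrMr// mul1r.
have := sa (a^# ** a); rewrite cstarM cstarK fM fS !nrm_starM => /(_ erefl).
by rewrite ler_pXn2r ?nnegrE ?nrm_ge0.
Qed.

End StarHom.

Section PositiveFunctional.
Context {R : realType} {A : cstarAlgType R} (phi : A -> R[i]).
Implicit Types a b x y : A.
Hypothesis phi_lin : scalar phi.

Lemma functionalD a b : phi (a + b) = phi a + phi b.
Proof. by rewrite -{1}[a]scale1r phi_lin mul1r. Qed.

Lemma functional0 : phi 0 = 0.
Proof. by apply: (addIr (phi 0)); rewrite -functionalD !add0r. Qed.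

Lemma functionalZ k a : phi (k *: a) = k * phi a.
Proof. by rewrite -[k *: a]addr0 phi_lin functional0 addr0. Qed.

Lemma functionalN a : phi (- a) = - phi a.
Proof. by rewrite -scaleN1r functionalZ mulN1r. Qed.

Lemma functionalB a b : phi (a - b) = phi a - phi b.
Proof. by rewrite functionalD functionalN. Qed.

Lemma functional_sum (I : Type) (r : seq I) (P : pred I) (F : I -> A) :
  phi (\sum_(i <- r | P i) F i) = \sum_(i <- r | P i) phi (F i).
Proof. by apply: (big_morph phi) => [x y|]; rewrite ?functionalD ?functional0. Qed.

Hypothesis phi_pos : forall a, 0 <= phi (a^# ** a).

Let q x := complex.Re (phi (x^# ** x)).

Let qE x : phi (x^# ** x) = (q x)%:C.
Proof. by rewrite /q RRe_real// ger0_real. Qed.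

Let q_ge0 x : 0 <= q x.
Proof. by rewrite -ler0c -qE. Qed.

Lemma positive_expand x y (k : R[i]) : phi ((x + k *: y)^# ** (x + k *: y)) =
  phi (x^# ** x) + k * phi (x^# ** y) + k^* * phi (y^# ** x) + k * k^* * phi (y^# ** y).
Proof.
rewrite cstarD cstarZ cmulDl !cmulDr !cmulZl !cmulZr !functionalD !functionalZ.
by rewrite !addrA mulrA (mulrC k k^*).
Qed.

(** Polarisation: [positive_expand] with [k = 1] and [k = i] must have imaginary part 0. *)
Lemma positive_hermitian x y : phi (y^# ** x) = (phi (x^# ** y))^*.
Proof.
have im (a : A) : complex.Im (phi (a^# ** a)) = 0 by rewrite qE.
have := im (x + 1 *: y); have := im (x + 'i *: y).
rewrite !positive_expand !qE; case: (phi (x^# ** y)) => u v; case: (phi (y^# ** x)) => u' v' /=.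
rewrite !(mul0r, mul1r, mulr0, mulr1, oppr0, subr0, add0r, addr0) => h1 h2.
by apply/eqP; rewrite eq_complex /=; apply/andP; split; apply/eqP; lra.
Qed.

Lemma cauchy_schwarz x y : nrm (phi (x^# ** y)) ^+ 2 <= q x * q y.
Proof.
set n := nrm _.
have H (t : R) : 0 <= q x - 2 * t * n ^+ 2 + t ^+ 2 * n ^+ 2 * q y.
  have := phi_pos (x + (- t%:C * (phi (x^# ** y))^*) *: y).
  rewrite positive_expand (positive_hermitian x y) !qE /n nrm_sqr.
  case: (phi _) => u v; rewrite lecE /= => /andP[_ h].
  by apply: (le_trans h); rewrite le_eqVlt; apply/orP; left; apply/eqP; ring.
have n0 : 0 <= n ^+ 2 by exact: sqr_ge0.
have [qy|qy] := eqVneq (q y) 0.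
  (* If [q y = 0] the polynomial in [t] is affine of slope [-2 n^2]; at this [t] it equals
     [- q x - 2] unless [n = 0]. *)
  have := H ((1 + q x) / (n ^+ 2)); rewrite qy !mulr0 addr0.
  have [->//|nn] := eqVneq (n ^+ 2) 0.
  rewrite mulrA -[in X in X -> _]mulrA mulVf ?mulr1 => [h|//].
  by have := q_ge0 x; lra.
have qy0 : 0 < q y by rewrite lt_def qy q_ge0.
have := H (q y)^-1.
have -> : q x - 2 * (q y)^-1 * n ^+ 2 + (q y)^-1 ^+ 2 * n ^+ 2 * q y = q x - n ^+ 2 / q y.
  by field; rewrite gt_eqF.
by rewrite subr_ge0 ler_pdivrMr.
Qed.

Lemma cauchy_schwarz0l x y : phi (x^# ** x) = 0 -> phi (x^# ** y) = 0.
Proof.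
move=> x0; have := cauchy_schwarz x y; rewrite /q x0 mul0r => h.
apply: nrm_eq0; apply/eqP; rewrite -sqrf_eq0.
by apply/eqP/le_anti; rewrite h sqr_ge0.
Qed.

Lemma cauchy_schwarz0r x y : phi (x^# ** x) = 0 -> phi (y ** x) = 0.
Proof.
move=> x0; have := cauchy_schwarz0l y^# x0.
rewrite positive_hermitian cstarK => /(congr1 conjc); rewrite conjcK => ->.
by rewrite conjc0.
Qed.

(** With [h^2 = b + b - b^2] one gets [p - p h^2 p = (p - b p)^# (p - b p)], so [q (h p) <= q p];
    Cauchy-Schwarz for [p] and [h p] concludes. *)
Lemma positive_compress_selfadjoint p h : projection p -> h^# = h -> nrm h < 1 ->
  nrm (phi (p ** h ** p)) <= complex.Re (phi p).
Proof.
move=> [ps pp] hs h1; have [b [bs bh bE]] := cstar_sqrt hs h1.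
have pE : complex.Re (phi p) = q p by rewrite /q ps pp.
have H2 : q (h ** p) <= q p.
  rewrite -subr_ge0 -ler0c rmorphB /= -!qE -functionalB.
  suff -> : p^# ** p - (h ** p)^# ** (h ** p) = (p - b ** p)^# ** (p - b ** p) by [].
  rewrite cstarB !cstarM ps hs bs cmulBl !cmulBr pp !cmulA.
  rewrite -(cmulA p h h) -bE cmulBr cmulDr cmulBl cmulDl !cmulA.
  set u := p ** b ** p; set v := p ** b ** b ** p.
  by rewrite -(addrA u) opprD addrA.
have := cauchy_schwarz p (h ** p); rewrite ps cmulA -pE => h3.
rewrite -(ler_pXn2r (_ : 0 < 2)%N) ?nnegrE ?nrm_ge0 ?pE ?q_ge0//.
by apply: (le_trans h3); rewrite pE expr2 ler_wpM2l.
Qed.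

(** In the corner of [p] the projection acts as a unit, so positivity alone bounds the functional by
    its value at [p]. Cauchy-Schwarz for [p] and [x p] reduces to the self-adjoint element
    [x^# x]. *)
Lemma positive_compress p a : projection p ->
  nrm (phi (p ** a ** p)) <= complex.Re (phi p) * nrm a.
Proof.
move=> pp; have [ps p2] := pp.
have pE : complex.Re (phi p) = q p by rewrite /q ps p2.
have small x : nrm x < 1 -> nrm (phi (p ** x ** p)) <= q p.
  move=> x1; have xs : (x^# ** x)^# = x^# ** x by rewrite cstarM cstarK.
  have := @positive_compress_selfadjoint p (x^# ** x) pp xs.
  rewrite nrm_starM pE expr_lt1 ?nrm_ge0// => /(_ x1) h1.
  have := cauchy_schwarz p (x ** p); rewrite ps cmulA => h2.
  rewrite -(ler_pXn2r (_ : 0 < 2)%N) ?nnegrE ?nrm_ge0 ?q_ge0//.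
  apply: (le_trans h2); rewrite expr2 ler_wpM2l ?q_ge0//.
  apply: le_trans h1; apply: (le_trans _ (normRe_le _)).
  by rewrite /q cstarM ps !cmulA ler_norm.
rewrite pE; apply/ler_addgt0Pr => e e0.
pose d := e / (1 + q p).
have q1 : 0 < 1 + q p by rewrite ltr_pwDl.
have d0 : 0 < d by rewrite divr_gt0.
have k0 : 0 < nrm a + d by rewrite ltr_pwDr ?nrm_ge0.
pose k := ((nrm a + d)^-1)%:C : R[i].
have kn : nrm k = (nrm a + d)^-1 by rewrite nrm_real ger0_norm// invr_ge0 ltW.
have := small (k *: a); rewrite cmulZr cmulZl functionalZ nrmZ nrmM kn.
rewrite mulrC ltr_pdivrMr// mul1r ltrDl d0 => /(_ isT).
rewrite mulrC ler_pdivrMr// mulrDr => h.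
apply: (le_trans h); rewrite lerD2l /d mulrA ler_pdivrMr// [q p * e]mulrC.
by rewrite ler_wpM2l ?(ltW e0)// lerDr.
Qed.

End PositiveFunctional.

Section States.
Context {R : realType} {A : cstarAlgType R} (psi : A -> R[i]).

Lemma state_bounded : state psi -> forall a, nrm (psi a) <= nrm a.
Proof.
move=> [lin _ S1] a.
set E := (X in sup X) in S1.
have supE : has_sup E.
  apply: contrapT => nE; move: S1; rewrite sup_out// => /eqP.
  by rewrite eq_sym oner_eq0.
have small x : nrm x <= 1 -> nrm (psi x) <= 1.
  move=> x1; rewrite -S1; apply: sup_upper_bound => //.
  by exists x => //=; rewrite nrmE lecR.
have [->|a0] := eqVneq a 0; first by rewrite (functional0 lin) nrm0 nrm_ge0.
have an := nrm_gt0 a0; pose k := ((nrm a)^-1)%:C : R[i].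
have kn : nrm k = (nrm a)^-1 by rewrite nrm_real ger0_norm// invr_ge0 ltW.
have := small (k *: a); rewrite (functionalZ lin) nrmZ nrmM kn mulVf ?gt_eqF// lexx => /(_ isT).
by rewrite mulrC ler_pdivrMr// mul1r.
Qed.

Lemma state_le_bound (C : R) : state psi -> (forall a, nrm (psi a) <= C * nrm a) ->
  0 <= C -> 1 <= C.
Proof.
move=> [_ _ <-] bnd C0; apply: ge_sup.
  by exists (complex.Re `|psi 0|), 0 => //=; rewrite normr0.
move=> _ [a /= a1 <-]; rewrite nrmE lecR in a1.
by apply: (le_trans (bnd a)); rewrite ler_piMr.
Qed.

Lemma mk_state : scalar psi -> (forall a, 0 <= psi (a^# ** a)) ->
  (forall a, nrm (psi a) <= nrm a) ->
  (forall e : R, 0 < e -> exists2 a, nrm a <= 1 & 1 - e <= nrm (psi a)) -> state psi.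
Proof.
move=> lin pos bnd one; split=> // [a [c ->]|]; first exact: pos.
set E := (X in sup X).
have E1 : ubound E 1.
  by move=> _ [a /= a1 <-]; rewrite nrmE lecR in a1; exact: le_trans (bnd a) a1.
have E0 : E !=set0.
  have [a a1 _] := one 1 ltr01.
  by exists (nrm (psi a)), a => //=; rewrite nrmE lecR.
apply/eqP; rewrite eq_le; apply/andP; split; first exact: ge_sup.
apply/ler_addgt0Pr => e e0; have [a a1 ha] := one e e0.
rewrite -lerBlDr; apply: (le_trans ha); apply: ub_le_sup; first by exists 1.
by exists a => //=; rewrite nrmE lecR.
Qed.

End States.

(** * Graph families *)

Section GraphFamily.
Context {R : realType} {E : digraph} {V : set (vertex E)} {A : cstarAlgType R}.
Context {s : edge E -> A} {p : vertex E -> A} (fam : graph_family V s p).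
Implicit Types (e f : edge E) (v w : vertex E) (x y : A).

Lemma vproj v : projection (p v). Proof. by case: fam => _ []. Qed.

Lemma vproj_star v : (p v)^# = p v. Proof. by have [] := vproj v. Qed.

Lemma vproj_mul v w : p v ** p w = if v == w then p v else 0.
Proof.
case: eqP => [<-|vw]; first by have [] := vproj v.
by case: fam => _ [_ H] _ _ _; exact: H.
Qed.

Lemma edge_starM e : (s e)^# ** s e = p (rng e).
Proof. by case: fam. Qed.

(** On the range side the relation holds in [A] itself: [r = s_e p - s_e] has [r^# r = 0], and the
    C*-identity gives [r = 0]. *)
Lemma edge_rng e : s e ** p (rng e) = s e.
Proof.
apply/eqP; rewrite -subr_eq0; apply/eqP/nrm_eq0/eqP; rewrite -sqrf_eq0 -nrm_starM.
apply/eqP; have pss : p (rng e) ** (s e)^# ** s e = p (rng e).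
  by rewrite -cmulA edge_starM vproj_mul eqxx.
rewrite cstarB cstarM vproj_star cmulBl !cmulBr !cmulA pss edge_starM.
by rewrite vproj_mul eqxx !subrr nrm0.
Qed.

Lemma edge_rng_star e : p (rng e) ** (s e)^# = (s e)^#.
Proof. by rewrite -[RHS](congr1 cstar (edge_rng e)) cstarM vproj_star. Qed.

(** [s_e^# = s_e^# (s_e s_e^#)] and [s_f = (s_f s_f^#) s_f], and the two projections are
    orthogonal. *)
Lemma edge_orth e f : e <> f -> (s e)^# ** s f = 0.
Proof.
move=> ef; rewrite -(edge_rng f) -(edge_rng_star e) -!edge_starM.
rewrite -!cmulA (cmulA (s e) (s e)^#) (cmulA (s f)) (cmulA _ _ (s f)).
have [[_ H] _ _ _ _] := fam.
by rewrite -(cmulA (s e ** _)) (cmulA (s e ** _) (s f ** _)) (H _ _ ef) cmul0l cmul0r.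
Qed.

Lemma nrm_vproj v : nrm (p v) <= 1.
Proof. exact/nrm_projection/vproj. Qed.

Lemma nrm_edge e : nrm (s e) <= 1.
Proof.
have := nrm_starM (s e); rewrite edge_starM => h.
by rewrite -(expr_le1 (_ : 0 < 2)%N) ?nrm_ge0// -h nrm_vproj.
Qed.

Lemma vproj_sum_projection (r : seq (vertex E)) : uniq r -> projection (\sum_(v <- r) p v).
Proof.
move=> ur; split; first by rewrite cstar_sum; apply: eq_bigr => v _; exact: vproj_star.
rewrite cmul_suml; apply: eq_big_seq => v vr; rewrite cmul_sumr.
rewrite (bigD1_seq v)//= vproj_mul eqxx big1 ?addr0// => w wv.
by rewrite vproj_mul eq_sym (negbTE wv).
Qed.

(* The identity [p (src e) ** s e = s e] would follow from the spectral theory of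
   A; under positive functionals it only needs [r^# r = - (c s)^# (c s)] for
   [r = p s - s]. *)
Lemma edge_src_null (phi : A -> R[i]) e w x y :
  scalar phi -> (forall a, 0 <= phi (a^# ** a)) ->
  phi (y ** p w ** s e ** x) = if w == src e then phi (y ** s e ** x) else 0.
Proof.
move=> lin pos; have [_ _ _ H _] := fam; have {H}[c Hc] := H e.
have pE : p (src e) = s e ** (s e)^# + c^# ** c by rewrite -Hc addrC subrK.
pose r := p (src e) ** s e - s e.
have rr : r^# ** r = - ((c ** s e)^# ** (c ** s e)).
  rewrite /r cstarB !cstarM vproj_star cmulBl !cmulBr edge_starM.
  rewrite (cmulA (_ ** p _)) -(cmulA (s e)^# (p _)) vproj_mul eqxx.
  rewrite cmulA subrr sub0r opprB pE cmulDr cmulDl !cmulA.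
  rewrite edge_starM -(cmulA _ (s e)^#) edge_starM vproj_mul eqxx.
  by rewrite opprD addrA subrr sub0r.
have r0 : phi ((r ** x)^# ** (r ** x)) = 0.
  apply/eqP; rewrite eq_le pos andbT cstarM -cmulA (cmulA r^#) rr.
  rewrite cmulNl cmulNr (functionalN lin) oppr_le0.
  by rewrite (_ : x^# ** _ = (c ** s e ** x)^# ** (c ** s e ** x)) ?pos// !cstarM !cmulA.
have {r0} H z : phi (z ** p (src e) ** s e ** x) = phi (z ** s e ** x).
  apply/eqP; rewrite -subr_eq0 -(functionalB lin); apply/eqP.
  have <- := cauchy_schwarz0r lin pos z r0.
  by rewrite /r cmulBl cmulBr !cmulA.
case: eqP => [->|/eqP ws]; first exact: H.
have := H (y ** p w); rewrite -(cmulA y (p w)) vproj_mul (negbTE ws) cmul0r !cmul0l => <-.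
exact: functional0 lin.
Qed.

Lemma edge_src_null_star (phi : A -> R[i]) e w x y :
  scalar phi -> (forall a, 0 <= phi (a^# ** a)) ->
  phi (y ** (s e)^# ** p w ** x) = if w == src e then phi (y ** (s e)^# ** x) else 0.
Proof.
move=> lin pos; have := @edge_src_null phi e w y^# x^# lin pos.
have herm := positive_hermitian lin pos.
have -> : phi (y ** (s e)^# ** p w ** x) = (phi (x^# ** p w ** s e ** y^#))^*.
  by rewrite -[y ** (s e)^# ** p w]cstarK herm !cstarM !cstarK vproj_star !cmulA.
have -> : phi (y ** (s e)^# ** x) = (phi (x^# ** s e ** y^#))^*.
  by rewrite -[y ** (s e)^#]cstarK herm !cstarM !cstarK !cmulA.
by move=> ->; case: ifP; rewrite ?conjc0.
Qed.

End GraphFamily.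

Section GeneratedAlgebra.
Context {R : realType} {E : digraph} {V : set (vertex E)} {A : cstarAlgType R}.
Context {s : edge E -> A} {p : vertex E -> A} (fam : graph_family V s p).
Context (gen : forall D : set A, closed_star_subalgebra D ->
  (forall e, D (s e)) -> (forall v, D (p v)) -> D = setT).
Implicit Types (e f : edge E) (v w : vertex E) (x y : A).

(* The elements [a] such that [N] contains [a] and [a^#] and is stable under
   left multiplication by both form a closed *-subalgebra. *)
Lemma gen_induction (N : set A) : closed N -> N 0 ->
  (forall k x y, N x -> N y -> N (k *: x + y)) ->
  (forall e x, N x -> N (s e ** x)) -> (forall e x, N x -> N ((s e)^# ** x)) ->
  (forall v x, N x -> N (p v ** x)) ->
  (forall e, N (s e)^#) -> (forall v, N (p v)) -> forall a, N a.
Proof.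
move=> clN N0 linN sN ssN pN Ns Np.
pose D := [set a | [/\ N a, N a^# & forall x, N x -> N (a ** x) /\ N (a^# ** x)]].
suff DT : D = setT by move=> a; have [] : D a by rewrite DT.
apply: gen => [|e|v].
- split.
  + apply: closed_nrmP => a Da; split.
    * by apply: (closed_nrm clN) => e e0; have [b [Nb _ _] ab] := Da e e0; exists b.
    * apply: (closed_nrm clN) => e e0; have [b [_ Nb _] ab] := Da e e0; exists b^# => //.
      by rewrite -cstarB nrm_star.
    * move=> x Nx.
      have small (e : R) : 0 < e -> 0 < e / (1 + nrm x).
        by move=> e0; rewrite divr_gt0// ltr_pwDl ?nrm_ge0.
      have lt_e (c : A) (e : R) : 0 < e -> nrm c < e / (1 + nrm x) -> nrm (c ** x) < e.
        move=> e0; rewrite ltr_pdivlMr ?ltr_pwDl ?nrm_ge0// => h.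
        apply: le_lt_trans h; apply: (le_trans (nrm_cmul _ _)).
        by rewrite ler_wpM2l ?nrm_ge0// lerDr.
      split; apply: (closed_nrm clN) => e e0;
        have [b [_ _ /(_ x Nx)[b1 b2]] ab] := Da _ (small e e0).
        by exists (b ** x) => //; rewrite -cmulBl; exact: lt_e.
      by exists (b^# ** x) => //; rewrite -cmulBl -cstarB; apply: lt_e; rewrite ?nrm_star.
  + by rewrite /D /= cstar0; split=> // x Nx; rewrite cmul0l.
  + move=> k a b [Na Nas Ha] [Nb Nbs Hb]; split; first exact: linN.
      by rewrite cstarD cstarZ; exact: linN.
    move=> x Nx; have [? ?] := Ha x Nx; have [? ?] := Hb x Nx.
    by rewrite cstarD cstarZ !cmulDl !cmulZl; split; exact: linN.
  + move=> a b [Na Nas Ha] [Nb Nbs Hb]; split; first by have [] := Ha b Nb.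
      by rewrite cstarM; have [] := Hb _ Nas.
    move=> x Nx; have [? ?] := Ha x Nx; have [? ?] := Hb x Nx.
    by rewrite cstarM -!cmulA; split; [apply: (Ha _ _).1|apply: (Hb _ _).2].
  + move=> a [Na Nas Ha]; split=> //; first by rewrite cstarK.
    by move=> x Nx; rewrite cstarK; have [] := Ha x Nx.
- split=> // [|x Nx]; first by rewrite -(edge_rng fam); exact: sN.
  by split; [exact: sN|exact: ssN].
- by split=> // [|x Nx]; rewrite (vproj_star fam)//; split; exact: pN.
Qed.

Definition tends0 (u : nat -> R[i]) := forall e : R, 0 < e ->
  exists n0, forall n, (n0 <= n)%N -> nrm (u n) <= e.

Lemma tends0D u u' : tends0 u -> tends0 u' -> tends0 (fun n => u n + u' n).
Proof.
move=> u0 v0 e e0; have [n1 H1] := u0 (e / 2) ltac:(lra).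
have [n2 H2] := v0 (e / 2) ltac:(lra).
exists (maxn n1 n2) => n; rewrite geq_max => /andP[/H1{}H1 /H2{}H2].
by apply: (le_trans (nrmD _ _)); lra.
Qed.

Lemma tends0M (k : R[i]) u : tends0 u -> tends0 (fun n => k * u n).
Proof.
move=> u0 e e0; have k0 : 0 < 1 + nrm k by rewrite ltr_pwDl ?nrm_ge0.
have [n0 H] := u0 _ (divr_gt0 e0 k0); exists n0 => n /H.
rewrite ler_pdivlMr// nrmM; apply: le_trans.
by rewrite mulrC ler_wpM2l ?nrm_ge0// lerDr.
Qed.

Lemma tends0_cst0 : tends0 (fun=> 0).
Proof. by move=> e e0; exists 0%N => n _; rewrite nrm0 ltW. Qed.

(* Words in the adjoints of the generators act by left multiplication; in the
   absence of a unit they are kept as operators. *)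
Definition pull (l : seq (edge E + vertex E)) x : A :=
  foldl (fun x a => match a with inl e => (s e)^# ** x | inr v => p v ** x end) x l.

Lemma pull_mul l x y : pull l (x ** y) = pull l x ** y.
Proof. by elim: l x => //= -[e|v] l ih x; rewrite -ih cmulA. Qed.

Lemma pull_linear l k x y : pull l (k *: x + y) = k *: pull l x + pull l y.
Proof. by elim: l x y => //= -[e|v] l ih x y; rewrite cmulDr cmulZr ih. Qed.

Lemma pull0 l : pull l 0 = 0.
Proof. by have := pull_mul l 0 0; rewrite cmul0l cmul0r. Qed.

Lemma pullB l x y : pull l (x - y) = pull l x - pull l y.
Proof. by rewrite addrC -scaleN1r pull_linear scaleN1r addrC. Qed.

Lemma nrm_pull l x : nrm (pull l x) <= nrm x.
Proof.
elim: l x => //= -[e|v] l ih x; apply: (le_trans (ih _)); apply: (le_trans (nrm_cmul _ _)).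
  by rewrite nrm_star ler_piMl ?nrm_ge0// (nrm_edge fam).
by rewrite ler_piMl ?nrm_ge0// (nrm_vproj fam).
Qed.

(* A functional killing [s_e A] and [A s_e^#] is determined by its values on the
   vertex projections; this is the asymptotic form of that fact. *)
Lemma vanishing_functionals (theta : nat -> A -> R[i]) (C : R) : 0 <= C ->
  (forall n, scalar (theta n)) -> (forall n a, nrm (theta n a) <= C * nrm a) ->
  (forall n e w x y, theta n (y ** p w ** s e ** x) =
    if w == src e then theta n (y ** s e ** x) else 0) ->
  (forall e x, tends0 (fun n => theta n (s e ** x))) ->
  (forall e w x, tends0 (fun n => theta n (p w ** s e ** x))) ->
  (forall e x, tends0 (fun n => theta n (x ** (s e)^#))) ->
  (forall e w x, tends0 (fun n => theta n (x ** (s e)^# ** p w))) ->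
  (forall v, tends0 (fun n => theta n (p v))) ->
  forall a, tends0 (fun n => theta n a).
Proof.
move=> C0 lin bnd null hs hps hss hssp hp a.
(* All words are quantified over so that stability under left multiplication by adjoints and vertex
   projections is built in; left multiplication by [s_e] remains to be computed. *)
pose N := [set x | forall l, tends0 (fun n => theta n (pull l x))].
suff : N a by move=> /(_ [::]).
have Ns e x : N x -> N (s e ** x).
  move=> Nx l.
  have contract f l' : tends0 (fun n => theta n (pull l' ((s f)^# ** s e ** x))).
    have [<-|fe] := pselect (f = e).
      by rewrite (edge_starM fam); exact: (Nx (inr (rng f) :: l')).
    by rewrite (edge_orth fam fe) cmul0l pull0; under eq_fun do rewrite (functional0 (lin _)); exact: tends0_cst0.
  (* A projection [p w] in front of [s e] is absorbed by [null] as soon as an adjoint edge stands to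
     its left. With nothing to its left there is no factor [y] to use, which is what the separate
     hypothesis [hps] covers. *)
  have withp : forall l' w, tends0 (fun n => theta n (pull l' (p w ** s e ** x))).
    elim=> [|[f|v] l' ih] w /=; first exact: hps.
      have -> : (fun n => theta n (pull l' ((s f)^# ** (p w ** s e ** x)))) =
          (fun n => if w == src e then theta n (pull l' ((s f)^# ** s e ** x)) else 0).
        by apply/funext => n; rewrite !cmulA !pull_mul null.
      by case: (w == src e); [exact: contract|exact: tends0_cst0].
    rewrite !cmulA (vproj_mul fam); case: (v =P w) => [->|_]; first exact: ih.
    by rewrite !cmul0l pull0; under eq_fun do rewrite (functional0 (lin _)); exact: tends0_cst0.
  case: l => [|[f|v] l] /=; first exact: hs.
    by rewrite cmulA; exact: contract.
  by rewrite cmulA; exact: withp.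
apply: gen_induction => //.
- apply: closed_nrmP => x Nx l e e0.
  have C1 : 0 < 1 + C by rewrite ltr_pwDl.
  have e2 : 0 < e / 2 by rewrite divr_gt0.
  have [y Ny xy] := Nx _ (divr_gt0 e2 C1).
  have [n0 Hn] := Ny l _ e2; exists n0 => n /Hn h.
  apply: (le_trans (nrm_dist _ (theta n (pull l y)))).
  rewrite -(functionalB (lin n)) -pullB.
  have := bnd n (pull l (x - y)); have := nrm_pull l (x - y).
  rewrite ltr_pdivlMr// in xy; have := nrm_ge0 (x - y); have := nrm_ge0 (pull l (x - y)).
  by clear -C0 xy h; nra.
- by move=> l; rewrite pull0; under eq_fun do rewrite (functional0 (lin _)); exact: tends0_cst0.
- move=> k x y Nx Ny l.
  have -> : (fun n => theta n (pull l (k *: x + y))) =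
     (fun n => k * theta n (pull l x) + theta n (pull l y)).
    by apply/funext => n; rewrite pull_linear lin.
  exact/tends0D/Ny/tends0M/Nx.
- by move=> e x Nx l; exact: (Nx (inl e :: l)).
- by move=> v x Nx l; exact: (Nx (inr v :: l)).
- move=> e l; rewrite -(edge_rng_star fam).
  under eq_fun do rewrite pull_mul; exact: hss.
- move=> v l; elim: l v => [|[f|w] l ih] v /=; first exact: hp.
    rewrite -(edge_rng_star fam) -cmulA; under eq_fun do rewrite pull_mul cmulA.
    exact: hssp.
  rewrite (vproj_mul fam); case: (w =P v) => _; first exact: ih.
  by rewrite pull0; under eq_fun do rewrite (functional0 (lin _)); exact: tends0_cst0.
Qed.

End GeneratedAlgebra.

(** * Unconditional sums *)

Section UnconditionalSums.
Context {R : realType} {I : choiceType}.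
Implicit Types (x y : I -> R[i]) (F : seq I).

(** Convergence along the net of finite subsets, each represented by a list without repetition; [F0]
    itself may repeat entries. *)
Definition has_sum x (t : R[i]) := forall e : R, 0 < e -> exists F0, forall F,
  uniq F -> {subset F0 <= F} -> nrm (t - \sum_(i <- F) x i) <= e.

Lemma has_sum_eq x y t : x =1 y -> has_sum x t -> has_sum y t.
Proof.
move=> xy xt e e0; have [F0 H] := xt e e0; exists F0 => F uF sF.
by rewrite -(eq_bigr _ (fun i _ => xy i)); exact: H.
Qed.

Lemma has_sum_linear k x y t u : has_sum x t -> has_sum y u ->
  has_sum (fun i => k * x i + y i) (k * t + u).
Proof.
move=> xt yu e e0; have k1 : 0 < 1 + nrm k by rewrite ltr_pwDl ?nrm_ge0.
have e2 : 0 < e / 2 by rewrite divr_gt0.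
have [F1 H1] := xt _ (divr_gt0 e2 k1); have [F2 H2] := yu _ e2.
exists (F1 ++ F2) => F uF sF.
have h1 := H1 F uF (fun i iF => sF i ltac:(by rewrite mem_cat iF)).
have h2 := H2 F uF (fun i iF => sF i ltac:(by rewrite mem_cat iF orbT)).
rewrite big_split -mulr_sumr opprD addrACA -mulrBr.
apply: (le_trans (nrmD _ _)); rewrite nrmM.
rewrite ler_pdivlMr// in h1; have := nrm_ge0 (t - \sum_(i <- F) x i).
by clear -h1 h2; lra.
Qed.

Lemma has_sum0 : has_sum (fun=> 0) 0.
Proof. by move=> e e0; exists [::] => F _ _; rewrite big1// subrr nrm0 ltW. Qed.

Lemma has_sumZ k x t : has_sum x t -> has_sum (fun i => k * x i) (k * t).
Proof.
move=> /(has_sum_linear k)/(_ has_sum0); rewrite addr0.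
by apply: has_sum_eq => i; rewrite addr0.
Qed.

Lemma has_sum_unique x t u : has_sum x t -> has_sum x u -> t = u.
Proof.
move=> xt xu; apply/eqP; rewrite -subr_eq0; apply/eqP/nrm_eq0.
apply/eqP; rewrite eq_le nrm_ge0 andbT; apply/ler_addgt0Pr => e e0; rewrite add0r.
have e2 : 0 < e / 2 by rewrite divr_gt0.
have [F1 H1] := xt _ e2; have [F2 H2] := xu _ e2; pose F := undup (F1 ++ F2).
have h1 : nrm (t - \sum_(i <- F) x i) <= e / 2.
  by apply: H1; [exact: undup_uniq|move=> i iF; rewrite mem_undup mem_cat iF].
have h2 : nrm (u - \sum_(i <- F) x i) <= e / 2.
  by apply: H2; [exact: undup_uniq|move=> i iF; rewrite mem_undup mem_cat iF orbT].
have -> : t - u = (t - \sum_(i <- F) x i) - (u - \sum_(i <- F) x i).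
  by rewrite opprB addrA subrK.
by apply: (le_trans (nrmB _ _)); clear -h1 h2; lra.
Qed.

Lemma has_sum_ge0 x t : (forall i, 0 <= x i) -> has_sum x t -> 0 <= t.
Proof.
move=> x0 xt.
have near e : 0 < e -> exists2 u : R[i], 0 <= u & nrm (t - u) <= e.
  move=> e0; have [F0 H] := xt e e0; exists (\sum_(i <- undup F0) x i); first exact: sumr_ge0.
  by apply: H; [exact: undup_uniq|move=> i; rewrite mem_undup].
rewrite lecE /=; apply/andP; split.
  rewrite -normr_le0; apply/ler_addgt0Pr => e e0; rewrite add0r.
  have [u u0 tu] := near e e0; apply: le_trans tu; apply: le_trans (normIm_le _).
  by have := ger0_Im u0; case: (t) (u) => a b [a' b'] /= ->; rewrite subr0.
apply/ler_addgt0Pr => e e0; have [u u0 tu] := near e e0.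
have := le_trans (normRe_le _) tu; move: u0; rewrite lecE /= => /andP[_].
by case: (t) (u) => a b [a' b'] /=; rewrite ler_norml => ? /andP[? ?]; lra.
Qed.

Lemma has_sum_tail x t (F0 : seq I) (B : R) : has_sum x t -> uniq F0 ->
  (forall F, uniq F -> {in F, forall i, i \notin F0} -> \sum_(i <- F) nrm (x i) <= B) ->
  nrm (t - \sum_(i <- F0) x i) <= B.
Proof.
move=> xt uF0 HB; apply/ler_addgt0Pr => e e0; have [F1 H1] := xt e e0.
pose F := undup (F0 ++ F1).
have h1 : nrm (t - \sum_(i <- F) x i) <= e.
  by apply: H1; [exact: undup_uniq|move=> i iF; rewrite mem_undup mem_cat iF orbT].
pose F2 := [seq i <- F | i \notin F0].
have pF : perm_eq F (F0 ++ F2).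
  apply: uniq_perm; first exact: undup_uniq.
    rewrite cat_uniq uF0 filter_uniq ?undup_uniq// andbT /=.
    by apply/hasPn => i; rewrite mem_filter => /andP[].
  by move=> i; rewrite mem_cat mem_filter mem_undup mem_cat; case: (i \in F0).
rewrite (perm_big _ pF) big_cat /= in h1.
have h2 : nrm (\sum_(i <- F2) x i) <= B.
  apply: (le_trans (nrm_sum _ _ _)); apply: HB; first by rewrite filter_uniq ?undup_uniq.
  by move=> i; rewrite mem_filter => /andP[].
have -> : t - \sum_(i <- F0) x i =
    (t - (\sum_(i <- F0) x i + \sum_(i <- F2) x i)) + \sum_(i <- F2) x i.
  by rewrite opprD addrA subrK.
apply: (le_trans (nrmD _ _)); clear -h1 h2; lra.
Qed.

Lemma has_sum_bound x t (B : R) : has_sum x t ->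
  (forall F, uniq F -> \sum_(i <- F) nrm (x i) <= B) -> nrm t <= B.
Proof.
move=> xt HB; have := @has_sum_tail x t [::] B xt isT.
by rewrite big_nil subr0; apply => F uF _; exact: HB.
Qed.

Lemma has_sum_nonneg (y : I -> R) (B : R) : (forall i, 0 <= y i) ->
  (forall F, uniq F -> \sum_(i <- F) y i <= B) -> exists t, has_sum (fun i => (y i)%:C) t.
Proof.
move=> y0 HB; pose S := [set \sum_(i <- F) y i | F in [set F | uniq F]].
have ubS : has_ubound S by exists B => _ [F uF <-]; exact: HB.
have hS : has_sup S by split => //; exists (\sum_(i <- [::]) y i), [::].
exists (sup S)%:C => e e0.
have [_ [F0 uF0 <-] h0] := sup_adherent e0 hS.
exists F0 => F uF sF.
rewrite -rmorph_sum -rmorphB nrm_real ger0_norm.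
  have h1 : \sum_(i <- F0) y i <= \sum_(i <- F) y i.
    have pF : perm_eq F (F0 ++ [seq i <- F | i \notin F0]).
      apply: uniq_perm => //.
        rewrite cat_uniq uF0 filter_uniq// andbT /=.
        by apply/hasPn => i; rewrite mem_filter => /andP[].
      move=> i; rewrite mem_cat mem_filter; case: (boolP (i \in F0)) => //= iF.
      exact: sF.
    by rewrite (perm_big _ pF) big_cat /= lerDl sumr_ge0.
  by clear -h0 h1; lra.
by rewrite subr_ge0; apply: ub_le_sup => //; exists F.
Qed.

(** Absolute summability reduces to nonnegative terms: the real part is [(|x| + Re x) - |x|], a
    difference of two summable nonnegative families, and likewise the imaginary part. *)
Lemma has_sum_exists x (B : R) :
  (forall F, uniq F -> \sum_(i <- F) nrm (x i) <= B) -> exists t, has_sum x t.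
Proof.
move=> HB.
have [t0 H0] := has_sum_nonneg (fun i => nrm_ge0 (x i)) HB.
have half (P : R[i] -> R) : (forall z, `|P z| <= nrm z) ->
    exists t, has_sum (fun i => (nrm (x i) + P (x i))%:C) t.
  move=> HP; apply: (@has_sum_nonneg _ (B + B)) => [i|F uF].
    by have := HP (x i); rewrite ler_norml; lra.
  rewrite big_split lerD ?HB//; apply: le_trans (HB F uF).
  by apply: ler_sum => i _; apply: le_trans (HP _); exact: ler_norm.
have [t1 H1] := half _ (@normRe_le R); have [t2 H2] := half _ (@normIm_le R).
exists ('i * (-1 * t0 + t2) + (-1 * t0 + t1)).
have := has_sum_linear 'i (has_sum_linear (-1) H0 H2) (has_sum_linear (-1) H0 H1).
apply: has_sum_eq => i; rewrite !mulN1r !rmorphD /= !addKr.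
by rewrite [RHS]complexE addrC.
Qed.

(** For terms that vanish outside the image of the injection [h], whose partial inverse is [g];
    intended for prefixing a path by an edge. *)
Lemma has_sum_reindex (h : I -> I) (g : I -> option I) x t :
  pcancel h g -> ocancel g h -> (forall i, g i = None -> x i = 0) ->
  has_sum (fun j => x (h j)) t -> has_sum x t.
Proof.
move=> hg gh x0 ht e e0; have [F0 H] := ht e e0.
exists [seq h j | j <- F0] => F uF sF.
have -> : \sum_(i <- F) x i = \sum_(j <- pmap g F) x (h j).
  elim: F {uF sF} => [|i F ih]; first by rewrite !big_nil.
  rewrite big_cons ih /=; have := gh i; case gi : (g i) => [j|] /=.
    by move=> <-; rewrite big_cons.
  by move=> _; rewrite x0// add0r.
apply: H => [|j jF0]; first exact: pmap_uniq gh _ uF.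
by rewrite mem_pmap -hg map_f// sF// map_f.
Qed.

Lemma has_sum_partial (y : I -> R) (t : R[i]) (G : seq I) :
  (forall i, 0 <= y i) -> has_sum (fun i => (y i)%:C) t -> uniq G ->
  \sum_(i <- G) y i <= complex.Re t.
Proof.
move=> y0 yt uG; apply/ler_addgt0Pr => e e0; have [F0 H] := yt e e0.
pose F := undup (G ++ F0).
have h1 : nrm (t - \sum_(i <- F) (y i)%:C) <= e.
  by apply: H; [exact: undup_uniq|move=> i iF; rewrite mem_undup mem_cat iF orbT].
have h2 : \sum_(i <- G) y i <= \sum_(i <- F) y i.
  have pF : perm_eq F (G ++ [seq i <- F | i \notin G]).
    apply: uniq_perm; first exact: undup_uniq.
      rewrite cat_uniq uG filter_uniq ?undup_uniq// andbT /=.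
      by apply/hasPn => i; rewrite mem_filter => /andP[].
    by move=> i; rewrite mem_cat mem_filter mem_undup mem_cat; case: (i \in G).
  by rewrite (perm_big _ pF) big_cat /= lerDl sumr_ge0.
have := le_trans (Re_lip _ _) h1; rewrite -rmorph_sum /= ler_norml => /andP[h3 _].
by clear -h2 h3; lra.
Qed.

End UnconditionalSums.

(** * Partition functions *)

Lemma partition_seq (R : realType) (T K : eqType) (k : T -> K) (Ks : seq K) (F : seq T)
    (X : T -> R) : uniq Ks -> {in F, forall l, k l \in Ks} ->
  \sum_(l <- F) X l = \sum_(w <- Ks) \sum_(l <- [seq l <- F | k l == w]) X l.
Proof.
move=> uK FK.
under [RHS]eq_bigr do rewrite big_filter big_mkcond /=.
rewrite exchange_big /=; apply: eq_big_seq => l /FK lK.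
rewrite (bigD1_seq (k l))//= eqxx big1 ?addr0// => w wk.
by rewrite eq_sym (negbTE wk).
Qed.

Section PathWeights.
Context {R : realType} {E : digraph} (N : edge E -> R) (N_gt1 : forall e, 1 < N e).
Implicit Types (e : edge E) (v w : vertex E) (l : seq (edge E)) (b : R).

(* A path with range [v] is encoded by its list of edges: [lsrc v l] is its source
   and [lpath v l] says that consecutive edges match and that the last one ends at
   [v]. *)
Definition lsrc v l := if l is e :: _ then src e else v.

Fixpoint lpath v l := if l is e :: l' then (rng e == lsrc v l') && lpath v l' else true.

Definition lweight b l : R := (\prod_(e <- l) N e) `^ (- b).

Lemma N_gt0 e : 0 < N e. Proof. exact: lt_trans (N_gt1 e). Qed.

Lemma prodN_ge1 l : 1 <= \prod_(e <- l) N e.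
Proof.
elim: l => [|e l ih]; first by rewrite big_nil.
by rewrite big_cons -[leLHS]mulr1 ler_pM// ltW.
Qed.

Lemma prodN_gt1 l : l != [::] -> 1 < \prod_(e <- l) N e.
Proof.
case: l => // e l _; rewrite big_cons; apply: lt_le_trans (N_gt1 e) _.
by rewrite ler_peMr ?prodN_ge1// ltW// N_gt0.
Qed.

Lemma lweight_nil b : lweight b [::] = 1.
Proof. by rewrite /lweight big_nil powR1. Qed.

Lemma lweight_cons b e l : lweight b (e :: l) = N e `^ (- b) * lweight b l.
Proof.
rewrite /lweight big_cons powRM// ltW ?N_gt0//.
by apply: lt_le_trans (prodN_ge1 l).
Qed.

Lemma lweight_gt0 b l : 0 < lweight b l.
Proof. by rewrite powR_gt0//; apply: lt_le_trans (prodN_ge1 l). Qed.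

Lemma lpath_paths v l : lpath v l -> paths_to v (lsrc v l, l).
Proof.
elim: l => [|e l ih] //= /andP[/eqP el vl]; have [pl rl] := ih vl.
split; rewrite /is_path /path_rng /=.
  rewrite eqxx /=; case: l el pl {ih vl rl} => //= f l ef /andP[_ ->].
  by rewrite ef eqxx.
move: rl; rewrite /path_rng /= => <-.
by case: l el {ih vl pl} => //= ->.
Qed.

Lemma paths_lpath v u : paths_to v u -> lpath v u.2 /\ u.1 = lsrc v u.2.
Proof.
case: u => w l; rewrite /paths_to /= => -[].
elim: l w => [|e l ih] w /=; first by move=> _; rewrite /path_rng /=.
move=> /andP[/eqP ew pl]; rewrite /path_rng /= => lv.
have [||h1 h2] := ih (rng e).
- by rewrite /is_path; case: (l) pl => //= f l' /andP[/eqP -> ->]; rewrite eqxx.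
- by rewrite /path_rng.
- by rewrite h1 -h2 eqxx.
Qed.

(* [m] is subinvariant for the weights at [b], and strictly so at [v] for the
   weights at [b + 1]; the defect [d] at [v] bounds the partition function. *)
Lemma subinvariant_bound (m : vertex E -> R) b v : (forall w, 0 <= m w) ->
  (forall w (F : seq (edge E)), uniq F -> {in F, forall e, src e = w} ->
    \sum_(e <- F) N e `^ (- b) * m (rng e) <= m w) ->
  (forall F : seq (vertex E), uniq F -> \sum_(w <- F) m w <= 1) ->
  0 < m v ->
  exists B, forall F : seq (seq (edge E)), uniq F -> {in F, forall l, lpath v l} ->
    \sum_(l <- F) lweight (b + 1) l <= B.
Proof.
move=> m0 sub mass mv.
have NS e : N e `^ (- (b + 1)) = N e `^ (- b) / N e.
  rewrite opprD powRD; last by apply/implyP => _; rewrite gt_eqF ?N_gt0.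
  by rewrite (powRN _ 1) powRr1// ltW ?N_gt0.
have le1 e : N e `^ (- (b + 1)) * m (rng e) <= N e `^ (- b) * m (rng e).
  rewrite ler_wpM2r// NS ler_piMr ?powR_ge0// invf_le1 ?N_gt0//.
  exact: ltW.
(* If some edge [e0] leaving [v] has [m (rng e0) > 0], its term [t] shrinks to [t / N e0] at
   [b + 1], and the loss is the defect. Otherwise the sum is 0 and the defect is all of [m v]. *)
have [d [d0 Hd]] : exists d, 0 < d /\ forall F : seq (edge E), uniq F ->
    {in F, forall e, src e = v} ->
    \sum_(e <- F) N e `^ (- (b + 1)) * m (rng e) <= m v - d.
  have [[e0 [e0v e0m]]|none] := pselect (exists e, src e = v /\ m (rng e) != 0).
    pose t := N e0 `^ (- b) * m (rng e0).
    have t0 : 0 < t by rewrite mulr_gt0 ?powR_gt0 ?N_gt0// lt_def e0m m0.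
    exists (t * (1 - (N e0)^-1)); split.
      by rewrite mulr_gt0// subr_gt0 invf_lt1 ?N_gt0.
    (* [e0] is forced into the sum, whether or not [F] contains it, so that its loss is always
       counted. *)
    move=> F uF Fv; pose F1 := e0 :: [seq e <- F | e != e0].
    have uF1 : uniq F1 by rewrite /= mem_filter eqxx filter_uniq.
    have F1v : {in F1, forall e, src e = v}.
      by move=> e; rewrite inE mem_filter => /orP[/eqP->|/andP[_ /Fv]].
    have sF1 : \sum_(e <- F) N e `^ (- (b + 1)) * m (rng e) <=
        \sum_(e <- F1) N e `^ (- (b + 1)) * m (rng e).
      have [e0F|e0F] := boolP (e0 \in F).
        have -> // : \sum_(e <- F1) N e `^ (- (b + 1)) * m (rng e) =
          \sum_(e <- F) N e `^ (- (b + 1)) * m (rng e).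
        by rewrite /F1 big_cons big_filter -(bigD1_seq e0 e0F uF).
      have /all_filterP FE : all (fun e => e != e0) F.
        by apply/allP => e eF; apply: contraNneq e0F => <-.
      by rewrite /F1 big_cons FE lerDr mulr_ge0 ?powR_ge0.
    apply: (le_trans sF1); have := sub v F1 uF1 F1v.
    rewrite /F1 !big_cons -/t NS -mulrA mulrCA -/t => h.
    have : \sum_(j <- [seq e <- F | e != e0]) N j `^ (- (b + 1)) * m (rng j) <=
       \sum_(j <- [seq e <- F | e != e0]) N j `^ (- b) * m (rng j) by apply: ler_sum => e _.
    by clear -h => h'; lra.
  exists (m v); split=> // F uF Fv; rewrite subrr big_seq big1// => e eF.
  have -> : m (rng e) = 0; last by rewrite mulr0.
  by apply/eqP; apply: contra_notT none => me; exists e; split=> //; exact: Fv.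
(* Induction on the length of the paths with source [w], grouped by their first edge. The path of
   length 0 contributes [d], but it occurs only for [w = v], where the defect leaves exactly that
   room. *)
have main k : forall w (F : seq (seq (edge E))), uniq F ->
    {in F, forall l, [/\ lpath v l, lsrc v l = w & (size l <= k)%N]} ->
    d * \sum_(l <- F) lweight (b + 1) l <= m w.
  elim: k => [|k ih] w F uF HF.
    have [->|] := eqVneq F [::]; first by rewrite big_nil mulr0.
    case: F uF HF => // l F uF HF _.
    have lnil l' : l' \in l :: F -> l' = [::] by move=> /HF[_ _]; case: l'.
    have -> : l :: F = [:: [::]].
      have -> : l = [::] by apply: lnil; rewrite inE eqxx.
      case: F uF HF lnil => // l' F /= uF _ lnil.
      have l'0 : l' = [::] by apply: lnil; rewrite !inE eqxx orbT.
      have l0 : l = [::] by apply: lnil; rewrite !inE eqxx.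
      by move: uF; rewrite l0 l'0 inE eqxx.
    have [_ + _] := HF l (mem_head _ _); rewrite (lnil l (mem_head _ _)) /= => <-.
    rewrite big_seq1 lweight_nil mulr1.
    by have := Hd [::] isT; rewrite big_nil subr_ge0; apply.
  pose H := undup (pmap ohead F).
  have uH : uniq H := undup_uniq _.
  have HP e : e \in H -> src e = w.
    rewrite mem_undup mem_pmap => /mapP[l lF]; have [_ + _] := HF l lF.
    by case: l lF => //= f l _ <- [->].
  have uK : uniq (None :: map Some H).
    rewrite /= map_inj_uniq ?uH ?andbT; last by move=> ? ? [].
    by apply/mapP => -[].
  rewrite (@partition_seq _ _ _ ohead (None :: map Some H)) //; last first.
    move=> [|e l] lF //; rewrite inE /= map_f// mem_undup mem_pmap.
    by apply/mapP; exists (e :: l).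
  rewrite big_cons big_map mulrDr [d * \sum_(e <- H) _]mulr_sumr.
  have tails e : d * \sum_(l <- [seq l <- F | ohead l == Some e]) lweight (b + 1) l
      <= N e `^ (- (b + 1)) * m (rng e).
    set Fe := [seq l <- F | _].
    have Fe_cons l : l \in Fe -> l = e :: behead l.
      by rewrite mem_filter => /andP[]; case: l => //= f l /eqP[->].
    have -> : \sum_(l <- Fe) lweight (b + 1) l =
        N e `^ (- (b + 1)) * \sum_(l <- map behead Fe) lweight (b + 1) l.
      rewrite big_map mulr_sumr; apply: eq_big_seq => l lFe.
      by rewrite {1}(Fe_cons l lFe) lweight_cons.
    rewrite mulrCA ler_wpM2l ?powR_ge0//; apply: ih.
      rewrite map_inj_in_uniq ?filter_uniq// => l1 l2 l1F l2F bh.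
      by rewrite (Fe_cons _ l1F) (Fe_cons _ l2F) bh.
    move=> _ /mapP[l lFe ->]; have := HF l; rewrite (Fe_cons l lFe) /=.
    have -> : e :: behead l \in F by rewrite -Fe_cons//; move: lFe; rewrite mem_filter => /andP[].
    by case=> // /andP[/eqP <- ->] _ ?; split.
  have heads : \sum_(e <- H) d * \sum_(l <- [seq l <- F | ohead l == Some e]) lweight (b + 1) l
      <= \sum_(e <- H) N e `^ (- (b + 1)) * m (rng e) by apply: ler_sum.
  have [nF|nF] := boolP ([::] \in F).
    have [_ /= vw _] := HF _ nF.
    have := Hd H uH; rewrite vw => /(_ HP) hH.
    have -> : [seq l <- F | ohead l == None] = [:: [::]].
      rewrite (@eq_filter _ _ (pred1 [::])); last by case.
      by rewrite filter_pred1_uniq.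
    by rewrite big_seq1 lweight_nil mulr1; clear -hH heads; lra.
  have -> : [seq l <- F | ohead l == None] = [::].
    apply/eqP; rewrite -[_ == _]negbK -has_filter; apply/hasPn => -[|//] /=.
    by rewrite (negbTE nF).
  rewrite big_nil mulr0 add0r; apply: (le_trans heads).
  by apply: le_trans (sub w H uH HP); apply: ler_sum => e _.
exists d^-1 => F uF HF.
rewrite -[leRHS]mul1r ler_pdivlMr// mulrC.
pose Ks := undup (map (lsrc v) F).
rewrite (@partition_seq _ _ _ (lsrc v) Ks) ?undup_uniq//; last first.
  by move=> l lF; rewrite mem_undup map_f.
rewrite mulr_sumr; apply: le_trans (mass Ks (undup_uniq _)).
apply: ler_sum => w _; apply: (main (\max_(l <- F) size l)%N); first by rewrite filter_uniq.
move=> l; rewrite mem_filter => /andP[/eqP lw lF]; split=> //; first exact: HF.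
exact: leq_bigmax_seq.
Qed.

Lemma partition_function_le v b (B : R) :
  (forall F : seq (seq (edge E)), uniq F -> {in F, forall l, lpath v l} ->
    \sum_(l <- F) lweight b l <= B) ->
  (partition_function N v b <= B%:E)%E.
Proof.
move=> HB; apply: ge_ereal_sup => _ /= [D [finD Dv] <-].
rewrite fsbig_finite//= sumEFin lee_fin.
rewrite (_ : \sum_(u <- _) _ =
    \sum_(l <- [seq u.2 | u <- finmap.enum_fset (fset_set D)]) lweight b l).
  apply: HB.
    rewrite map_inj_in_uniq ?finmap.fset_uniq// => -[w l] [w' l'] /=.
    rewrite !in_fset_set// !inE => /Dv/paths_lpath[_ /= ->] /Dv/paths_lpath[_ /= ->].
    by move=> ->.
  by move=> _ /mapP[u + ->]; rewrite in_fset_set// inE => /Dv/paths_lpath[].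
by rewrite big_map.
Qed.

Lemma partition_function_finite v b : (partition_function N v b < +oo)%E ->
  exists B, forall F : seq (seq (edge E)), uniq F -> {in F, forall l, lpath v l} ->
    \sum_(l <- F) lweight b l <= B.
Proof.
move=> fin.
have [B BE] : exists B : R, (partition_function N v b <= B%:E)%E.
  case: (partition_function N v b) fin => // [r _|_]; first by exists r.
  by exists 0; rewrite leNye.
exists B => F uF HF; rewrite -lee_fin; apply: le_trans BE.
pose D := [set u | u \in [seq (lsrc v l, l) | l <- F]].
have uD : uniq [seq (lsrc v l, l) | l <- F] by rewrite map_inj_uniq// => l l' [].
have finD : finite_set D by exact: finite_seq.
apply: ereal_sup_ubound; exists D.
  by split=> // _ /= /mapP[l lF ->]; exact/lpath_paths/HF.
rewrite fsbig_finite//= sumEFin; congr (_%:E).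
rewrite (perm_big [seq (lsrc v l, l) | l <- F]) ?big_map//=.
apply: uniq_perm => [||u]; [exact: finmap.fset_uniq|by []|]; rewrite in_fset_set//.
by apply/idP/idP => [|h]; rewrite inE.
Qed.

End PathWeights.

(** * KMS states and ground states *)

Section Eigenvectors.
Context {R : realType} {A : cstarAlgType R} (sigma : R -> A -> A).
Context (sigma_hom : forall t, star_hom (sigma t)).

Definition eigenvector (L : R) (g : A) :=
  forall t : R, sigma t g = cexp ('i * L%:C * t%:C) *: g.

Lemma cexp_real (L t : R) : cexp ('i * L%:C * t%:C) = cos (t * L) +i* sin (t * L).
Proof.
rewrite /cexp (_ : 'i * L%:C * t%:C = 0 +i* (t * L)) /= ?expR0 ?mul1r//.
by apply/eqP; rewrite eq_complex /=; apply/andP; split; apply/eqP; ring.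
Qed.

Lemma cexp_imaginary (L b : R) : cexp ('i * L%:C * (0 +i* b)) = (expR (- (L * b)))%:C.
Proof.
rewrite /cexp (_ : 'i * L%:C * (0 +i* b) = (- (L * b))%:C) /= ?cos0 ?sin0 ?mulr1//.
by apply/eqP; rewrite eq_complex /=; apply/andP; split; apply/eqP; ring.
Qed.

Lemma eigenvector_star L g : eigenvector L g -> eigenvector (- L) g^#.
Proof.
move=> Hg t; have [_ _ sS] := sigma_hom t; rewrite sS Hg cstarZ !cexp_real.
by rewrite mulrN cosN sinN.
Qed.

Lemma eigenvectorM L M g h : eigenvector L g -> eigenvector M h ->
  eigenvector (L + M) (g ** h).
Proof.
move=> Hg Hh t; have [_ sM _] := sigma_hom t; rewrite sM Hg Hh cmulZl cmulZr scalerA.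
by rewrite rmorphD mulrDr mulrDl cexpD.
Qed.

Lemma eigenvector_extension L g : eigenvector L g ->
  entire_extension sigma g (fun z => cexp ('i * L%:C * z) *: g).
Proof.
move=> Hg; split=> [z|t]; last by rewrite Hg.
by apply: (@derivable_scale_cexp R A (fun=> g)); exact: derivable_cst.
Qed.

Lemma eigenvector_analytic L g : eigenvector L g -> analytic sigma g.
Proof. by move=> /eigenvector_extension h; eexists; exact: h. Qed.

(** The extension of an eigenvector is a scalar function times a fixed element, so differentiability
    of the product reduces to right multiplication by [g], which is bounded and linear, and to a
    scalar factor. *)
Lemma entire_extensionM L g a f : eigenvector L g -> entire_extension sigma a f ->
  entire_extension sigma (a ** g) (fun z => cexp ('i * L%:C * z) *: (f z ** g)).
Proof.
move=> Hg [df fa]; split=> [z|t]; last first.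
  by have [_ sM _] := sigma_hom t; rewrite sM Hg fa cmulZr.
apply: (@derivable_scale_cexp R A (fun z => f z ** g)).
apply: (@derivable_linear R A A f z (cmul^~ g) (nrm g)); first exact: nrm_ge0.
- by move=> k x y; rewrite cmulDl cmulZl.
- by move=> x; rewrite mulrC; exact: nrm_cmul.
- exact: df.
Qed.

Lemma analyticM L g a : eigenvector L g -> analytic sigma a -> analytic sigma (a ** g).
Proof. by move=> Hg [f fa]; eexists; exact: entire_extensionM Hg fa. Qed.

Lemma kms_eigenvector (b L : R) (phi : A -> R[i]) g x : kms_state sigma b phi -> 0 < b ->
  eigenvector L g -> analytic sigma x ->
  phi (g ** x) = (expR (- (L * b)))%:C * phi (x ** g).
Proof.
move=> [[lin _ _] _ _ kms] b0 Hg Hx.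
rewrite (kms b0 g x _ (eigenvector_extension Hg) Hx) /= cexp_imaginary.
by rewrite cmulZr (functionalZ lin).
Qed.

End Eigenvectors.

Section GraphDynamics.
Context {R : realType} {E : digraph} {V : set (vertex E)} {A : cstarAlgType R}.
Context {s : edge E -> A} {p : vertex E -> A} (fam : graph_family V s p).
Context (N : edge E -> R) (N_gt1 : forall e, 1 < N e).
Context (sigma : R -> A -> A) (sigma_hom : forall t, star_hom (sigma t)).
Context (sigma_s : forall t e, sigma t (s e) = powRi (N e) t *: s e).
Context (sigma_p : forall t v, sigma t (p v) = p v).

Lemma eigenvector_edge e : eigenvector sigma (ln (N e)) (s e).
Proof. by move=> t; rewrite sigma_s cexp_real. Qed.

Lemma eigenvector_edge_star e : eigenvector sigma (- ln (N e)) (s e)^#.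
Proof. exact/eigenvector_star/eigenvector_edge. Qed.

Lemma eigenvector_vproj v : eigenvector sigma 0 (p v).
Proof. by move=> t; rewrite sigma_p cexp_real mulr0 cos0 sin0 scale1r. Qed.

Lemma expR_ln_N b e : expR (- (ln (N e) * b)) = N e `^ (- b).
Proof.
rewrite /powR gt_eqF; first by rewrite mulNr mulrC.
exact: lt_trans (N_gt1 e).
Qed.

Lemma state_pos (phi : A -> R[i]) : state phi -> forall a, 0 <= phi (a^# ** a).
Proof. by move=> [_ pos _] a; apply: pos; exists a. Qed.

Lemma vproj_pos (phi : A -> R[i]) v : state phi -> phi (p v) = (complex.Re (phi (p v)))%:C.
Proof.
move=> /state_pos /(_ (p v)); rewrite (vproj_star fam) (vproj_mul fam) eqxx => h.
by rewrite RRe_real// ger0_real.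
Qed.

Lemma vproj_ge0 (phi : A -> R[i]) v : state phi -> 0 <= complex.Re (phi (p v)).
Proof.
move=> st; rewrite -ler0c -vproj_pos//.
by have := state_pos st (p v); rewrite (vproj_star fam) (vproj_mul fam) eqxx.
Qed.

Lemma state_mass (phi : A -> R[i]) (F : seq (vertex E)) : state phi -> uniq F ->
  \sum_(v <- F) complex.Re (phi (p v)) <= 1.
Proof.
move=> st uF; have [lin _ _] := st.
have := state_bounded st (\sum_(v <- F) p v).
rewrite (functional_sum lin) (eq_bigr _ (fun v _ => vproj_pos v st)) -rmorph_sum nrm_real.
move=> /(le_trans (ler_norm _))/le_trans; apply.
exact: nrm_projection (vproj_sum_projection fam uF).
Qed.

(** The KMS condition gives [phi(s_e s_e^#) = N(e)^-b phi(p_{r(e)})]. The sum [Q] of the [s_e s_e^#]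
    is a projection, and [phi] takes the same value [q] at [Q], [p_w Q] and [Q p_w]; so positivity
    at [(p_w - Q)^2] reads [phi(p_w) - q >= 0], without [Q <= p_w] being known in [A]. *)
Lemma kms_subinvariant (b : R) (phi : A -> R[i]) w (F : seq (edge E)) :
  kms_state sigma b phi -> 0 < b -> uniq F -> {in F, forall e, src e = w} ->
  \sum_(e <- F) N e `^ (- b) * complex.Re (phi (p (rng e))) <= complex.Re (phi (p w)).
Proof.
move=> kms b0 uF Fw; have [st _ _ _] := kms; have [lin _ _] := st.
have pos := state_pos st.
have an_ss e : analytic sigma (s e)^# := eigenvector_analytic (eigenvector_edge_star e).
have an_ssp e : analytic sigma ((s e)^# ** p w).
  by apply: (analyticM sigma_hom (eigenvector_vproj w)).
have loc e : e \in F -> phi ((s e)^# ** p w ** s e) = phi (p (rng e)).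
  move=> /Fw ew; have := @edge_src_null _ _ _ _ _ _ fam phi e w (p (rng e)) (s e)^# lin pos.
  by rewrite -!cmulA !(edge_rng fam) !cmulA ew eqxx (edge_starM fam).
have eig_ps e : eigenvector sigma (0 + ln (N e)) (p w ** s e).
  exact/(eigenvectorM sigma_hom)/eigenvector_edge/eigenvector_vproj.
have ssp e : e \in F -> phi (s e ** (s e)^# ** p w) = (N e `^ (- b))%:C * phi (p (rng e)).
  move=> eF; rewrite -cmulA (kms_eigenvector kms b0 (eigenvector_edge e) (an_ssp e)).
  by rewrite expR_ln_N loc.
have pss e : e \in F -> phi (p w ** (s e ** (s e)^#)) = (N e `^ (- b))%:C * phi (p (rng e)).
  move=> eF; rewrite cmulA (kms_eigenvector kms b0 (eig_ps e) (an_ss e)).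
  by rewrite add0r expR_ln_N cmulA loc.
have ss e : phi (s e ** (s e)^#) = (N e `^ (- b))%:C * phi (p (rng e)).
  by rewrite (kms_eigenvector kms b0 (eigenvector_edge e) (an_ss e)) expR_ln_N (edge_starM fam).
pose Q := \sum_(e <- F) s e ** (s e)^#.
pose q := \sum_(e <- F) N e `^ (- b) * complex.Re (phi (p (rng e))).
have qE : \sum_(e <- F) (N e `^ (- b))%:C * phi (p (rng e)) = q%:C.
  by rewrite /q rmorph_sum; apply: eq_bigr => e _; rewrite rmorphM /= -vproj_pos.
have Qs : Q^# = Q.
  by rewrite /Q cstar_sum; apply: eq_bigr => e _; rewrite cstarM cstarK.
have QQ : Q ** Q = Q.
  rewrite /Q cmul_suml; apply: eq_big_seq => e eF; rewrite cmul_sumr (bigD1_seq e)//=.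
  rewrite big1 => [|f fe].
    by rewrite addr0 !cmulA -(cmulA (s e)) (edge_starM fam) (edge_rng fam).
  by rewrite !cmulA -(cmulA (s e)) (edge_orth fam) ?cmul0r ?cmul0l// => ef; rewrite ef eqxx in fe.
have pQ : phi (p w ** Q) = q%:C.
  by rewrite cmul_sumr (functional_sum lin) -qE; apply: eq_big_seq => e /pss.
have Qp : phi (Q ** p w) = q%:C.
  by rewrite cmul_suml (functional_sum lin) -qE; apply: eq_big_seq => e /ssp.
have phiQ : phi Q = q%:C by rewrite (functional_sum lin) -qE; apply: eq_bigr => e _.
have := pos (p w - Q); rewrite cstarB (vproj_star fam) Qs cmulBl !cmulBr.
rewrite QQ (vproj_mul fam) eqxx !(functionalB lin) pQ Qp phiQ subrr subr0.
by rewrite vproj_pos// -rmorphB ler0c subr_ge0.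
Qed.

Lemma kms_critical_beta (b : R) (phi : A -> R[i]) v : kms_state sigma b phi -> 0 < b ->
  phi (p v) <> 0 -> (critical_beta N v < +oo)%E.
Proof.
move=> kms b0 pv; have [st _ _ _] := kms.
have [||||B HB] := @subinvariant_bound R E N N_gt1 (fun w => complex.Re (phi (p w))) b v.
- by move=> w; exact: vproj_ge0.
- by move=> w F; exact: kms_subinvariant.
- by move=> F; exact: state_mass.
- rewrite lt_def vproj_ge0// andbT; apply/eqP => h; apply: pv.
  by rewrite vproj_pos// h.
apply: (@le_lt_trans _ _ (b + 1)%:E); last exact: ltry.
apply: ereal_inf_lbound; exists (b + 1) => //; split; first by rewrite addr_ge0// ltW.
by apply: le_lt_trans (partition_function_le HB) _; exact: ltry.
Qed.

End GraphDynamics.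

(** * Ground states and their compressions by paths *)

Section GroundStates.
Context {R : realType} {E : digraph} {V : set (vertex E)} {A : cstarAlgType R}.
Context {s : edge E -> A} {p : vertex E -> A} (fam : graph_family V s p).
Context (gen : forall D : set A, closed_star_subalgebra D ->
  (forall e, D (s e)) -> (forall v, D (p v)) -> D = setT).
Context (N : edge E -> R) (N_gt1 : forall e, 1 < N e).
Context (sigma : R -> A -> A) (sigma_hom : forall t, star_hom (sigma t)).
Context (sigma_s : forall t e, sigma t (s e) = powRi (N e) t *: s e).
Context (sigma_p : forall t v, sigma t (p v) = p v).
Context (psi : A -> R[i]) (psi_ground : ground_state sigma psi).

Let psi_lin : scalar psi. Proof. by case: psi_ground => -[]. Qed.
Let psi_state : state psi. Proof. by case: psi_ground. Qed.
Let psi_pos : forall a, 0 <= psi (a^# ** a). Proof. exact: state_pos. Qed.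

Lemma ground_negative_analytic (L : R) a b : 0 < L -> eigenvector sigma (- L) b ->
  analytic sigma a -> psi (a ** b) = 0.
Proof.
move=> L0 Hb Ha; have [_ bnd] := psi_ground.
have [M HM] := bnd a b _ Ha (eigenvector_extension Hb).
apply: nrm_eq0; apply/eqP; rewrite eq_le nrm_ge0 andbT leNgt; apply/negP => n0.
(* Chosen so that [L y n = 1 + |M|]; then [exp(L y) n >= (1 + L y) n] exceeds [M]. *)
set n := nrm _ in n0; pose y := (1 + `|M|) / n / L.
have y0 : 0 < y by rewrite !divr_gt0// ltr_pwDl.
have := HM (0 +i* y) y0.
rewrite cexp_imaginary cmulZr (functionalZ psi_lin) nrmE lecR nrmM nrm_real.
rewrite ger0_norm ?expR_ge0// -/n mulNr opprK => h.
have h1 : 1 + L * y <= expR (L * y) := expR_ge1Dx _.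
have h2 : (1 + L * y) * n <= M by apply: le_trans h; rewrite ler_wpM2r// ltW.
have h3 : L * y * n = 1 + `|M| by rewrite /y; field; rewrite !gt_eqF.
have := ler_norm M; move: h2; rewrite mulrDl h3 mul1r; lra.
Qed.

Lemma generator_eigenvectors : [/\ forall e, exists L, eigenvector sigma L (s e),
  forall e, exists L, eigenvector sigma L (s e)^# &
  forall v, exists L, eigenvector sigma L (p v)].
Proof.
split=> [e|e|v]; eexists; first exact: eigenvector_edge.
  exact: eigenvector_edge_star.
exact: eigenvector_vproj.
Qed.

(** The ground state condition speaks of analytic [x] only; [gen_induction] removes this
    restriction. The second clause of [K] keeps an analytic factor on the left, which is what makes
    [K] stable under left multiplication by eigenvectors. *)
Lemma ground_negative (L : R) x b : 0 < L -> eigenvector sigma (- L) b ->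
  psi (x ** b) = 0.
Proof.
move=> L0 Hb; have Hab a : analytic sigma a -> psi (a ** b) = 0.
  exact: ground_negative_analytic L0 Hb.
pose K := [set x | psi (x ** b) = 0 /\ forall y, analytic sigma y -> psi (y ** x ** b) = 0].
suff : K x by case.
have [eig_s eig_ss eig_p] := generator_eigenvectors.
have Kgen g : (exists M, eigenvector sigma M g) -> K g.
  move=> [M Hg]; split; first exact/Hab/(eigenvector_analytic Hg).
  by move=> y /(analyticM sigma_hom Hg)/Hab.
have Kmul g z : (exists M, eigenvector sigma M g) -> K z -> K (g ** z).
  move=> [M Hg] [z0 Kz]; split; first exact/Kz/(eigenvector_analytic Hg).
  by move=> y /(analyticM sigma_hom Hg)/Kz; rewrite !cmulA.
have zero_lim (c : A) : (forall e : R, 0 < e -> exists d, nrm (c - d) < e /\ psi (d ** b) = 0) ->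
    psi (c ** b) = 0.
  move=> H; apply: nrm_eq0; apply/eqP; rewrite eq_le nrm_ge0 andbT.
  apply/ler_addgt0Pr => e e0; rewrite add0r.
  have b1 : 0 < 1 + nrm b by rewrite ltr_pwDl ?nrm_ge0.
  have [d [cd d0]] := H _ (divr_gt0 e0 b1).
  rewrite -[psi _]subr0 -d0 -(functionalB psi_lin) -cmulBl.
  apply: (le_trans (state_bounded psi_state _)); apply: (le_trans (nrm_cmul _ _)).
  rewrite ltr_pdivlMr// in cd; have := nrm_ge0 (c - d); lra.
apply: (gen_induction fam gen).
- apply: closed_nrmP => z Kz; split.
    by apply: zero_lim => e e0; have [d [d0 _] zd] := Kz e e0; exists d.
  move=> y Hy; apply: zero_lim => e e0.
  have y1 : 0 < 1 + nrm y by rewrite ltr_pwDl ?nrm_ge0.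
  have [d [_ d0] zd] := Kz _ (divr_gt0 e0 y1); exists (y ** d); split; last exact: d0.
  rewrite -cmulBr; apply: le_lt_trans (nrm_cmul _ _) _.
  rewrite ltr_pdivlMr// in zd; have := nrm_ge0 (z - d); lra.
- by split=> [|y _]; rewrite ?cmul0r cmul0l (functional0 psi_lin).
- move=> k y z [y0 Ky] [z0 Kz]; split=> [|w Hw].
    by rewrite cmulDl cmulZl psi_lin y0 z0 mulr0 addr0.
  by rewrite cmulDr cmulZr cmulDl cmulZl psi_lin Ky// Kz// mulr0 addr0.
- by move=> e z; apply: Kmul.
- by move=> e z; apply: Kmul.
- by move=> v z; apply: Kmul.
- by move=> e; apply: Kgen.
- by move=> v; apply: Kgen.
Qed.

Lemma lnN_gt0 e : 0 < ln (N e). Proof. by rewrite ln_gt0. Qed.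

Lemma ground_edge_star x e : psi (x ** (s e)^#) = 0.
Proof. by apply: (ground_negative x (lnN_gt0 e)); exact: eigenvector_edge_star. Qed.

Lemma ground_edge_star_vproj x e w : psi (x ** (s e)^# ** p w) = 0.
Proof.
rewrite -cmulA; apply: (ground_negative x (lnN_gt0 e)).
rewrite -[- _]addr0; apply: (eigenvectorM sigma_hom).
  exact: eigenvector_edge_star.
exact: eigenvector_vproj.
Qed.

Lemma ground_edge x e : psi (s e ** x) = 0.
Proof.
by rewrite -[s e]cstarK (positive_hermitian psi_lin psi_pos) ground_edge_star conjc0.
Qed.

Lemma ground_vproj_edge x e w : psi (p w ** s e ** x) = 0.
Proof.
rewrite -[p w ** s e]cstarK (positive_hermitian psi_lin psi_pos).
by rewrite cstarM (vproj_star fam) cmulA ground_edge_star_vproj conjc0.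
Qed.

(** [vanishing_functionals] for the constant sequence [psi o sigma_t - psi]; contractivity of
    [sigma t] supplies the uniform bound 2. *)
Lemma ground_invariant t a : psi (sigma t a) = psi a.
Proof.
have [slin sM sS] := sigma_hom t.
pose theta (n : nat) x := psi (sigma t x) - psi x.
suff : tends0 (fun n => theta n a).
  move=> h; apply/eqP; rewrite -subr_eq0; apply/eqP/nrm_eq0/eqP.
  rewrite eq_le nrm_ge0 andbT; apply/ler_addgt0Pr => e e0; rewrite add0r.
  by have [n /(_ n (leqnn n))] := h e e0.
have zero x : theta 0%N x = 0 -> tends0 (fun n => theta n x).
  by move=> h; rewrite (_ : (fun n => _) = fun=> 0); [exact: tends0_cst0|exact/funext].
have sE e : sigma t (s e) = powRi (N e) t *: s e by exact: sigma_s.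
have ssE e : sigma t (s e)^# = (powRi (N e) t)^* *: (s e)^# by rewrite sS sE cstarZ.
apply: (vanishing_functionals fam gen (C := 2)) => //.
- move=> n k x y; rewrite /theta slin !psi_lin.
  by rewrite opprD addrACA mulrBr.
- move=> n x; apply: (le_trans (nrmB _ _)).
  have h1 := state_bounded psi_state x; have h2 := state_bounded psi_state (sigma t x).
  have h3 := star_hom_contractive (sigma_hom t) x; lra.
- move=> n e w x y; rewrite /theta !sM sE sigma_p !cmulZr !cmulZl !(functionalZ psi_lin).
  rewrite !(edge_src_null fam _ _ _ _ psi_lin psi_pos).
  by case: ifP; rewrite // mulr0 subrr.
- move=> e x; apply: zero; rewrite /theta sM sE cmulZl (functionalZ psi_lin).
  by rewrite !ground_edge mulr0 subrr.
- move=> e w x; apply: zero; rewrite /theta !sM sE sigma_p cmulZr cmulZl (functionalZ psi_lin).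
  by rewrite !ground_vproj_edge mulr0 subrr.
- move=> e x; apply: zero; rewrite /theta sM ssE cmulZr (functionalZ psi_lin).
  by rewrite !ground_edge_star mulr0 subrr.
- move=> e w x; apply: zero; rewrite /theta !sM ssE sigma_p cmulZr cmulZl (functionalZ psi_lin).
  by rewrite !ground_edge_star_vproj mulr0 subrr.
- by move=> v; apply: zero; rewrite /theta sigma_p subrr.
Qed.

(** The element [s_u] for the path with edges [l] and range [v]; the last factor makes it [p v] at
    length 0. Lists that are not paths are allowed here and get coefficient 0 in [path_coef]. *)
Definition path_op v l : A := foldr (fun e x => s e ** x) (p v) l.

Lemma path_op_vproj v l : path_op v l ** p v = path_op v l.
Proof.
elim: l => [|e l ih] /=; first by rewrite (vproj_mul fam) eqxx.
by rewrite -cmulA ih.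
Qed.

Lemma nrm_path_op v l : nrm (path_op v l) <= 1.
Proof.
elim: l => [|e l ih] /=; first exact: nrm_vproj fam v.
apply: (le_trans (nrm_cmul _ _)); rewrite -[leRHS]mul1r.
by rewrite ler_pM ?nrm_ge0// (nrm_edge fam).
Qed.

Lemma eigenvector_path_op v l : exists L, eigenvector sigma L (path_op v l).
Proof.
elim: l => [|e l [L ih]] /=; first by exists 0; exact: eigenvector_vproj.
exists (ln (N e) + L); apply: (eigenvectorM sigma_hom) => //.
exact: eigenvector_edge.
Qed.

Lemma path_op_src_star v l w x : psi ((path_op v l)^# ** p w ** x) =
  if w == lsrc v l then psi ((path_op v l)^# ** x) else 0.
Proof.
case: l => [|e l] /=.
  rewrite (vproj_star fam) (vproj_mul fam) eq_sym; case: eqP => // _.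
  by rewrite cmul0l (functional0 psi_lin).
by rewrite cstarM (edge_src_null_star fam _ _ _ _ psi_lin psi_pos).
Qed.

Lemma path_op_src v l w x : psi (x ** p w ** path_op v l) =
  if w == lsrc v l then psi (x ** path_op v l) else 0.
Proof.
case: l => [|e l] /=.
  rewrite -cmulA (vproj_mul fam); case: eqP => [->//|_].
  by rewrite cmul0r (functional0 psi_lin).
by rewrite !cmulA (edge_src_null fam _ _ _ _ psi_lin psi_pos).
Qed.

Definition path_functional v l a : R[i] := psi ((path_op v l)^# ** a ** path_op v l).

Lemma path_functional_linear v l : scalar (path_functional v l).
Proof. by move=> k x y; rewrite /path_functional cmulDr cmulZr cmulDl cmulZl psi_lin. Qed.

Lemma path_functional_pos v l a : 0 <= path_functional v l (a^# ** a).
Proof. by have := psi_pos (a ** path_op v l); rewrite /path_functional cstarM !cmulA. Qed.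

(** [path_op] absorbs [p v] on the right, so [positive_compress] gives the factor [psi(p_v)] in
    place of 1. This makes the bound of [path_sum] by [path_mass] sharp. *)
Lemma path_functional_bound v l a :
  nrm (path_functional v l a) <= complex.Re (psi (p v)) * nrm a.
Proof.
have Sp : p v ** (path_op v l)^# = (path_op v l)^#.
  by rewrite -[RHS](congr1 cstar (path_op_vproj v l)) cstarM (vproj_star fam).
have -> : path_functional v l a = psi (p v ** ((path_op v l)^# ** a ** path_op v l) ** p v).
  by rewrite !cmulA Sp -(cmulA _ (path_op v l)) path_op_vproj.
apply: (le_trans (positive_compress psi_lin psi_pos _ (vproj fam v))).
rewrite ler_wpM2l ?(vproj_ge0 fam)//.
apply: (le_trans (nrm_cmul _ _)); rewrite -[leRHS]mulr1 ler_pM ?nrm_ge0 ?nrm_path_op//.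
apply: (le_trans (nrm_cmul _ _)); rewrite nrm_star -[leRHS]mul1r.
by rewrite ler_wpM2r ?nrm_ge0 ?nrm_path_op.
Qed.

Lemma path_functional_vprojl v l w a : path_functional v l (p w ** a) =
  if w == lsrc v l then path_functional v l a else 0.
Proof. by rewrite /path_functional !cmulA -(cmulA (_ ** _)) path_op_src_star cmulA. Qed.

Lemma path_functional_vprojr v l w a : path_functional v l (a ** p w) =
  if w == lsrc v l then path_functional v l a else 0.
Proof. by rewrite /path_functional !cmulA path_op_src. Qed.

Lemma path_functional_vproj v l w : lpath v l ->
  path_functional v l (p w) = if w == lsrc v l then psi (p v) else 0.
Proof.
move=> vl; rewrite /path_functional path_op_src_star; case: eqP => // _.
elim: l vl => [|e l ih] /=; first by rewrite (vproj_star fam) (vproj_mul fam) eqxx.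
move=> /andP[/eqP er vl]; rewrite cstarM -cmulA (cmulA (s e)^#) (edge_starM fam) cmulA.
by rewrite path_op_src_star er eqxx ih.
Qed.

(** [path_op] and its adjoint acquire opposite phases, which cancel; the rest is invariance of
    [psi]. *)
Lemma path_functional_invariant v l t a :
  path_functional v l (sigma t a) = path_functional v l a.
Proof.
have [slin sM sS] := sigma_hom t; have [L HL] := eigenvector_path_op v l.
rewrite /path_functional -[RHS](ground_invariant t) !sM sS HL cstarZ !cmulZl cmulZr scalerA.
rewrite (_ : _ * _ = 1) ?scale1r// mulrC cexp_real.
by apply/eqP; rewrite eq_complex /= mulrN opprK -!expr2 cos2Dsin2 mulrN mulrC addNr !eqxx.
Qed.

End GroundStates.

(** * The functionals obtained by summing over paths *)

Section PathSums.
Context {R : realType} {E : digraph} {V : set (vertex E)} {A : cstarAlgType R}.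
Context {s : edge E -> A} {p : vertex E -> A} (fam : graph_family V s p).
Context (gen : forall D : set A, closed_star_subalgebra D ->
  (forall e, D (s e)) -> (forall v, D (p v)) -> D = setT).
Context (N : edge E -> R) (N_gt1 : forall e, 1 < N e).
Context (sigma : R -> A -> A) (sigma_hom : forall t, star_hom (sigma t)).
Context (sigma_s : forall t e, sigma t (s e) = powRi (N e) t *: s e).
Context (sigma_p : forall t v, sigma t (p v) = p v).
Context (psi : A -> R[i]) (psi_ground : ground_state sigma psi).
Context (b : R) (F : seq (vertex E)) (uF : uniq F).
Context (summ : forall v, v \in F -> exists B, forall L : seq (seq (edge E)), uniq L ->
  {in L, forall l, lpath v l} -> \sum_(l <- L) lweight N b l <= B).

Local Notation path := (vertex E * seq (edge E))%type.

Let psi_state : state psi. Proof. by case: psi_ground. Qed.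
Let T (i : path) a := @path_functional R E A s p psi i.1 i.2 a.
Let c v : R := complex.Re (psi (p v)).

Let c_ge0 v : 0 <= c v. Proof. exact: (vproj_ge0 fam). Qed.

Definition path_coef (i : path) : R :=
  if (i.1 \in F) && lpath i.1 i.2 then lweight N b i.2 else 0.

Lemma path_coef_ge0 i : 0 <= path_coef i.
Proof. by rewrite /path_coef; case: ifP => // _; rewrite ltW// lweight_gt0. Qed.

(** The predicate [Q] lets one estimate serve both the whole sum and the tail over paths of positive
    length. *)
Lemma path_coef_le (Q : pred (seq (edge E))) (B : vertex E -> R) :
  (forall v, v \in F -> forall L : seq (seq (edge E)), uniq L ->
    {in L, forall l, lpath v l && Q l} -> \sum_(l <- L) lweight N b l <= B v) ->
  forall G : seq path, uniq G -> {in G, forall i, i.1 \in F -> Q i.2} ->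
  \sum_(i <- G) path_coef i * c i.1 <= \sum_(v <- F) c v * B v.
Proof.
move=> HB G uG GQ.
rewrite (bigID (fun i : path => (i.1 \in F) && lpath i.1 i.2)) /=.
rewrite [X in _ + X]big1 ?addr0; last by move=> i /negbTE h; rewrite /path_coef h mul0r.
rewrite -big_filter; set G' := [seq i <- G | _].
have G'P i : i \in G' -> [/\ i \in G, i.1 \in F & lpath i.1 i.2].
  by rewrite mem_filter => /andP[/andP[? ?] ?].
rewrite (@partition_seq _ _ _ fst F) //; last by move=> i /G'P[].
rewrite big_seq [leRHS]big_seq; apply: ler_sum => v vF.
set Gv := [seq i <- G' | _].
have GvP i : i \in Gv -> i.1 = v /\ i \in G' by rewrite mem_filter => /andP[/eqP].
have -> : \sum_(i <- Gv) path_coef i * c i.1 = c v * \sum_(l <- map snd Gv) lweight N b l.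
  rewrite big_map mulr_sumr; apply: eq_big_seq => i /GvP[<- /G'P[_ iF il]].
  by rewrite /path_coef iF il mulrC.
rewrite ler_wpM2l//; apply: HB => //.
  rewrite map_inj_in_uniq ?filter_uniq// => -[v1 l1] [v2 l2] /GvP[/= -> _] /GvP[/= -> _].
  by move=> /= ->.
move=> _ /mapP[i iGv ->]; have [<- /G'P[iG iF il]] := GvP i iGv.
by rewrite il GQ.
Qed.

Lemma path_coef_bounded : exists B, forall G : seq path, uniq G ->
  \sum_(i <- G) path_coef i * c i.1 <= B.
Proof.
have /choice[B HB] : forall v, exists B, v \in F -> forall L : seq (seq (edge E)), uniq L ->
    {in L, forall l, lpath v l} -> \sum_(l <- L) lweight N b l <= B.
  move=> v; have [/summ[B HB]|_] := boolP (v \in F); first by exists B.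
  by exists 0.
exists (\sum_(v <- F) c v * B v) => G uG; apply: (@path_coef_le predT) => //.
by move=> v vF L uL HL; apply: HB => // l /HL /andP[].
Qed.

(** The sum over [v] in [F] of [psi(p_v) Z_v(b)], shown below to be the norm of [path_sum]. The
    default value 0 of [xget] is excluded by [path_massP]. *)
Definition path_mass : R :=
  complex.Re (xget 0 [set t | has_sum (fun i => (path_coef i * c i.1)%:C) t]).

Definition path_sum a : R[i] :=
  xget 0 [set t | has_sum (fun i => (path_coef i)%:C * T i a) t].

Lemma path_massP : has_sum (fun i => (path_coef i * c i.1)%:C) path_mass%:C.
Proof.
have [B HB] := path_coef_bounded.
have y0 i : 0 <= path_coef i * c i.1 by rewrite mulr_ge0 ?path_coef_ge0.
have [t Ht] := has_sum_nonneg y0 HB.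
rewrite /path_mass; set u := xget _ _.
have Hu : has_sum (fun i => (path_coef i * c i.1)%:C) u by apply: xgetPex; exists t.
by rewrite RRe_real// ger0_real//; apply: has_sum_ge0 Hu => i; rewrite ler0c.
Qed.

Lemma path_mass_le (G : seq path) : uniq G -> \sum_(i <- G) path_coef i * c i.1 <= path_mass.
Proof.
move=> uG; have := has_sum_partial _ path_massP uG; apply => i.
by rewrite mulr_ge0 ?path_coef_ge0.
Qed.

Lemma path_term_bound (G : seq path) a :
  \sum_(i <- G) nrm ((path_coef i)%:C * T i a) <= (\sum_(i <- G) path_coef i * c i.1) * nrm a.
Proof.
rewrite mulr_suml; apply: ler_sum => i _.
rewrite nrmM nrm_real ger0_norm ?path_coef_ge0// -mulrA ler_wpM2l ?path_coef_ge0//.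
exact: (path_functional_bound fam psi_ground).
Qed.

Lemma path_sumP a : has_sum (fun i => (path_coef i)%:C * T i a) (path_sum a).
Proof.
apply: xgetPex; apply: (@has_sum_exists _ _ _ (path_mass * nrm a)) => G uG.
by apply: (le_trans (path_term_bound G a)); rewrite ler_wpM2r ?nrm_ge0// path_mass_le.
Qed.

Lemma path_sum_linear : scalar path_sum.
Proof.
move=> k x y; apply: has_sum_unique (path_sumP _) _.
have := has_sum_linear k (path_sumP x) (path_sumP y).
apply: has_sum_eq => i; rewrite /T (path_functional_linear psi_ground) mulrDr.
by rewrite mulrCA.
Qed.

Lemma path_sum_pos a : 0 <= path_sum (a^# ** a).
Proof.
apply: has_sum_ge0 (path_sumP _) => i.
by rewrite mulr_ge0 ?ler0c ?path_coef_ge0// (path_functional_pos psi_ground).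
Qed.

Lemma path_sum_bound a : nrm (path_sum a) <= path_mass * nrm a.
Proof.
apply: has_sum_bound (path_sumP a) _ => G uG.
by apply: (le_trans (path_term_bound G a)); rewrite ler_wpM2r ?nrm_ge0// path_mass_le.
Qed.

Lemma path_sum_invariant t a : path_sum (sigma t a) = path_sum a.
Proof.
apply: has_sum_unique (path_sumP _) _; apply: has_sum_eq (path_sumP a) => i.
by rewrite /T (path_functional_invariant fam gen N_gt1 sigma_hom sigma_s sigma_p psi_ground).
Qed.

Lemma path_sum_vproj w a : path_sum (p w ** a) = path_sum (a ** p w).
Proof.
apply: has_sum_unique (path_sumP _) _; apply: has_sum_eq (path_sumP (a ** p w)) => i.
by rewrite /T (path_functional_vprojl fam psi_ground) (path_functional_vprojr fam psi_ground).
Qed.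

(* Only the paths [e :: l] contribute to the left-hand side, and the term of
   [e :: l] there is the term of [l] on the right-hand side. *)
Lemma path_sum_edge e a : path_sum (s e ** a) = (N e `^ (- b))%:C * path_sum (a ** s e).
Proof.
apply: has_sum_unique (path_sumP _) _.
pose h (i : path) : path := (i.1, e :: i.2).
pose g (i : path) : option path :=
  if i.2 is f :: l then if f == e then Some (i.1, l) else None else None.
(* When [e :: l] is not a path its coefficient is 0 while that of [l] may not be; the term of [l] on
   the right-hand side must then vanish by itself. *)
have src0 v l x : rng e != lsrc v l -> psi (x ** s e ** @path_op R E A s p v l) = 0.
  move=> el; rewrite -(edge_rng fam) cmulA (path_op_src fam psi_ground).
  by rewrite (negbTE el).
apply: (@has_sum_reindex _ _ h g).
- by move=> [v l]; rewrite /g /h /= eqxx.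
- by move=> [v [|f l]]; rewrite /g /h //=; case: eqP => //= ->.
- move=> [v [|f l]] /=.
    (* The path of length 0 contributes nothing on the left because a ground state kills
       [p_v s_e A]. *)
    move=> _; rewrite /T /path_functional /= (vproj_star fam) cmulA -(cmulA _ a).
    by rewrite (ground_vproj_edge fam gen N_gt1 sigma_hom sigma_s sigma_p psi_ground) mulr0.
  rewrite /g /=; case: eqP => // fe _.
  rewrite /T /path_functional /= cstarM !cmulA -(cmulA _ (s f)^#) (edge_orth fam fe).
  rewrite cmul0r !cmul0l functional0 ?mulr0//.
  by case: psi_state.
- apply: has_sum_eq (has_sumZ _ (path_sumP _)) => -[v l].
  rewrite /T /path_functional /h /= cstarM !cmulA -(cmulA _ (s e)^#) (edge_starM fam).
  rewrite -!cmulA (cmulA _ (p (rng e))) (path_op_src_star fam psi_ground) !cmulA.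
  rewrite /path_coef /= lweight_cons//.
  have [el|el] := eqVneq (rng e) (lsrc v l).
    by rewrite /=; case: ifP => _; rewrite ?mulr0 ?mul0r ?mulr0// rmorphM mulrA.
  by rewrite andbF !mul0r src0// !mulr0.
Qed.

(** The sum [P] of the vertex projections at the sources of finitely many paths replaces the unit:
    each of these paths contributes its full mass at [P], and the remaining terms are
    nonnegative. *)
Lemma path_sum_mass e : 0 < e -> exists2 a, nrm a <= 1 & path_mass - e <= nrm (path_sum a).
Proof.
move=> e0; have [G0 HG0] := path_massP e0; pose G := undup G0.
have hG : path_mass - e <= \sum_(i <- G) path_coef i * c i.1.
  have := HG0 G (undup_uniq _) ltac:(by move=> i; rewrite mem_undup).
  by rewrite -rmorph_sum -rmorphB nrm_real ler_norml => /andP[_]; lra.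
pose W := undup [seq lsrc i.1 i.2 | i <- G]; pose P := \sum_(w <- W) p w.
have uW : uniq W := undup_uniq _.
exists P; first exact: nrm_projection (vproj_sum_projection fam uW).
have TP i : (path_coef i)%:C * T i P =
    (path_coef i * (if lsrc i.1 i.2 \in W then c i.1 else 0))%:C.
  rewrite rmorphM /=; case: (boolP (lpath i.1 i.2)) => il; last first.
    by rewrite /path_coef (negbTE il) andbF !mul0r.
  congr (_ * _); rewrite /T (functional_sum (path_functional_linear psi_ground _ _)).
  under eq_bigr do rewrite (path_functional_vproj fam psi_ground)//.
  case: ifP => iW.
    rewrite (bigD1_seq _ iW uW) /= eqxx big1 ?addr0 => [|w /negbTE -> //].
    exact: (vproj_pos fam).
  by rewrite big_seq big1// => w wW; case: eqP => // wE; rewrite -wE wW in iW.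
have yP := has_sum_eq TP (path_sumP P).
have y0 i : 0 <= path_coef i * (if lsrc i.1 i.2 \in W then c i.1 else 0).
  by rewrite mulr_ge0 ?path_coef_ge0//; case: ifP.
apply: (le_trans hG); apply: le_trans (normRe_le _); apply: le_trans (ler_norm _).
apply: le_trans (has_sum_partial y0 yP (undup_uniq G0)).
rewrite big_seq [leRHS]big_seq; apply: ler_sum => i iG.
have -> // : lsrc i.1 i.2 \in W.
by rewrite mem_undup; apply/mapP; exists i.
Qed.

(** The paths of length 0 reproduce the masses [psi(p_v)] for [v] in [F] exactly; all longer paths
    together contribute at most [d] times the total of these masses. *)
Lemma path_sum_near (d : R) : (forall v, v \in F -> forall L : seq (seq (edge E)), uniq L ->
    {in L, forall l, lpath v l && (l != [::])} -> \sum_(l <- L) lweight N b l <= d) ->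
  (forall w, nrm (path_sum (p w) - (if w \in F then c w else 0)%:C) <= d * \sum_(v <- F) c v) /\
  `|path_mass - \sum_(v <- F) c v| <= d * \sum_(v <- F) c v.
Proof.
move=> Hd; pose F0 : seq path := [seq (v, [::]) | v <- F].
have uF0 : uniq F0 by rewrite map_inj_uniq// => v w [].
have coef0 v : v \in F -> path_coef (v, [::]) = 1.
  by move=> vF; rewrite /path_coef /= vF lweight_nil.
have tail (G : seq path) : uniq G -> {in G, forall i, i \notin F0} ->
    \sum_(i <- G) path_coef i * c i.1 <= d * \sum_(v <- F) c v.
  move=> uG GF0; rewrite mulrC mulr_suml; apply: (@path_coef_le (fun l => l != [::])) => //.
  by move=> [v l] /GF0 /= vl vF; apply: contraNneq vl => ->; rewrite map_f.
split=> [w|].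
  have TF0 : \sum_(i <- F0) (path_coef i)%:C * T i (p w) = (if w \in F then c w else 0)%:C.
    rewrite big_map big_seq (eq_bigr (fun v => if w == v then psi (p w) else 0)); last first.
      move=> v vF; rewrite coef0// mul1r /T (path_functional_vproj fam psi_ground)//=.
      by case: eqP => // ->.
    rewrite -big_seq; case: ifP => wF.
      rewrite (bigD1_seq w)//= eqxx big1 ?addr0 => [|v]; first exact: (vproj_pos fam).
      by rewrite eq_sym => /negbTE ->.
    by rewrite big_seq big1// => v vF; case: eqP => // wE; rewrite wE vF in wF.
  rewrite -TF0; apply: has_sum_tail (path_sumP _) uF0 _ => G uG GF0.
  apply: (le_trans (path_term_bound G _)); apply: le_trans (tail G uG GF0).
  rewrite ler_piMr ?(nrm_vproj fam)// sumr_ge0// => i _.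
  by rewrite mulr_ge0 ?path_coef_ge0.
have -> : \sum_(v <- F) c v = \sum_(i <- F0) path_coef i * c i.1.
  by rewrite big_map; apply: eq_big_seq => v vF; rewrite coef0// mul1r.
rewrite -nrm_real rmorphB rmorph_sum /= -[X in d * X](_ : \sum_(v <- F) c v = _); last first.
  by rewrite big_map; apply: eq_big_seq => v vF; rewrite coef0// mul1r.
apply: has_sum_tail path_massP uF0 _ => G uG GF0.
apply: le_trans (tail G uG GF0); apply: ler_sum => i _.
by rewrite nrm_real ger0_norm// mulr_ge0 ?path_coef_ge0.
Qed.

End PathSums.

(** * From relations on generators to the KMS condition *)

Section KMSFromGenerators.
Context {R : realType} {E : digraph} {V : set (vertex E)} {A : cstarAlgType R}.
Context {s : edge E -> A} {p : vertex E -> A} (fam : graph_family V s p).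
Context (gen : forall D : set A, closed_star_subalgebra D ->
  (forall e, D (s e)) -> (forall v, D (p v)) -> D = setT).
Context (N : edge E -> R) (N_gt1 : forall e, 1 < N e).
Context (sigma : R -> A -> A) (sigma_hom : forall t, star_hom (sigma t)).
Context (sigma_s : forall t e, sigma t (s e) = powRi (N e) t *: s e).
Context (sigma_p : forall t v, sigma t (p v) = p v).
Context (b : R) (b0 : 0 < b) (phi : A -> R[i]) (phi_state : state phi).
Context (phi_s : forall e a, phi (s e ** a) = (N e `^ (- b))%:C * phi (a ** s e)).
Context (phi_p : forall v a, phi (p v ** a) = phi (a ** p v)).
Context (phi_inv : forall t a, phi (sigma t a) = phi a).

Let phi_lin : scalar phi. Proof. by case: phi_state. Qed.
Let phi_pos : forall a, 0 <= phi (a^# ** a). Proof. exact: state_pos. Qed.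

(* The set of [y] satisfying the KMS condition against all analytic elements is
   stable under left multiplication by a generator [g] with
   [sigma_{ib}(g) = q g], since [a (g y) = (a g) y] and [a g] is analytic. *)
Lemma kms_of_generators : kms_state sigma b phi.
Proof.
split=> //; [exact: ltW|by move=> h; move: (b0); rewrite h ltxx|move=> _ x y f xf _].
pose K := [set y | forall a f, entire_extension sigma a f ->
  phi (a ** y) = phi (y ** f (0 +i* b))].
suff : K y by apply; exact: xf.
pose good g := exists2 L, eigenvector sigma L g &
  forall a, phi (g ** a) = (expR (- (L * b)))%:C * phi (a ** g).
have good_p v : good (p v).
  exists 0; first exact: eigenvector_vproj.
  by move=> a; rewrite mul0r oppr0 expR0 mul1r.
have good_s e : good (s e).
  exists (ln (N e)); first exact: eigenvector_edge.
  by move=> a; rewrite (expR_ln_N N_gt1) phi_s.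
have ss_rel e a : phi (a ** (s e)^#) = (N e `^ (- b))%:C * phi ((s e)^# ** a).
  have h1 : phi (a ** (s e)^#) = (phi (s e ** a^#))^*.
    by have := positive_hermitian phi_lin phi_pos (s e)^# a^#; rewrite !cstarK.
  by rewrite h1 phi_s (positive_hermitian phi_lin phi_pos a (s e)) rmorphM /= oppr0.
have good_ss e : good (s e)^#.
  exists (- ln (N e)); first exact: eigenvector_edge_star.
  move=> a; rewrite ss_rel mulrA -rmorphM /= -(expR_ln_N N_gt1) -expRD.
  by rewrite mulNr opprK subrr expR0 mul1r.
have Kmul g z : good g -> K z -> K (g ** z).
  move=> [L Hg gE] Kz a h ah.
  rewrite cmulA (Kz _ _ (entire_extensionM sigma_hom Hg ah)) /= cexp_imaginary.
  by rewrite cmulZr (functionalZ phi_lin) cmulA -gE cmulA.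
(* Because [phi] and [p v] are invariant, [phi(p_v h(z))] is constant on the real line, hence takes
   the same value at [ib]. *)
have Kp v : K (p v).
  move=> a h [dh ha]; rewrite -phi_p; apply/esym.
  apply: (@entire_constant _ (fun z => phi (p v ** h z))) => // [z|t].
    have lin : linear (fun z : A => phi (p v ** z) : R[i]^o).
      by move=> k w w'; rewrite cmulDr cmulZr phi_lin.
    apply: (@derivable_linear R A R[i]^o h z (fun y => phi (p v ** y)) 1 ler01 lin) => [w|];
      last exact: dh.
    apply: (le_trans (state_bounded phi_state _)); apply: (le_trans (nrm_cmul _ _)).
    by rewrite ler_wpM2r ?nrm_ge0 ?(nrm_vproj fam).
  have [_ sM _] := sigma_hom t.
  by rewrite ha -{1}[p v](sigma_p t) -sM phi_inv.
apply: (gen_induction fam gen (N := K)) => //.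
- apply: closed_nrmP => z Kz a h ah.
  apply/eqP; rewrite -subr_eq0; apply/eqP/nrm_eq0/eqP; rewrite eq_le nrm_ge0 andbT.
  apply/ler_addgt0Pr => e e0; rewrite add0r.
  pose M := 1 + nrm a + nrm (h (0 +i* b)).
  have M0 : 0 < M by rewrite /M -addrA ltr_pwDl// addr_ge0 ?nrm_ge0.
  have [d Kd zd] := Kz _ (divr_gt0 e0 M0).
  have -> : phi (a ** z) - phi (z ** h (0 +i* b)) =
      phi (a ** (z - d)) - phi ((z - d) ** h (0 +i* b)).
    rewrite cmulBr cmulBl !(functionalB phi_lin) (Kd a h ah).
    by rewrite opprB addrA subrK.
  apply: (le_trans (nrmB _ _)).
  have h1 := le_trans (state_bounded phi_state (a ** (z - d))) (nrm_cmul _ _).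
  have h2 := le_trans (state_bounded phi_state ((z - d) ** h (0 +i* b))) (nrm_cmul _ _).
  rewrite ltr_pdivlMr// /M in zd; have := nrm_ge0 (z - d); lra.
- by move=> a h _; rewrite cmul0l cmul0r.
- move=> k z w Kz Kw a h ah.
  by rewrite cmulDr cmulZr cmulDl cmulZl !phi_lin (Kz _ _ ah) (Kw _ _ ah).
- by move=> e z; exact: Kmul.
- by move=> e z; exact: Kmul.
- by move=> v z; exact: Kmul.
- move=> e a h ah; have := Kmul _ _ (good_ss e) (Kp (src e)) a h ah.
  (* [s_e^# p_{s(e)}] lies in [K]; the projection is then removed under [phi], on one side by
     [edge_src_null_star] and on the other after commuting it around. *)
  have red w : phi ((s e)^# ** p (src e) ** w) = phi ((s e)^# ** w).
    have := edge_src_null_star fam e (src e) w (p (rng e)) phi_lin phi_pos.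
    by rewrite eqxx (edge_rng_star fam).
  by rewrite red cmulA -phi_p cmulA ss_rel cmulA red -ss_rel.
Qed.

End KMSFromGenerators.

Section SmallWeights.
Context {R : realType} {E : digraph} (N : edge E -> R) (N_gt1 : forall e, 1 < N e).
Implicit Types (v : vertex E) (l : seq (edge E)).

Lemma powRN_small (x e : R) : 1 < x -> 0 < e ->
  exists b0, forall b, b0 <= b -> x `^ (- b) <= e.
Proof.
move=> x1 e0; have x0 : 0 < x by exact: lt_trans x1.
have lx : 0 < ln x by rewrite ln_gt0.
exists (e^-1 / ln x) => b hb.
rewrite /powR gt_eqF// mulNr expRN invf_ple ?posrE ?expR_gt0//.
apply: le_trans (expR_ge1Dx _); rewrite ler_pdivrMr// in hb.
by apply: (le_trans hb); rewrite lerDr.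
Qed.

Lemma lweight_le l (b b' : R) : b <= b' -> lweight N b' l <= lweight N b l.
Proof. by move=> bb; rewrite /lweight ler_powR ?prodN_ge1// lerN2. Qed.

Lemma lweight_sum_small (L : seq (seq (edge E))) (e : R) : 0 < e ->
  {in L, forall l, l != [::]} ->
  exists b0, forall b, b0 <= b -> \sum_(l <- L) lweight N b l <= e.
Proof.
elim: L e => [|l L ih] e e0 HL; first by exists 0 => b _; rewrite big_nil ltW.
have e2 : 0 < e / 2 by rewrite divr_gt0.
have [|b1 H1] := ih _ e2; first by move=> l' l'L; apply: HL; rewrite inE l'L orbT.
have l1 : 1 < \prod_(e <- l) N e by apply: prodN_gt1 => //; apply: HL; rewrite mem_head.
have [b2 H2] := powRN_small l1 e2; exists (Num.max b1 b2) => b.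
rewrite ge_max big_cons => /andP[/H1 h1 /H2 h2]; rewrite /lweight in h1 *; lra.
Qed.

(** Dominated convergence by hand: a finite set [L0] of paths carries the sum at [b1] up to [d / 2].
    Outside [L0] the weights only decrease with [b], and on [L0] they tend to 0 since the length is
    positive. *)
Lemma partition_tail_small v (d : R) : (critical_beta N v < +oo)%E -> 0 < d ->
  exists b0, forall b, b0 <= b -> forall L : seq (seq (edge E)), uniq L ->
    {in L, forall l, lpath v l && (l != [::])} -> \sum_(l <- L) lweight N b l <= d.
Proof.
move=> /ereal_inf_lt[_ [b1 [_ fin] <-] _] d0.
have [B HB] := partition_function_finite fin.
pose ok L := uniq L /\ {in L, forall l, lpath v l && (l != [::])}.
pose S := [set \sum_(l <- L) lweight N b1 l | L in [set L | ok L]].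
have ubS : ubound S B.
  by move=> _ [L [uL HL] <-]; apply: HB => // l /HL /andP[].
have hS : has_sup S by split; [exists (\sum_(l <- [::]) lweight N b1 l), [::]|exists B].
have d2 : 0 < d / 2 by rewrite divr_gt0.
have [_ [L0 [uL0 HL0] <-] hL0] := sup_adherent d2 hS.
have [|b2 Hb2] := @lweight_sum_small L0 _ d2; first by move=> l /HL0 /andP[].
exists (Num.max b1 b2) => b; rewrite ge_max => /andP[b1b b2b] L uL HL.
pose L1 := [seq l <- L | l \notin L0].
have okL : ok (L0 ++ L1).
  split.
    rewrite cat_uniq uL0 filter_uniq// andbT.
    by apply/hasPn => l; rewrite mem_filter => /andP[].
  by move=> l; rewrite mem_cat mem_filter => /orP[/HL0//|/andP[_ /HL]].
have h1 : \sum_(l <- L0 ++ L1) lweight N b1 l <= sup S.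
  by apply: ub_le_sup; [exists B|exists (L0 ++ L1)].
rewrite big_cat /= in h1.
have h2 : \sum_(l <- L1) lweight N b l <= \sum_(l <- L1) lweight N b1 l.
  by apply: ler_sum => l _; exact: lweight_le.
have h3 : \sum_(l <- L) lweight N b l <= \sum_(l <- L0 ++ L1) lweight N b l.
  have pL : perm_eq (L ++ [seq l <- L0 | l \notin L]) (L0 ++ L1).
    apply: uniq_perm.
    - rewrite cat_uniq uL filter_uniq// andbT.
      by apply/hasPn => l; rewrite mem_filter => /andP[].
    - by case: okL.
    - move=> l; rewrite !mem_cat !mem_filter.
      by case: (l \in L); case: (l \in L0).
  by rewrite -(perm_big _ pL) big_cat /= lerDl sumr_ge0// => l _; rewrite ltW// lweight_gt0.
rewrite big_cat /= in h3; have := Hb2 b b2b; clear -hL0 h1 h2 h3; lra.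
Qed.

End SmallWeights.

(** * Approximation of a ground state by KMS states *)

Section Approximation.
Context {R : realType} {E : digraph} {V : set (vertex E)} {A : cstarAlgType R}.
Context {s : edge E -> A} {p : vertex E -> A} (fam : graph_family V s p).
Context (gen : forall D : set A, closed_star_subalgebra D ->
  (forall e, D (s e)) -> (forall v, D (p v)) -> D = setT).
Context (N : edge E -> R) (N_gt1 : forall e, 1 < N e).
Context (sigma : R -> A -> A) (sigma_hom : forall t, star_hom (sigma t)).
Context (sigma_s : forall t e, sigma t (s e) = powRi (N e) t *: s e).
Context (sigma_p : forall t v, sigma t (p v) = p v).
Context (psi : A -> R[i]) (psi_ground : ground_state sigma psi).
Context (crit : forall v, psi (p v) <> 0 -> (critical_beta N v < +oo)%E).

Let psi_state : state psi. Proof. by case: psi_ground. Qed.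
Let psi_lin : scalar psi. Proof. by case: psi_state. Qed.
Let psi_pos : forall a, 0 <= psi (a^# ** a). Proof. exact: state_pos. Qed.
Let c v : R := complex.Re (psi (p v)).
Let c_ge0 v : 0 <= c v. Proof. exact: (vproj_ge0 fam). Qed.

Let masses := [set \sum_(v <- F) c v | F in [set F : seq (vertex E) | uniq F]].
Let csup := sup masses.

Let has_sup_masses : has_sup masses.
Proof.
split; first by exists (\sum_(v <- [::]) c v), [::].
by exists 1 => _ [F uF <-]; exact: (state_mass fam).
Qed.

Let masses_le (F : seq (vertex E)) : uniq F -> \sum_(v <- F) c v <= csup.
Proof. by move=> uF; apply: sup_upper_bound => //; exists F. Qed.

Let csup_le1 : csup <= 1.
Proof.
apply: ge_sup; first by case: has_sup_masses.
by move=> _ [F uF <-]; exact: (state_mass fam).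
Qed.

(** The tolerance at stage [n]. Starting at 1/2 keeps the normalising masses [K n] away from 0. *)
Let d (n : nat) : R := n.+2%:R^-1.

Let d_gt0 n : 0 < d n. Proof. by rewrite invr_gt0. Qed.

Let d_le n : d n <= 1/2.
Proof. by rewrite /d mul1r lef_pV2 ?posrE// ler_nat. Qed.

Let d_small (e : R) : 0 < e -> exists n0, forall n, (n0 <= n)%N -> d n <= e.
Proof.
move=> e0; exists (Num.bound e^-1) => n hn.
rewrite /d invf_ple ?posrE//; apply: ltW; apply: (lt_le_trans (archi_boundP _)).
  by rewrite invr_ge0 ltW.
by rewrite ler_nat (leq_trans hn)// !leqW.
Qed.

Lemma approximating_vertices n : exists F, [/\ uniq F,
  {in F, forall v, psi (p v) <> 0} & csup - d n < \sum_(v <- F) c v].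
Proof.
have [_ [F uF <-] hF] := sup_adherent (d_gt0 n) has_sup_masses.
exists [seq v <- F | psi (p v) != 0]; split; first exact: filter_uniq.
  by move=> v; rewrite mem_filter => /andP[/eqP].
rewrite big_filter big_mkcond /= (eq_bigr c)// => v _.
by case: eqP => //= h; rewrite /c h.
Qed.

Lemma approximating_temperature n (F : seq (vertex E)) :
  {in F, forall v, psi (p v) <> 0} ->
  exists2 b, n.+1%:R <= b & forall v, v \in F -> forall L : seq (seq (edge E)), uniq L ->
    {in L, forall l, lpath v l && (l != [::])} -> \sum_(l <- L) lweight N b l <= d n.
Proof.
elim: F => [|v F ih] HF; first by exists n.+1%:R.
have [w wF|b hb Hb] := ih; first by apply: HF; rewrite inE wF orbT.
have [b1 Hb1] := partition_tail_small N_gt1 (crit (HF v (mem_head _ _))) (d_gt0 n).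
exists (Num.max b b1) => [|w]; first by rewrite le_max hb.
rewrite inE => /orP[/eqP ->|wF]; first by apply: Hb1; rewrite le_max lexx orbT.
move=> L uL HL; apply: le_trans (Hb w wF L uL HL); apply: ler_sum => l _.
by apply: lweight_le => //; rewrite le_max lexx.
Qed.

Lemma ground_kms_infty : kms_infty_state sigma psi.
Proof.
have /choice[F HF] := approximating_vertices.
have /choice[b Hb] : forall n, exists b, n.+1%:R <= b /\
    forall v, v \in F n -> forall L : seq (seq (edge E)), uniq L ->
    {in L, forall l, lpath v l && (l != [::])} -> \sum_(l <- L) lweight N b l <= d n.
  by move=> n; have [_ /approximating_temperature] := HF n => /(_ n)[b hb Hb] _; exists b.
have uF n : uniq (F n) by have [] := HF n.
have b_gt0 n : 0 < b n by apply: lt_le_trans (Hb n).1.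
(* The path of length 0 has weight 1 and all others together at most [d n]. *)
have summ n v : v \in F n -> exists B, forall L : seq (seq (edge E)), uniq L ->
    {in L, forall l, lpath v l} -> \sum_(l <- L) lweight N (b n) l <= B.
  move=> vF; exists (1 + d n) => L uL HL.
  rewrite (bigID (fun l => l == [::])) /= lerD//.
    rewrite -big_filter; have [nL|nL] := boolP ([::] \in L).
      by rewrite filter_pred1_uniq// big_seq1 lweight_nil.
    have -> : [seq l <- L | l == [::]] = [::].
      apply/eqP; rewrite -[_ == _]negbK -has_filter; apply/hasPn => l lL.
      by apply: contraNneq nL => <-.
    by rewrite big_nil.
  rewrite -big_filter; apply: (Hb n).2 vF _ _ _; first by rewrite filter_uniq.
  by move=> l; rewrite mem_filter => /andP[-> /HL ->].
pose Phi n := @path_sum R E A s p N psi (b n) (F n).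
pose K n := @path_mass R E A p N psi (b n) (F n).
pose C n := \sum_(v <- F n) c v.
have C_le n : C n <= csup by exact: masses_le.
have C_ge0 n : 0 <= C n by rewrite sumr_ge0.
have C_gt n : csup - d n < C n by have [] := HF n.
have Phi_lin n : scalar (Phi n) := path_sum_linear fam N_gt1 psi_ground (uF n) (summ n).
have Phi_pos n a : 0 <= Phi n (a^# ** a) := path_sum_pos fam N_gt1 psi_ground (uF n) (summ n) a.
have Phi_bnd n a : nrm (Phi n a) <= K n * nrm a :=
  path_sum_bound fam N_gt1 psi_ground (uF n) (summ n) a.
have Phi_s n e a : Phi n (s e ** a) = (N e `^ (- b n))%:C * Phi n (a ** s e) :=
  path_sum_edge fam gen N_gt1 sigma_hom sigma_s sigma_p psi_ground (uF n) (summ n) e a.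
have Phi_p n v a : Phi n (p v ** a) = Phi n (a ** p v) :=
  path_sum_vproj fam N_gt1 psi_ground (uF n) (summ n) v a.
have Phi_inv n t a : Phi n (sigma t a) = Phi n a :=
  path_sum_invariant fam gen N_gt1 sigma_hom sigma_s sigma_p psi_ground (uF n) (summ n) t a.
have Phi_mass n e : 0 < e -> exists2 a, nrm a <= 1 & K n - e <= nrm (Phi n a) :=
  @path_sum_mass _ _ _ _ _ _ fam _ N_gt1 _ _ psi_ground _ _ (uF n) (summ n) e.
have near n := path_sum_near fam N_gt1 psi_ground (uF n) (summ n) (Hb n).2.
have dC n : d n * C n <= d n.
  by rewrite ler_piMr ?(ltW (d_gt0 n))//; apply: le_trans (C_le n) csup_le1.
have Phi_near n w : nrm (Phi n (p w) - (if w \in F n then c w else 0)%:C) <= d n.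
  by apply: le_trans (dC n); have [+ _] := near n; apply.
have K_near n : `|K n - C n| <= d n * C n by have [] := near n.
have K_le2 n : K n <= 2.
  have := K_near n; rewrite ler_norml => /andP[_].
  have := dC n; have := d_le n; have := C_le n; have := csup_le1; lra.
have K_ge0 n : 0 <= K n.
  have : d n * C n <= 1/2 * C n by rewrite ler_wpM2r.
  have := K_near n; have := C_ge0 n; rewrite ler_norml; lra.
have Phi_to_psi a : tends0 (fun n => Phi n a - psi a).
  have small_s e x : tends0 (fun n => Phi n (s e ** x)).
    move=> r r0; have M0 : 0 < 1 + 2 * nrm x by rewrite ltr_pwDl ?mulr_ge0 ?nrm_ge0.
    have [b0 Hb0] := powRN_small (N_gt1 e) (divr_gt0 r0 M0).
    exists (Num.bound `|b0|) => n hn.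
    have b0n : b0 <= b n.
      apply: (le_trans (ler_norm _)); apply: le_trans (Hb n).1.
      apply: ltW; apply: (lt_le_trans (archi_boundP (normr_ge0 _))).
      by rewrite ler_nat (leq_trans hn).
    rewrite Phi_s nrmM nrm_real ger0_norm ?powR_ge0//.
    have h1 : nrm (Phi n (x ** s e)) <= 1 + 2 * nrm x.
      apply: (le_trans (Phi_bnd _ _)).
      apply: (@le_trans _ _ (2 * nrm x)); last by rewrite lerDr.
      apply: ler_pM => //; first exact: nrm_ge0.
      apply: (le_trans (nrm_cmul _ _)).
      by rewrite ler_piMr ?nrm_ge0 ?(nrm_edge fam).
    apply: (@le_trans _ _ (r / (1 + 2 * nrm x) * (1 + 2 * nrm x))).
      by rewrite ler_pM ?powR_ge0 ?nrm_ge0 ?Hb0.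
    by rewrite divfK// gt_eqF.
  have small_ps e w x : tends0 (fun n => Phi n (p w ** s e ** x)).
    by under eq_fun do rewrite -cmulA Phi_p -cmulA; exact: small_s.
  have conj_small y y' : (forall n, Phi n y = (Phi n y')^*) ->
      tends0 (fun n => Phi n y') -> tends0 (fun n => Phi n y).
    move=> yy H r r0; have [n0 Hn] := H r r0; exists n0 => n /Hn.
    by rewrite yy nrm_conj.
  pose theta n x := Phi n x - psi x.
  have to_Phi x : psi x = 0 -> tends0 (fun n => Phi n x) -> tends0 (fun n => theta n x).
    move=> x0; rewrite (_ : (fun n => theta n x) = fun n => Phi n x)//.
    by apply/funext => n; rewrite /theta x0 subr0.
  apply: (vanishing_functionals fam gen (theta := theta) (C := 3)) => //.
  - move=> n k x y; rewrite /theta Phi_lin psi_lin.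
    by rewrite opprD addrACA mulrBr.
  - move=> n x; apply: (le_trans (nrmB _ _)).
    have h1 := state_bounded psi_state x; have h2 := Phi_bnd n x.
    have h3 := ler_wpM2r (nrm_ge0 x) (K_le2 n); lra.
  - move=> n e w x y; rewrite /theta.
    rewrite (edge_src_null fam _ _ _ _ psi_lin psi_pos).
    rewrite (edge_src_null fam _ _ _ _ (Phi_lin n) (Phi_pos n)).
    by case: ifP => //; rewrite subrr.
  - move=> e x; apply: to_Phi => //.
    exact: (ground_edge fam gen N_gt1 sigma_hom sigma_s sigma_p psi_ground).
  - move=> e w x; apply: to_Phi => //.
    exact: (ground_vproj_edge fam gen N_gt1 sigma_hom sigma_s sigma_p psi_ground).
  - move=> e x; apply: to_Phi.
      exact: (ground_edge_star fam gen N_gt1 sigma_hom sigma_s sigma_p psi_ground).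
    apply: (conj_small _ (s e ** x^#)) => // n.
    by have := positive_hermitian (Phi_lin n) (Phi_pos n) (s e)^# x^#; rewrite !cstarK.
  - move=> e w x; apply: to_Phi.
      exact: (ground_edge_star_vproj fam gen N_gt1 sigma_hom sigma_s sigma_p psi_ground).
    apply: (conj_small _ (p w ** s e ** x^#)) => // n.
    have := positive_hermitian (Phi_lin n) (Phi_pos n) ((s e)^# ** p w) x^#.
    by rewrite !cstarK cstarM cstarK (vproj_star fam) !cmulA.
  - move=> w r r0; have [n0 Hn] := d_small (divr_gt0 r0 (ltr0n R 2)).
    exists n0 => n /Hn dr; rewrite /theta.
    have -> : psi (p w) = (c w)%:C := vproj_pos fam w psi_state.
    set k := if w \in F n then c w else 0.
    (* If [w] is outside [F n], then [w :: F n] still has mass at most [csup], so [c w] is below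
       [d n]. *)
    have kd : `|k - c w| <= d n.
      rewrite /k; case: ifP => wF; first by rewrite subrr normr0 ltW.
      rewrite sub0r normrN ger0_norm//.
      have := @masses_le (w :: F n); rewrite /= wF uF big_cons => /(_ isT).
      have := C_gt n; rewrite -/(C n); lra.
    have -> : Phi n (p w) - (c w)%:C = (Phi n (p w) - k%:C) + (k - c w)%:C.
      by rewrite rmorphB addrA subrK.
    apply: (le_trans (nrmD _ _)); rewrite nrm_real.
    have := Phi_near n w; rewrite -/k; lra.
have csup_ge0 : 0 <= csup by apply: le_trans (C_ge0 0%N) (C_le 0%N).
(* The norms [K n] are at most [csup + d n], so the limit [psi] has norm at most [csup]. Since a
   state has norm 1, the vertex masses lose nothing: [csup = 1]. *)
have psi_le a : nrm (psi a) <= csup * nrm a.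
  apply/ler_addgt0Pr => e e0; have a1 : 0 < 1 + nrm a by rewrite ltr_pwDl ?nrm_ge0.
  have e2 : 0 < e / 2 by rewrite divr_gt0.
  have [n1 H1] := Phi_to_psi a _ e2; have [n2 H2] := d_small (divr_gt0 e2 a1).
  pose n := maxn n1 n2; have h1 := H1 n (leq_maxl _ _); have h2 := H2 n (leq_maxr _ _).
  apply: (le_trans (nrm_dist _ (Phi n a))); rewrite nrm_distC.
  rewrite ler_pdivlMr// in h2.
  have Kc : K n <= csup + d n.
    by have := K_near n; rewrite ler_norml; have := dC n; have := C_le n; lra.
  have := le_trans (Phi_bnd n a) (ler_wpM2r (nrm_ge0 a) Kc).
  have := d_gt0 n; lra.
have csup1 : csup = 1.
  by apply/eqP; rewrite eq_le csup_le1 (state_le_bound psi_state psi_le).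
have K_gt n : 1 / 4 <= K n.
  have h1 := C_gt n; have h2 := d_le n; rewrite csup1 in h1.
  have : d n * C n <= 1/2 * C n by rewrite ler_wpM2r.
  have := K_near n; rewrite ler_norml; lra.
have K0 n : 0 < K n by apply: lt_le_trans (K_gt n).
pose phi n a := ((K n)^-1)%:C * Phi n a.
have KVn n : nrm ((K n)^-1)%:C = (K n)^-1 by rewrite nrm_real ger0_norm// invr_ge0 ltW.
have phi_state n : state (phi n).
  apply: mk_state.
  - by move=> k x y; rewrite /phi Phi_lin mulrDr mulrCA.
  - by move=> a; rewrite mulr_ge0// ler0c invr_ge0 ltW.
  - by move=> a; rewrite nrmM KVn mulrC ler_pdivrMr// mulrC.
  - move=> e e0; have [a a1 ha] := Phi_mass n _ (mulr_gt0 e0 (K0 n)).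
    exists a => //; rewrite nrmM KVn mulrC ler_pdivlMr// mulrBl mul1r.
    exact: ha.
split=> //; exists b, phi; split.
- move=> n; apply: (kms_of_generators fam gen N_gt1 sigma_hom sigma_s sigma_p) => //.
  + by move=> e a; rewrite /phi Phi_s mulrCA.
  + by move=> v a; rewrite /phi Phi_p.
  + by move=> t a; rewrite /phi Phi_inv.
- apply/cvgryPge => M; exists (Num.bound `|M|) => // n /= hn.
  apply: le_trans (Hb n).1; apply: (le_trans (ler_norm _)).
  apply: ltW; apply: (lt_le_trans (archi_boundP (normr_ge0 _))).
  by rewrite ler_nat (leq_trans hn).
- move=> a; apply/cvg_nrmP => e e0.
  have a1 : 0 < 1 + nrm (psi a) by rewrite ltr_pwDl ?nrm_ge0.
  (* Dividing by [K n >= 1/4] costs a factor 4; the numerator is at most [3 e / 16], one part from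
     [Phi n a - psi a] and two from [|K n - 1| <= 2 d n]. *)
  have e8 : 0 < e / 16 by rewrite divr_gt0.
  have [n1 H1] := Phi_to_psi a _ e8.
  have [n2 H2] := d_small (divr_gt0 e8 a1).
  exists (maxn n1 n2) => // n /=; rewrite geq_max => /andP[/H1{}H1 /H2{}H2].
  have -> : psi a - phi n a =
      ((K n)^-1)%:C * ((K n - 1)%:C * psi a - (Phi n a - psi a)).
    rewrite rmorphB rmorph1 mulrBl mul1r opprB addrA subrK mulrBr mulrA -rmorphM /=.
    by rewrite mulVf ?gt_eqF// rmorph1 mul1r.
  rewrite nrmM KVn mulrC ler_pdivrMr//.
  apply: (le_trans (nrmB _ _)); rewrite nrmM nrm_real.
  have K1 : `|K n - 1| <= d n + d n.
    have := K_near n; have := dC n; have := C_gt n; have := C_le n.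
    rewrite csup1 !ler_norml; lra.
  have h1 := ler_wpM2r (nrm_ge0 (psi a)) K1.
  rewrite ler_pdivlMr// in H2.
  have h2 : e * (1/4) <= e * K n by rewrite ler_wpM2l// ltW.
  have := d_gt0 n; lra.
Qed.

End Approximation.

Unset Implicit Arguments.

Theorem theorem6p1 (R : realType) (E : digraph) (V : set (vertex E))
    (V_reg : V `<=` @regular E) (N : edge E -> R) (N_gt1 : forall e, 1 < N e)
    (A : cstarAlgType R) (s : edge E -> A) (p : vertex E -> A)
    (A_univ : is_relative_graph_algebra V s p)
    (sigma : R -> A -> A) (sigma_dyn : dynamics sigma)
    (sigma_s : forall t e, sigma t (s e) = powRi (N e) t *: s e)
    (sigma_p : forall t v, sigma t (p v) = p v)
    (psi : A -> R[i]) (psi_ground : ground_state sigma psi) :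
  kms_infty_state sigma psi <->
  forall v, psi (p v) <> 0 -> (critical_beta N v < +oo)%E.
Proof.
have [fam gen _] := A_univ.
have sigma_hom t : star_hom (sigma t) by have [+ _ _ _] := sigma_dyn; move=> /(_ t)[].
split=> [[_ [b [phi [kms binf conv]]]] v pv|crit]; last first.
  exact: (ground_kms_infty fam gen N_gt1 sigma_hom sigma_s sigma_p psi_ground crit).
have /cvg_nrmP conv_v := conv (p v).
have n0 : 0 < nrm (psi (p v)) / 2 by rewrite divr_gt0// nrm_gt0//; apply/eqP.
have [n1 _ H1] := conv_v _ n0.
have /cvgryPgt /(_ 0) [n2 _ H2] := binf.
(* A single index suffices: [phi n (p v)] is within half the modulus of [psi (p v)], hence nonzero,
   and [b n] is positive. *)
pose n := maxn n1 n2; have b0 : 0 < b n := H2 n (leq_maxr _ _).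
apply: (kms_critical_beta fam N_gt1 sigma_hom sigma_s sigma_p (kms n) b0).
move=> phi0; have := H1 n (leq_maxl _ _); rewrite /= phi0 subr0; lra.
Qed.
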